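(* Let $N\ge1$ be an integer, $k>0$ a real number, and $f\in H_N(D)$. 1. If $f\in H_N^k(D)$, then there exist a function $F:\mathbb{C}\to\mathbb{C}$ of class $C^\infty$ on $\mathbb{C}$ with compact support and constants $C_1,C_2>0$ such that $F|_D=f$ and $$\left|\left(\frac{\partial}{\partial\overline z}\right)^NF(z)\right|\le C_1\exp\left[-C_2(|z|-1)^{-k}\right]\quad\text{for all } z\in\mathbb{C}\setminus\overline D.$$ 2. Conversely, if there exist an open neighborhood $\mathcal{U}$ of the closed unit disk $\overline D$, a function $F:\mathcal{U}\to\mathbb{C}$ of class $C^\infty$ on $\mathcal{U}$ and constants $C_1,C_2>0$ such that $F|_D=f$ and $$\left|\left(\frac{\partial}{\partial\overline z}\right)^NF(z)\right|\le C_1\exp\left[-C_2(|z|-1)^{-k}\right]\quad\text{for all } z\in\mathcal{U}\setminus\overline D,$$ then $f\in H_N^k(D)$.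
   Context: $D=\{z\in\mathbb{C}:|z|<1\}$ and $\overline D$ is its closure. With $z=x+iy$, $\frac{\partial}{\partial\overline z}=\frac12\left(\frac{\partial}{\partial x}+i\frac{\partial}{\partial y}\right)$, and for $\alpha=(\alpha_1,\alpha_2)\in\mathbb{N}^2$ (with $0\in\mathbb{N}$), $|\alpha|=\alpha_1+\alpha_2$ and $D^\alpha=\frac{\partial^{|\alpha|}}{\partial x^{\alpha_1}\partial y^{\alpha_2}}$. For a function $h$ on a nonempty set $E\subset\mathbb{C}$, $\|h\|_{\infty,E}=\sup_{u\in E}|h(u)|$. $H_N(D)$ (polyanalytic functions of order $N$ on $D$) is the set of functions $F:D\to\mathbb{C}$ of class $C^N$ with $\left(\frac{\partial}{\partial\overline z}\right)^NF=0$ on $D$; such functions are automatically $C^\infty$. The Gevrey polyanalytic class $H_N^k(D)$ is the set of $f\in H_N(D)$ for which there is a constant $B>0$ with $\|D^\alpha f\|_{\infty,D}\le B^{|\alpha|+1}|\alpha|^{(1+\frac1k)|\alpha|}$ for all $\alpha\in\mathbb{N}^2$ (convention $0^0=1$). *)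

(* Defs.v *)
From Stdlib Require Import Reals List.
From Coquelicot Require Import Coquelicot.
Open Scope R_scope.

(* A function on an open subset U of the plane is encoded as a total function
   [C -> C] of which only the values on U matter: every notion below, taken at
   a point of U, depends only on the values of the function near that point. *)

Definition closure {T : UniformSpace} (A : T -> Prop) (z : T) : Prop :=
  forall P : T -> Prop, locally z P -> exists w, P w /\ A w.

Definition is_compact {T : UniformSpace} (K : T -> Prop) : Prop :=
  forall (I : Type) (V : I -> T -> Prop),
    (forall i, open (V i)) ->
    (forall z, K z -> exists i, V i z) ->
    exists l : list I, forall z, K z -> exists i, In i l /\ V i z.

Definition compactly_supported (F : C -> C) : Prop :=
  is_compact (closure (fun z => F z <> RtoC 0)).

Definition unit_disk (z : C) : Prop := Cmod z < 1.

(* The supremum is taken in the extended reals: it is [p_infty] when [h] is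
   unbounded on [E]. *)
Definition sup_norm (E : C -> Prop) (h : C -> C) : Rbar :=
  Lub_Rbar (fun r => exists u, E u /\ r = Cmod (h u)).

(* Partial derivatives, componentwise because [Derive] is real-valued; the
   values are meaningful only where [ex_dx], resp. [ex_dy], holds. *)
Definition ex_dx (f : C -> C) (z : C) : Prop :=
  ex_derive (fun t : R => Re (f (t, Im z))) (Re z) /\
  ex_derive (fun t : R => Im (f (t, Im z))) (Re z).

Definition ex_dy (f : C -> C) (z : C) : Prop :=
  ex_derive (fun t : R => Re (f (Re z, t))) (Im z) /\
  ex_derive (fun t : R => Im (f (Re z, t))) (Im z).

Definition dx (f : C -> C) (z : C) : C :=
  (Derive (fun t : R => Re (f (t, Im z))) (Re z),
   Derive (fun t : R => Im (f (t, Im z))) (Re z)).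

Definition dy (f : C -> C) (z : C) : C :=
  (Derive (fun t : R => Re (f (Re z, t))) (Im z),
   Derive (fun t : R => Im (f (Re z, t))) (Im z)).

Definition dalpha (a1 a2 : nat) (f : C -> C) : C -> C :=
  Nat.iter a1 dx (Nat.iter a2 dy f).

Definition dbar (f : C -> C) (z : C) : C :=
  (RtoC (1 / 2) * (dx f z + Ci * dy f z))%C.

(* Class C^n on an open set U: all iterated partial derivatives of order at
   most n, in any order, exist and are continuous on U. *)
Fixpoint Cn (n : nat) (U : C -> Prop) (f : C -> C) : Prop :=
  (forall z, U z -> continuous f z) /\
  match n with
  | O => True
  | S m => (forall z, U z -> ex_dx f z /\ ex_dy f z) /\
           Cn m U (dx f) /\ Cn m U (dy f)
  end.

Definition smooth (U : C -> Prop) (f : C -> C) : Prop :=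
  forall n : nat, Cn n U f.

Definition polyanalytic (N : nat) (f : C -> C) : Prop :=
  Cn N unit_disk f /\
  forall z, unit_disk z -> Nat.iter N dbar f z = RtoC 0.

(* For m = 0 the exponent is 0 and [Rpower 0 0 = exp (0 * ln 0) = 1], which is
   the convention 0^0 = 1. *)
Definition gevrey_polyanalytic (N : nat) (k : R) (f : C -> C) : Prop :=
  polyanalytic N f /\
  exists B : R, 0 < B /\
    forall a1 a2 : nat,
      let m := (a1 + a2)%nat in
      Rbar_le (sup_norm unit_disk (dalpha a1 a2 f))
              (Finite (B ^ (m + 1) * Rpower (INR m) ((1 + 1 / k) * INR m))).

Definition dbar_flat (N : nat) (k C1 C2 : R) (U : C -> Prop) (F : C -> C) :
  Prop :=
  forall z, U z -> ~ closure unit_disk z ->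
    Cmod (Nat.iter N dbar F z) <= C1 * exp (- C2 * Rpower (Cmod z - 1) (- k)).

(* Main.v *)
Require Import Defs.
From Stdlib Require Import Reals List Lra Lia Factorial.
From Stdlib Require Import FunctionalExtensionality ClassicalEpsilon.
From Coquelicot Require Import Coquelicot.
Open Scope R_scope.

(** A polyanalytic function of order [N] on the disk is a sum
      f = sum_(j < N) conj(z)^j / j! H_j
  with holomorphic components
      H_j = sum_(l < N - j) (-1)^l / l! conj(z)^l dbar^(j+l) f
  ([pcomp_sum], [pcomp_holomorphic]).  The sum defining [H_j] telescopes: for
  any smooth [F], [dbar] of its [j]-th component is [conj(z)^(N-1-j) dbar^N F]
  up to a constant factor ([dbar_pcomp]).  This reduces both implications to
  statements about the Taylor coefficients [a_n] of holomorphic functions on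
  the disk.  The link is that [f] is in the Gevrey class if and only if the
  coefficients of every component are [O (exp (- c n^b))] for some [c > 0],
  where [b = k / (k + 1)].

  If the coefficients decay in this way, then a derivative of order [m] of
  [conj(z)^j a_n z^n] is of size at most [(n + j)^m |a_n|] on the disk, and
  [n^m exp (- c n^b)] is at most [(m / (b c))^(m / b)], which is Gevrey growth
  since [1 / b = 1 + 1 / k] ([gevrey_of_decay]).  Conversely, Gevrey bounds for
  [f] give bounds [A Q^m m^((1 + 1/k) m)] for the [m]-th complex derivatives of
  the components; Cauchy's estimates for these derivatives, with [m] of the
  order of [n^b], give the decay ([coef_decay_of_gevrey]).

  From a Gevrey function to a flat extension.  A component [conj(z)^j a_n z^n]
  is multiplied by a cutoff equal to 1 for [|z|^2 - 1 <= delta_n] and to 0 for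
  [|z|^2 - 1 >= 2 delta_n], where [delta_n] is a small multiple of
  [n^(-1/(k+1))].  On the support of the cutoff [|z|^n] is at most
  [exp (c/2 n^b)], and derivatives of the cutoffs cost only powers of [n], so
  the series of the products converges with all its derivatives.  The operator
  [dbar^N] annihilates the terms with [delta_n > |z|^2 - 1]; in the others [n^b]
  is at least a constant times [(|z| - 1)^(-k)], which is the flatness
  ([flat_component]).

  From a flat extension to the Gevrey class.  By Green's formula, the radial
  derivative of the integral of [h(zeta) zeta^(-n)] over the circle of radius
  [r] is an integral of [dbar h] against [zeta^(-n)] ([ecoef_derive]).  For the
  [j]-th component [h] of the extension this integral is constant up to radius
  1, where it is [2 pi a_n]; its derivative at a radius [1 + s] is bounded by a
  multiple of [exp (- C s^(-k)) (1 + s)^(-n)], hence of [exp (- c n^b)] for all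
  [s] ([flat_W]); and at a fixed radius beyond 1 it is exponentially small in
  [n] ([coef_decay_of_flat]).

  The complex analysis used is elementary and proved along the way: Cauchy's
  formula is obtained by contracting a circle to a point ([cauchy_formula]),
  and power series are differentiated termwise by means of estimates that are
  uniform over families of functions ([Reg], [Reg_cser], [wd_cser]). *)

(* Instances of the calculus lemmas on [R], where the scalars and the space cannot
  be inferred. *)
Local Notation is_derive_const_R := (is_derive_const (V := R_NormedModule)).
Local Notation is_derive_plus_R := (is_derive_plus (V := R_NormedModule)).
Local Notation is_derive_minus_R := (is_derive_minus (V := R_NormedModule)).
Local Notation is_derive_opp_R := (is_derive_opp (V := R_NormedModule)).
Local Notation is_derive_id_R := (is_derive_id (K := R_AbsRing)).
Local Notation continuous_plus_R := (continuous_plus (V := R_NormedModule)).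
Local Notation continuous_minus_R := (continuous_minus (V := R_NormedModule)).
Local Notation continuous_opp_R := (continuous_opp (V := R_NormedModule)).
Local Notation continuous_mult_R := (continuous_mult (K := R_AbsRing)).
Local Notation ex_derive_continuous_R := (ex_derive_continuous (V := R_NormedModule)).
Local Notation ex_series_scal_l_R := (ex_series_scal_l (K := R_AbsRing) (V := R_NormedModule)).
Local Notation ex_series_plus_R := (ex_series_plus (K := R_AbsRing) (V := R_NormedModule)).
Local Notation is_derive_comp_R := (is_derive_comp (K := R_AbsRing) (V := R_NormedModule)).
Local Notation RInt_const_R := (RInt_const (V := R_CompleteNormedModule)).

(** * Partial derivatives *)

Lemma C_eq (a b : C) : Re a = Re b -> Im a = Im b -> a = b.
Proof. destruct a, b; simpl; congruence. Qed.

Lemma Cmod_le_ReIm (a : C) : Cmod a <= Rabs (Re a) + Rabs (Im a).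
Proof.
  assert (E : a = (RtoC (Re a) + Ci * RtoC (Im a))%C) by (apply C_eq; simpl; ring).
  rewrite E at 1.
  eapply Rle_trans; [apply Cmod_triangle|].
  rewrite Cmod_mult, !Cmod_R, Cmod_Ci. lra.
Qed.

Lemma im_le_Cmod (a : C) : Rabs (Im a) <= Cmod a.
Proof. eapply Rle_trans; [apply Rmax_r | apply Rmax_Cmod]. Qed.

(** Derivative of a complex-valued function of a real variable. *)
Definition cderive (g : R -> C) (t : R) (v : C) : Prop :=
  is_derive (fun s => Re (g s)) t (Re v) /\
  is_derive (fun s => Im (g s)) t (Im v).

Lemma cderive_const (c : C) t : cderive (fun _ => c) t 0.
Proof. split; apply is_derive_const_R. Qed.

Lemma cderive_plus f g t u v :
  cderive f t u -> cderive g t v ->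
  cderive (fun s => f s + g s)%C t (u + v)%C.
Proof.
  intros [a b] [c d]; split; simpl;
    apply is_derive_plus_R; assumption.
Qed.

Lemma is_derive_Rmult (f g : R -> R) x u v :
  is_derive f x u -> is_derive g x v ->
  is_derive (fun s => f s * g s) x (u * g x + f x * v).
Proof. intros a b. apply (is_derive_mult f g); auto. intros; apply Rmult_comm. Qed.

Lemma cderive_mult f g t u v :
  cderive f t u -> cderive g t v ->
  cderive (fun s => f s * g s)%C t (u * g t + f t * v)%C.
Proof.
  intros [a b] [c d]; split; simpl.
  - evar_last.
    apply is_derive_minus_R; apply is_derive_Rmult; eassumption.
    unfold minus, plus, opp; simpl. unfold Re, Im. ring.
  - evar_last.
    apply is_derive_plus_R; apply is_derive_Rmult; eassumption.
    unfold minus, plus, opp; simpl. unfold Re, Im. ring.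
Qed.

Lemma cderive_val f t u v : cderive f t u -> u = v -> cderive f t v.
Proof. intros H <-; exact H. Qed.

Lemma cderive_ext_loc f g t v :
  locally t (fun s => f s = g s) -> cderive f t v -> cderive g t v.
Proof.
  intros H [a b]; split; (eapply is_derive_ext_loc; [|eassumption]);
    revert H; apply filter_imp; intros s e; now rewrite e.
Qed.

Lemma cderive_RtoC f t u : is_derive f t u -> cderive (fun s => RtoC (f s)) t (RtoC u).
Proof. intros a; split; simpl; [exact a | apply is_derive_const_R]. Qed.

(** The partial derivative in [x] ([b = true]) or in [y] ([b = false]). *)
Definition pd (b : bool) : (C -> C) -> C -> C := if b then dx else dy.

(** The line through [z] parallel to the axis [b], parametrized by the coordinate
  that varies. *)
Definition slice (b : bool) (z : C) (t : R) : C :=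
  if b then (t, Im z) else (Re z, t).

(** The coordinate of [z] along this line. *)
Definition coord (b : bool) (z : C) : R := if b then Re z else Im z.

(** [v] is the partial derivative of [f] at [z] in the direction [b]. *)
Definition is_pd (b : bool) (f : C -> C) (z v : C) : Prop :=
  cderive (fun t => f (slice b z t)) (coord b z) v.

(** Existence of both partial derivatives. *)
Definition diff_at (f : C -> C) (z : C) : Prop := ex_dx f z /\ ex_dy f z.

Lemma slice_coord b z : slice b z (coord b z) = z.
Proof. destruct b, z; reflexivity. Qed.

Lemma is_pd_unique b f z v : is_pd b f z v -> pd b f z = v.
Proof.
  intros [a c]. apply is_derive_unique in a; apply is_derive_unique in c.
  destruct b; apply C_eq; assumption.
Qed.

Lemma pd_is b f z : diff_at f z -> is_pd b f z (pd b f z).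
Proof. intros [[a c] [d e]]; destruct b; split; apply Derive_correct; assumption. Qed.

Lemma diff_at_is f z : (forall b, exists v, is_pd b f z v) -> diff_at f z.
Proof.
  intros H. destruct (H true) as [u [a c]]; destruct (H false) as [v [d e]].
  split; split; eexists; eassumption.
Qed.

Lemma slice_lim b z : filterlim (slice b z) (locally (coord b z)) (locally z).
Proof.
  rewrite <- (slice_coord b z) at 2.
  intros P [e he]. exists e. intros t ht. apply he.
  destruct b; split; simpl; try assumption; apply ball_center.
Qed.

Lemma is_pd_ext_loc b f g z v :
  locally z (fun w => f w = g w) -> is_pd b f z v -> is_pd b g z v.
Proof.
  intros H. apply cderive_ext_loc. exact (slice_lim b z _ H).
Qed.

Lemma is_pd_const b c z : is_pd b (fun _ => c) z 0.
Proof. apply cderive_const. Qed.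

Lemma is_pd_plus b f g z u v :
  is_pd b f z u -> is_pd b g z v -> is_pd b (fun w => f w + g w)%C z (u + v)%C.
Proof. apply cderive_plus. Qed.

Lemma is_pd_mult b f g z u v :
  is_pd b f z u -> is_pd b g z v ->
  is_pd b (fun w => f w * g w)%C z (u * g z + f z * v)%C.
Proof.
  intros Hf Hg. pose proof (cderive_mult _ _ _ _ _ Hf Hg) as H.
  cbv beta in H. rewrite slice_coord in H. exact H.
Qed.

(** The partial derivatives of the coordinate function [z]; those of [conj(z)] are
  their conjugates. *)
Definition dz1 (b : bool) : C := if b then 1%C else Ci.

Lemma is_pd_id b z : is_pd b (fun w => w) z (dz1 b).
Proof.
  destruct b; split; simpl; try apply is_derive_id_R;
    apply is_derive_const_R.
Qed.

Lemma is_pd_conj b f z v : is_pd b f z v -> is_pd b (fun w => Cconj (f w)) z (Cconj v).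
Proof.
  intros [a c]; split; [exact a|]. apply is_derive_opp_R in c.
  exact c.
Qed.

Lemma pd_plus b f g z : diff_at f z -> diff_at g z ->
  pd b (fun w => f w + g w)%C z = (pd b f z + pd b g z)%C.
Proof. intros; apply is_pd_unique, is_pd_plus; apply pd_is; assumption. Qed.

Lemma pd_mult b f g z : diff_at f z -> diff_at g z ->
  pd b (fun w => f w * g w)%C z = (pd b f z * g z + f z * pd b g z)%C.
Proof. intros; apply is_pd_unique, is_pd_mult; apply pd_is; assumption. Qed.

Lemma pd_const b c z : pd b (fun _ => c) z = 0%C.
Proof. apply is_pd_unique, is_pd_const. Qed.

Lemma diff_at_plus f g z : diff_at f z -> diff_at g z -> diff_at (fun w => f w + g w)%C z.
Proof. intros Hf Hg; apply diff_at_is; intros b; eexists; apply is_pd_plus; apply pd_is; assumption. Qed.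

Lemma diff_at_mult f g z : diff_at f z -> diff_at g z -> diff_at (fun w => f w * g w)%C z.
Proof. intros Hf Hg; apply diff_at_is; intros b; eexists; apply is_pd_mult; apply pd_is; assumption. Qed.

Lemma diff_at_const c z : diff_at (fun _ => c) z.
Proof. apply diff_at_is; intros b; eexists; apply is_pd_const. Qed.

Lemma diff_at_ext_loc f g z :
  locally z (fun w => f w = g w) -> diff_at f z -> diff_at g z.
Proof.
  intros H Hf; apply diff_at_is; intros b; eexists; eapply is_pd_ext_loc;
    [exact H | apply pd_is; assumption].
Qed.

Lemma pd_ext_loc b f g z :
  locally z (fun w => f w = g w) -> diff_at f z -> pd b f z = pd b g z.
Proof.
  intros H Hf; symmetry; apply is_pd_unique; eapply is_pd_ext_loc;
    [exact H | apply pd_is; assumption].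
Qed.

Lemma locally_eq_on (U : C -> Prop) (f g : C -> C) z :
  open U -> (forall w, U w -> f w = g w) -> U z -> locally z (fun w => f w = g w).
Proof. intros hU H hz. generalize (hU z hz). apply filter_imp. exact H. Qed.

(** ** Continuity *)

Lemma continuous_C_iff {T : UniformSpace} (f : T -> C) z :
  continuous f z <->
  continuous (fun w => Re (f w)) z /\ continuous (fun w => Im (f w)) z.
Proof.
  split.
  - intros H; split.
    + apply (continuous_comp f (fun p : R * R => fst p)); [exact H|]. apply continuous_fst.
    + apply (continuous_comp f (fun p : R * R => snd p)); [exact H|]. apply continuous_snd.
  - intros [a b] P [e he].
    generalize (a (ball (Re (f z)) e) (locally_ball _ e)).
    generalize (b (ball (Im (f z)) e) (locally_ball _ e)).
    unfold filtermap. intros hb ha.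
    generalize (filter_and _ _ ha hb). unfold filtermap. apply filter_imp. intros w [x y].
    apply he. split; assumption.
Qed.

Lemma continuous_Cplus {T : UniformSpace} (f g : T -> C) z :
  continuous f z -> continuous g z -> continuous (fun w => f w + g w)%C z.
Proof.
  rewrite !continuous_C_iff. intros [a b] [c d]; split; simpl;
    apply continuous_plus_R; assumption.
Qed.

Lemma continuous_Cmult {T : UniformSpace} (f g : T -> C) z :
  continuous f z -> continuous g z -> continuous (fun w => f w * g w)%C z.
Proof.
  rewrite !continuous_C_iff. intros [a b] [c d]; split; simpl.
  - apply continuous_minus_R; apply continuous_mult_R; assumption.
  - apply continuous_plus_R; apply continuous_mult_R; assumption.
Qed.

Lemma continuous_Cconj (f : C -> C) z :
  continuous f z -> continuous (fun w => Cconj (f w)) z.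
Proof.
  rewrite !continuous_C_iff. intros [a b]; split; simpl; [exact a|].
  apply continuous_opp_R; assumption.
Qed.

(** ** Regular families
  [Reg P S n g]: on the sets [S i], all iterated partial derivatives of order
  at most [n] of the members of the family [g] exist and are continuous, and
  each of the families formed by them has the property [P].  With a trivial
  [P] this is the class C^n; with [P] a bound it gives estimates which are
  uniform over the family. *)
Fixpoint Reg {I : Type} (P : (I -> C -> C) -> Prop) (S : I -> C -> Prop)
  (n : nat) (g : I -> C -> C) : Prop :=
  (forall i z, S i z -> continuous (g i) z) /\ P g /\
  match n with
  | O => True
  | S m => (forall i z, S i z -> diff_at (g i) z) /\
           forall b, Reg P S m (fun i => pd b (g i))
  end.

(** [P] depends only on the values of each [g i] on [S i]. *)
Definition respects {I : Type} (P : (I -> C -> C) -> Prop) (S : I -> C -> Prop) : Prop :=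
  forall g h, (forall i z, S i z -> g i z = h i z) -> P g -> P h.

Lemma continuous_ext_on (U : C -> Prop) (f g : C -> C) z :
  open U -> (forall w, U w -> f w = g w) -> U z -> continuous f z -> continuous g z.
Proof.
  intros hU H hz Hc. apply (continuous_ext_loc g f z); [|exact Hc].
  exact (locally_eq_on U f g z hU H hz).
Qed.

Lemma Reg_ext {I} P (Om : I -> C -> Prop) n :
  (forall i, open (Om i)) -> respects P Om -> forall g h,
  (forall i z, Om i z -> g i z = h i z) -> Reg P Om n g -> Reg P Om n h.
Proof.
  intros hS hP. induction n as [|n IH]; intros g h E (Hc & Hp & Hd).
  - split; [|split; [|exact Logic.I]].
    + intros i z hz. apply (continuous_ext_on (Om i) (g i)); auto.
    + exact (hP g h E Hp).
  - destruct Hd as [Hd Hr]. split; [|split; [|split]].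
    + intros i z hz. apply (continuous_ext_on (Om i) (g i)); auto.
    + exact (hP g h E Hp).
    + intros i z hz. apply (diff_at_ext_loc (g i)); [|auto].
      apply (locally_eq_on (Om i)); auto.
    + intros b. apply (IH (fun i => pd b (g i))); [|auto].
      intros i z hz. apply pd_ext_loc; [|auto]. apply (locally_eq_on (Om i)); auto.
Qed.

Lemma Reg_S_le {I} P (Om : I -> C -> Prop) n : forall g,
  Reg P Om (S n) g -> Reg P Om n g.
Proof.
  induction n as [|n IH]; intros g (Hc & Hp & Hd & Hr).
  - split; [|split]; auto.
  - split; [|split; [|split]]; auto.
Qed.

Lemma Reg_le {I} P (Om : I -> C -> Prop) m n g : (n <= m)%nat ->
  Reg P Om m g -> Reg P Om n g.
Proof. intros H; induction H; auto. intros. apply IHle, Reg_S_le; assumption. Qed.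

Lemma Reg_plus {I} P (Om : I -> C -> Prop) n :
  (forall i, open (Om i)) -> respects P Om ->
  (forall g h, P g -> P h -> P (fun i z => g i z + h i z)%C) -> forall g h,
  Reg P Om n g -> Reg P Om n h -> Reg P Om n (fun i z => g i z + h i z)%C.
Proof.
  intros hS hP hplus. induction n as [|n IH]; intros g h (Hc & Hp & Hd) (Hc' & Hp' & Hd').
  - split; [|split]; auto. intros i z hz; apply continuous_Cplus; auto.
  - destruct Hd as [Hd Hr], Hd' as [Hd' Hr'].
    split; [|split; [|split]]; auto.
    + intros i z hz; apply continuous_Cplus; auto.
    + intros i z hz; apply diff_at_plus; auto.
    + intros b. eapply Reg_ext; [exact hS|exact hP| |apply IH; [apply (Hr b)|apply (Hr' b)]].
      intros i z hz. cbv beta. symmetry; apply pd_plus; auto.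
Qed.

Lemma Reg_mult {I} P1 P2 P3 (Om : I -> C -> Prop) n :
  (forall i, open (Om i)) -> respects P3 Om ->
  (forall g h, P3 g -> P3 h -> P3 (fun i z => g i z + h i z)%C) ->
  (forall g h, P1 g -> P2 h -> P3 (fun i z => g i z * h i z)%C) -> forall g h,
  Reg P1 Om n g -> Reg P2 Om n h -> Reg P3 Om n (fun i z => g i z * h i z)%C.
Proof.
  intros hS hP hplus hmult. induction n as [|n IH]; intros g h Hg Hh.
  - destruct Hg as (Hc & Hp & Hd), Hh as (Hc' & Hp' & Hd').
    split; [|split]; auto. intros i z hz; apply continuous_Cmult; auto.
  - pose proof (Reg_S_le _ _ _ _ Hg) as Hg'. pose proof (Reg_S_le _ _ _ _ Hh) as Hh'.
    destruct Hg as (Hc & Hp & Hd & Hr), Hh as (Hc' & Hp' & Hd' & Hr').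
    split; [|split; [|split]]; auto.
    + intros i z hz; apply continuous_Cmult; auto.
    + intros i z hz; apply diff_at_mult; auto.
    + intros b.
      eapply Reg_ext; [exact hS|exact hP| |
        apply Reg_plus; [exact hS|exact hP|exact hplus|
          apply (IH (fun i => pd b (g i)) h); [apply Hr|exact Hh']|
          apply (IH g (fun i => pd b (h i))); [exact Hg'|apply Hr']]].
      intros i z hz. cbv beta. symmetry; apply pd_mult; auto.
Qed.

Lemma Reg_const {I} (P : (I -> C -> C) -> Prop) S n (c : I -> C) :
  (forall i, open (S i)) -> respects P S ->
  P (fun i _ => c i) -> P (fun _ _ => 0%C) -> Reg P S n (fun i _ => c i).
Proof.
  intros hS hP. revert c. induction n as [|n IH]; intros c h1 h0.
  - split; [|split]; auto. intros; apply continuous_const.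
  - split; [|split; [|split]]; auto.
    + intros; apply continuous_const.
    + intros; apply diff_at_const.
    + intros b. eapply Reg_ext; [exact hS|exact hP| |apply (IH (fun _ => 0%C)); exact h0].
      intros i z _. symmetry; apply pd_const.
Qed.

Lemma Reg_weaken {I} (P Q : (I -> C -> C) -> Prop) S S' n :
  (forall i z, S' i z -> S i z) -> (forall g, P g -> Q g) -> forall g,
  Reg P S n g -> Reg Q S' n g.
Proof.
  intros hS hPQ; induction n as [|n IH]; intros g (a & b & c).
  - split; [|split]; auto.
  - destruct c as [c d]. split; [|split; [|split]]; auto.
Qed.

(** The property without content, for which [Reg] is the class C^n. *)
Definition trivP {I : Type} (g : I -> C -> C) : Prop := True.

Lemma respects_trivP {I} (Om : I -> C -> Prop) : respects trivP Om.
Proof. intros g h _ _; exact Logic.I. Qed.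

Lemma Cn_Reg n U f : Cn n U f <-> Reg trivP (fun _ : unit => U) n (fun _ => f).
Proof.
  revert f; induction n as [|n IH]; intros f; simpl.
  - split; [intros [a _]|intros [a _]]; repeat split; auto. intros; apply (a tt); auto.
  - split.
    + intros (a & b & c & d). split; [|split; [|split]]; auto. exact Logic.I.
      intros [|]; apply IH; assumption.
    + intros (a & _ & b & c). split; [|split; [|split]].
      * intros; apply (a tt); auto.
      * intros; apply (b tt); auto.
      * apply IH. apply (c true).
      * apply IH. apply (c false).
Qed.

(** Membership of one function of a regular family in C^n. *)
Lemma Reg_Cn {I} P (Om : I -> C -> Prop) n g i : Reg P Om n g -> Cn n (Om i) (g i).
Proof.
  revert g; induction n as [|n IH]; intros g (a & b & c); simpl.
  - split; auto.
  - destruct c as [c d]. split; [|split; [|split]].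
    + auto.
    + intros z hz. exact (c i z hz).
    + exact (IH (fun i => pd true (g i)) (d true)).
    + exact (IH (fun i => pd false (g i)) (d false)).
Qed.

Lemma Cn_ext n U f g : open U -> (forall z, U z -> f z = g z) -> Cn n U f -> Cn n U g.
Proof.
  intros hU E. rewrite !Cn_Reg. apply Reg_ext; auto. apply respects_trivP.
Qed.

Lemma Cn_le m n U f : (n <= m)%nat -> Cn m U f -> Cn n U f.
Proof. rewrite !Cn_Reg. apply Reg_le. Qed.

Lemma Cn_plus n U f g : open U -> Cn n U f -> Cn n U g -> Cn n U (fun z => f z + g z)%C.
Proof. intros hU. rewrite !Cn_Reg. apply Reg_plus; auto using respects_trivP. Qed.

Lemma Cn_mult n U f g : open U -> Cn n U f -> Cn n U g -> Cn n U (fun z => f z * g z)%C.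
Proof.
  intros hU. rewrite !Cn_Reg. apply Reg_mult; auto using respects_trivP.
Qed.

Lemma Cn_const n U c : open U -> Cn n U (fun _ => c).
Proof. intros hU. rewrite Cn_Reg. apply (Reg_const trivP _ n (fun _ => c)); auto using respects_trivP; exact Logic.I. Qed.

Lemma Cn_sub n U V f : (forall z, V z -> U z) -> Cn n U f -> Cn n V f.
Proof. intros H; rewrite !Cn_Reg; apply Reg_weaken; auto. Qed.

Lemma Cn_pd n U f b : Cn (S n) U f -> Cn n U (pd b f).
Proof. intros (_ & _ & a & c); destruct b; assumption. Qed.

Lemma Cn_diff n U f z : Cn (S n) U f -> U z -> diff_at f z.
Proof. intros (_ & a & _) hz; apply a; assumption. Qed.

Lemma Cn_continuous n U f z : Cn n U f -> U z -> continuous f z.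
Proof. destruct n; intros H; apply H. Qed.

Lemma Cn_intro n U f : (forall z, U z -> continuous f z) ->
  (forall z, U z -> diff_at f z) -> (forall b, Cn n U (pd b f)) -> Cn (S n) U f.
Proof. intros a b c; split; [|split; [|split]]; auto. apply (c true). apply (c false). Qed.

Lemma Cn_local n U f :
  (forall z, U z -> exists V, V z /\ Cn n V f) -> Cn n U f.
Proof.
  revert f; induction n as [|n IH]; intros f H.
  - split; auto. intros z hz. destruct (H z hz) as (V & hV & h). apply h; auto.
  - apply Cn_intro.
    + intros z hz. destruct (H z hz) as (V & hV & h). apply h; auto.
    + intros z hz. destruct (H z hz) as (V & hV & h). apply h; auto.
    + intros b. apply IH. intros z hz. destruct (H z hz) as (V & hV & h).
      exists V; split; auto. apply Cn_pd; assumption.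
Qed.

(** ** Powers *)

Lemma is_pd_pow b f z v n : is_pd b f z v ->
  is_pd b (fun w => f w ^ n)%C z (INR n * f z ^ (pred n) * v)%C.
Proof.
  intros H. induction n as [|n IH].
  - simpl. replace (0 * 1 * v)%C with (RtoC 0) by ring. apply is_pd_const.
  - replace (INR (S n) * f z ^ pred (S n) * v)%C
      with (v * f z ^ n + f z * (INR n * f z ^ pred n * v))%C.
    + apply (is_pd_mult b f (fun w => f w ^ n)%C); assumption.
    + rewrite S_INR, RtoC_plus. destruct n; simpl; [ring|].
      change (match n with O => 1 | S _ => INR n + 1 end) with (INR (S n)).
      ring.
Qed.

Lemma Cn_id n U : open U -> Cn n U (fun z => z).
Proof.
  intros hU. destruct n as [|n].
  - split; auto. intros; apply continuous_id.
  - apply Cn_intro.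
    + intros; apply continuous_id.
    + intros; apply diff_at_is; intros b; eexists; apply is_pd_id.
    + intros b. apply (Cn_ext n U (fun _ => dz1 b)); auto.
      * intros; symmetry; apply is_pd_unique, is_pd_id.
      * apply Cn_const; auto.
Qed.

Lemma Cn_conj n U f : open U -> Cn n U f -> Cn n U (fun z => Cconj (f z)).
Proof.
  intros hU. revert f; induction n as [|n IH]; intros f H.
  - split; auto. intros; apply continuous_Cconj, H; assumption.
  - apply Cn_intro.
    + intros; apply continuous_Cconj; eapply Cn_continuous; eassumption.
    + intros; apply diff_at_is; intros b; eexists; apply is_pd_conj, pd_is.
      eapply Cn_diff; eassumption.
    + intros b. apply (Cn_ext n U (fun z => Cconj (pd b f z))); auto.
      * intros; symmetry; apply is_pd_unique, is_pd_conj, pd_is.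
        eapply Cn_diff; eassumption.
      * apply IH, Cn_pd; assumption.
Qed.

Lemma Cn_pow n U f p : open U -> Cn n U f -> Cn n U (fun z => f z ^ p)%C.
Proof.
  intros hU H; induction p as [|p IH].
  - apply (Cn_const n U 1%C hU).
  - apply (Cn_mult n U f (fun z => f z ^ p)%C); assumption.
Qed.

(** ** First-order operators with constant coefficients *)

(** The operator [u dx + v dy]. *)
Definition Lop (l : C * C) (f : C -> C) (z : C) : C :=
  (fst l * dx f z + snd l * dy f z)%C.

(** The coefficients of [dx], of [dy], of the operator [d/dz] and of [dbar]. *)
Definition lX : C * C := (RtoC 1, RtoC 0).
Definition lY : C * C := (RtoC 0, RtoC 1).
Definition lZ : C * C := (RtoC (1 / 2), (- (RtoC (1 / 2) * Ci))%C).
Definition lZbar : C * C := (RtoC (1 / 2), (RtoC (1 / 2) * Ci)%C).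

(** A word of operators [Lop l]; the head of the list is applied first. *)
Fixpoint wd (w : list (C * C)) (f : C -> C) : C -> C :=
  match w with nil => f | l :: w' => wd w' (Lop l f) end.

Lemma Lop_X : Lop lX = dx.
Proof.
  apply functional_extensionality; intros f; apply functional_extensionality; intros z.
  unfold Lop, lX; simpl. ring.
Qed.

Lemma Lop_Y : Lop lY = dy.
Proof.
  apply functional_extensionality; intros f; apply functional_extensionality; intros z.
  unfold Lop, lY; simpl. ring.
Qed.

Lemma Lop_Zbar : Lop lZbar = dbar.
Proof.
  apply functional_extensionality; intros f; apply functional_extensionality; intros z.
  unfold Lop, lZbar, dbar; simpl. ring.
Qed.

(** The operator [d/dz]. *)
Definition dz : (C -> C) -> C -> C := Lop lZ.

Lemma wd_app w w' f : wd (w ++ w') f = wd w' (wd w f).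
Proof. revert f; induction w as [|l w IH]; intros f; simpl; auto. Qed.

Lemma iter_wd l n f : Nat.iter n (Lop l) f = wd (repeat l n) f.
Proof.
  revert f; induction n as [|n IH]; intros f; simpl; auto.
  rewrite <- IH. clear IH. induction n as [|n IH]; simpl; auto. now rewrite IH.
Qed.

Lemma dbar_wd n f : Nat.iter n dbar f = wd (repeat lZbar n) f.
Proof. rewrite <- Lop_Zbar. apply iter_wd. Qed.

Lemma dalpha_wd a1 a2 f : dalpha a1 a2 f = wd (repeat lY a2 ++ repeat lX a1) f.
Proof.
  unfold dalpha. rewrite <- Lop_X, <- Lop_Y, !iter_wd, wd_app. reflexivity.
Qed.

Lemma Lop_pd l f z : Lop l f z = (fst l * pd true f z + snd l * pd false f z)%C.
Proof. reflexivity. Qed.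

Lemma Lop_ext l (U : C -> Prop) f g z : open U -> (forall w, U w -> f w = g w) ->
  U z -> diff_at f z -> Lop l f z = Lop l g z.
Proof.
  intros hU E hz Hd. rewrite !Lop_pd.
  rewrite (pd_ext_loc true f g z), (pd_ext_loc false f g z); auto;
    apply (locally_eq_on U); auto.
Qed.

Lemma Lop_plus l f g z : diff_at f z -> diff_at g z ->
  Lop l (fun w => f w + g w)%C z = (Lop l f z + Lop l g z)%C.
Proof. intros Hf Hg. rewrite !Lop_pd, !pd_plus; auto. ring. Qed.

Lemma Lop_mult l f g z : diff_at f z -> diff_at g z ->
  Lop l (fun w => f w * g w)%C z = (Lop l f z * g z + f z * Lop l g z)%C.
Proof. intros Hf Hg. rewrite !Lop_pd, !pd_mult; auto. ring. Qed.

Lemma Lop_const l c z : Lop l (fun _ => c) z = 0%C.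
Proof. rewrite Lop_pd, !pd_const. ring. Qed.

Lemma Lop_scal l c f z : diff_at f z -> Lop l (fun w => c * f w)%C z = (c * Lop l f z)%C.
Proof.
  intros Hf. rewrite (Lop_mult l (fun _ => c)), Lop_const; auto. ring.
  apply diff_at_const.
Qed.

Lemma Cn_Lop n U l f : open U -> Cn (S n) U f -> Cn n U (Lop l f).
Proof.
  intros hU H.
  apply (Cn_plus n U (fun z => fst l * pd true f z)%C (fun z => snd l * pd false f z)%C hU);
    (apply (Cn_mult n U (fun _ => _)); [exact hU|apply Cn_const; exact hU|apply Cn_pd; exact H]).
Qed.

Lemma Cn_wd w : forall n U f, open U -> Cn (length w + n) U f -> Cn n U (wd w f).
Proof.
  induction w as [|l w IH]; intros n U f hU H; simpl in *; auto.
  apply IH; auto. apply Cn_Lop; assumption.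
Qed.

Lemma wd_ext w (U : C -> Prop) f g : open U -> Cn (length w) U f ->
  (forall z, U z -> f z = g z) -> forall z, U z -> wd w f z = wd w g z.
Proof.
  revert f g; induction w as [|l w IH]; intros f g hU Hf E z hz; simpl; auto.
  apply IH; auto.
  - apply Cn_Lop; assumption.
  - intros y hy. apply (Lop_ext l U); auto. eapply Cn_diff; eassumption.
Qed.

Lemma wd_plus w (U : C -> Prop) f g : open U -> Cn (length w) U f -> Cn (length w) U g ->
  forall z, U z -> wd w (fun y => f y + g y)%C z = (wd w f z + wd w g z)%C.
Proof.
  revert f g; induction w as [|l w IH]; intros f g hU Hf Hg z hz; simpl; auto.
  rewrite <- IH; auto using Cn_Lop.
  apply (wd_ext w U); auto.
  - apply Cn_Lop, Cn_plus; assumption.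
  - intros y hy; apply Lop_plus; eapply Cn_diff; eassumption.
Qed.

Lemma wd_scal w (U : C -> Prop) c f : open U -> Cn (length w) U f ->
  forall z, U z -> wd w (fun y => c * f y)%C z = (c * wd w f z)%C.
Proof.
  revert f; induction w as [|l w IH]; intros f hU Hf z hz; simpl; auto.
  rewrite <- IH; auto using Cn_Lop.
  apply (wd_ext w U); auto.
  - apply Cn_Lop, (Cn_mult _ U (fun _ => c)); auto. apply Cn_const; auto.
  - intros y hy; apply Lop_scal; eapply Cn_diff; eassumption.
Qed.

Lemma wd_const w c : w <> nil -> forall z, wd w (fun _ => c) z = 0%C.
Proof.
  destruct w as [|l w]; [congruence|]. intros _ z. revert l c.
  assert (E : forall l c, Lop l (fun _ : C => c) = fun _ => RtoC 0).
  { intros; apply functional_extensionality; intros; apply Lop_const. }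
  induction w as [|l' w IH]; intros l c; simpl.
  - apply Lop_const.
  - rewrite (E l c). apply IH.
Qed.

Lemma wd_zero w z : wd w (fun _ => RtoC 0) z = 0%C.
Proof. destruct w as [|l w]; [reflexivity|]. apply wd_const; congruence. Qed.

(** *** Powers of [z] and of its conjugate *)

(** The derivative of [z] under the operator with coefficients [l]. *)
Definition lz (l : C * C) : C := (fst l + snd l * Ci)%C.
(** The derivative of [conj(z)] under the operator with coefficients [l]. *)
Definition lzbar (l : C * C) : C := (fst l - snd l * Ci)%C.

Lemma Lop_zpow l n z : Lop l (fun w => w ^ n)%C z = (INR n * z ^ pred n * lz l)%C.
Proof.
  rewrite Lop_pd. unfold lz.
  rewrite !(is_pd_unique _ _ _ _ (is_pd_pow _ (fun w => w) _ _ n (is_pd_id _ z))).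
  simpl. ring.
Qed.

Lemma Lop_zbarpow l n z :
  Lop l (fun w => Cconj w ^ n)%C z = (INR n * Cconj z ^ pred n * lzbar l)%C.
Proof.
  rewrite Lop_pd. unfold lzbar.
  rewrite !(is_pd_unique _ _ _ _
    (is_pd_pow _ (fun w => Cconj w) _ _ n (is_pd_conj _ _ _ _ (is_pd_id _ z)))).
  simpl. replace (Cconj Ci) with (- Ci)%C by (apply C_eq; simpl; ring).
  replace (Cconj 1) with (RtoC 1) by (apply C_eq; simpl; ring). ring.
Qed.

Lemma lzbar_Z : lzbar lZ = 0%C.
Proof. unfold lzbar, lZ; apply C_eq; simpl; field. Qed.
Lemma lz_Zbar : lz lZbar = 0%C.
Proof. unfold lz, lZbar; apply C_eq; simpl; field. Qed.
Lemma lzbar_Zbar : lzbar lZbar = 1%C.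
Proof. unfold lzbar, lZbar; apply C_eq; simpl; field. Qed.

(** ** Disks *)

(** The open disk of radius [r] about 0. *)
Definition disk (r : R) (z : C) : Prop := Cmod z < r.

Lemma Cmod_close (w z : C) e : Rabs (Re w - Re z) < e -> Rabs (Im w - Im z) < e ->
  Rabs (Cmod w - Cmod z) < 2 * e.
Proof.
  intros h1 h2.
  assert (E : Cmod (w - z) < 2 * e).
  { eapply Rle_lt_trans; [apply Cmod_le_ReIm|].
    change (Rabs (Re w - Re z) + Rabs (Im w - Im z) < 2 * e). lra. }
  pose proof (Cmod_triangle (w - z) z) as t1. replace (w - z + z)%C with w in t1 by ring.
  pose proof (Cmod_triangle (- (w - z)) w) as t2. rewrite Cmod_opp in t2.
  replace (- (w - z) + w)%C with z in t2 by ring.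
  apply Rabs_def1; lra.
Qed.

Lemma continuous_Cmod (z : C) : continuous Cmod z.
Proof.
  apply filterlim_locally. intros e. assert (he : 0 < e / 2) by (pose proof (cond_pos e); lra).
  exists (mkposreal _ he). intros w [h1 h2].
  pose proof (Cmod_close w z _ h1 h2) as h. simpl in h.
  change (Rabs (Cmod w - Cmod z) < e). lra.
Qed.

Lemma open_diskr r : open (disk r).
Proof. apply (open_comp Cmod (fun x => x < r)); [intros; apply continuous_Cmod|apply open_lt]. Qed.

Lemma open_disk : open unit_disk.
Proof. exact (open_diskr 1). Qed.

Lemma open_exterior r : open (fun z => r < Cmod z).
Proof. apply (open_comp Cmod (fun x => r < x)); [intros; apply continuous_Cmod|apply open_gt]. Qed.

(** ** Mixed partial derivatives commute *)

Lemma locally_2d_C (P : R -> R -> Prop) x y :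
  locally (T := C_UniformSpace) (x, y) (fun w => P (fst w) (snd w)) -> locally_2d P x y.
Proof.
  intros [e he]. exists e. intros u v hu hv. apply (he (u, v)). split; assumption.
Qed.

Lemma cont2d (f : C -> R) (z : C) :
  continuous f z -> continuity_2d_pt (fun u v => f (u, v)) (Re z) (Im z).
Proof.
  intros H. apply continuity_2d_pt_filterlim. destruct z as [x y].
  eapply filterlim_ext; [|exact H]. intros [u v]; reflexivity.
Qed.

(** Schwarz's theorem. *)
Lemma pd_comm (U : C -> Prop) f z : open U -> Cn 2 U f -> U z ->
  dx (dy f) z = dy (dx f) z.
Proof.
  intros hU H hz. destruct z as [x y].
  destruct H as (_ & H1 & (_ & Hx & _ & Cxy) & (_ & Hy & Cyx & _)).
  assert (L : locally (T := C_UniformSpace) (x, y) U) by (apply hU; exact hz).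
  assert (Sch : forall g : C -> R,
    (forall w, U w -> ex_derive (fun t => g (t, Im w)) (Re w)) ->
    (forall w, U w -> ex_derive (fun t => g (Re w, t)) (Im w)) ->
    (forall w, U w -> ex_derive (fun t => Derive (fun s => g (t, s)) (Im w)) (Re w)) ->
    (forall w, U w -> ex_derive (fun t => Derive (fun s => g (s, t)) (Re w)) (Im w)) ->
    continuous (fun w : C => Derive (fun t => Derive (fun s => g (t, s)) (Im w)) (Re w)) (x, y) ->
    continuous (fun w : C => Derive (fun t => Derive (fun s => g (s, t)) (Re w)) (Im w)) (x, y) ->
    Derive (fun t => Derive (fun s => g (t, s)) y) x =
    Derive (fun t => Derive (fun s => g (s, t)) x) y).
  { intros g h1 h2 h3 h4 c1 c2. apply (Schwarz (fun u v => g (u, v))).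
    - apply locally_2d_C. revert L. apply filter_imp. intros [u v] hw; simpl.
      split; [|split; [|split]].
      + apply (h1 (u, v) hw).
      + apply (h2 (u, v) hw).
      + apply (h3 (u, v) hw).
      + apply (h4 (u, v) hw).
    - apply (cont2d _ (x, y) c1).
    - apply (cont2d _ (x, y) c2). }
  assert (K1 : continuous (dx (dy f)) (x, y)) by (apply (Cn_continuous 0 U); assumption).
  assert (K2 : continuous (dy (dx f)) (x, y)) by (apply (Cn_continuous 0 U); assumption).
  apply continuous_C_iff in K1; apply continuous_C_iff in K2.
  destruct K1 as [K1 K1'], K2 as [K2 K2'].
  apply C_eq.
  - apply (Sch (fun w => Re (f w))); auto.
    + intros w hw; apply (H1 w hw).
    + intros w hw; apply (H1 w hw).
    + intros w hw; apply (Hy w hw).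
    + intros w hw; apply (Hx w hw).
  - apply (Sch (fun w => Im (f w))); auto.
    + intros w hw; apply (H1 w hw).
    + intros w hw; apply (H1 w hw).
    + intros w hw; apply (Hy w hw).
    + intros w hw; apply (Hx w hw).
Qed.

(** * Integrals over circles *)

(** The chain rule along a curve, with continuity of one partial derivative only. *)
Lemma chain_real (f : C -> R) (fx fy : C -> R) (U : C -> Prop) (g : R -> C) t v :
  open U -> (forall w, U w -> is_derive (fun s => f (s, Im w)) (Re w) (fx w)) ->
  (forall w, U w -> is_derive (fun s => f (Re w, s)) (Im w) (fy w)) ->
  (forall w, U w -> continuous fx w) ->
  U (g t) -> cderive g t v ->
  is_derive (fun s => f (g s)) t (fx (g t) * Re v + fy (g t) * Im v).
Proof.
  intros hU hx hy hc hg [g1 g2].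
  assert (D : differentiable_pt_lim (fun a b => f (a, b)) (Re (g t)) (Im (g t))
    (fx (Re (g t), Im (g t))) (fy (g t))).
  { apply filterdiff_differentiable_pt_lim.
    apply (is_derive_filterdiff (fun a b => f (a, b)) (Re (g t)) (Im (g t))
      (fun a b => fx (a, b)) (fy (g t))).
    - assert (L : locally (T := C_UniformSpace) (Re (g t), Im (g t)) U).
      { apply hU. destruct (g t); exact hg. }
      revert L. apply filter_imp. intros [a b] hw. apply (hx (a, b) hw).
    - apply hy; assumption.
    - pose proof (hc (g t) hg) as K. destruct (g t) as [a b].
      apply (continuous_ext (fun w : C => fx w)); [intros [? ?]; reflexivity | exact K]. }
  apply is_derive_Reals in g1. apply is_derive_Reals in g2.
  apply is_derive_Reals.
  pose proof (derivable_pt_lim_comp_2d _ _ _ _ _ _ _ _ D g1 g2) as K.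
  apply is_derive_Reals in K. apply is_derive_Reals.
  assert (Eg : (Re (g t), Im (g t)) = g t) by (destruct (g t); reflexivity).
  rewrite Eg in K.
  eapply is_derive_ext; [|exact K]. intros s. cbv beta. destruct (g s); reflexivity.
Qed.

Lemma cderive_comp (U : C -> Prop) f g t v :
  open U -> Cn 1 U f -> U (g t) -> cderive g t v ->
  cderive (fun s => f (g s)) t (dx f (g t) * RtoC (Re v) + dy f (g t) * RtoC (Im v))%C.
Proof.
  intros hU H hg hv. destruct H as (_ & Hd & [Hx _] & _).
  split.
  - evar_last.
    + apply (chain_real (fun w => Re (f w)) (fun w => Re (dx f w)) (fun w => Re (dy f w)) U);
        try eassumption.
      * intros w hw. apply Derive_correct. apply (Hd w hw).
      * intros w hw. apply Derive_correct. apply (Hd w hw).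
      * intros w hw. apply (proj1 (proj1 (continuous_C_iff _ _) (Hx w hw))).
    + simpl. unfold Re, Im. ring.
  - evar_last.
    + apply (chain_real (fun w => Im (f w)) (fun w => Im (dx f w)) (fun w => Im (dy f w)) U);
        try eassumption.
      * intros w hw. apply Derive_correct. apply (Hd w hw).
      * intros w hw. apply Derive_correct. apply (Hd w hw).
      * intros w hw. apply (proj2 (proj1 (continuous_C_iff _ _) (Hx w hw))).
    + simpl. unfold Re, Im. ring.
Qed.

(** Integral over [0, 2 pi] of a complex-valued function, taken componentwise. *)
Definition cint (g : R -> C) : C :=
  (RInt (fun t => Re (g t)) 0 (2 * PI), RInt (fun t => Im (g t)) 0 (2 * PI)).

Lemma two_PI_pos : 0 < 2 * PI.
Proof. pose proof PI_RGT_0; lra. Qed.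

Lemma ex_RInt_cont (f : R -> R) a b : (forall t, continuous f t) -> ex_RInt f a b.
Proof. intros H; apply (ex_RInt_continuous (V := R_CompleteNormedModule)); auto. Qed.

Lemma cont_Re (g : R -> C) : (forall t, continuous g t) -> forall t, continuous (fun s => Re (g s)) t.
Proof. intros H t; apply (proj1 (proj1 (continuous_C_iff g t) (H t))). Qed.

Lemma cont_Im (g : R -> C) : (forall t, continuous g t) -> forall t, continuous (fun s => Im (g s)) t.
Proof. intros H t; apply (proj2 (proj1 (continuous_C_iff g t) (H t))). Qed.

Lemma cint_ext f g : (forall t, f t = g t) -> cint f = cint g.
Proof. intros H; unfold cint; f_equal; apply RInt_ext; intros; now rewrite H. Qed.

Lemma cint_plus f g : (forall t, continuous f t) -> (forall t, continuous g t) ->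
  cint (fun t => f t + g t)%C = (cint f + cint g)%C.
Proof.
  intros Hf Hg; apply C_eq.
  - exact (RInt_plus (V := R_CompleteNormedModule) (fun t => Re (f t)) (fun t => Re (g t)) 0 (2 * PI)
      (ex_RInt_cont _ _ _ (cont_Re f Hf)) (ex_RInt_cont _ _ _ (cont_Re g Hg))).
  - exact (RInt_plus (V := R_CompleteNormedModule) (fun t => Im (f t)) (fun t => Im (g t)) 0 (2 * PI)
      (ex_RInt_cont _ _ _ (cont_Im f Hf)) (ex_RInt_cont _ _ _ (cont_Im g Hg))).
Qed.

Lemma RInt_lin (f g : R -> R) a b : (forall t, continuous f t) -> (forall t, continuous g t) ->
  RInt (fun t => a * f t + b * g t) 0 (2 * PI) =
  a * RInt f 0 (2 * PI) + b * RInt g 0 (2 * PI).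
Proof.
  intros Hf Hg.
  rewrite (RInt_plus (V := R_CompleteNormedModule) (fun t => a * f t) (fun t => b * g t)).
  - rewrite (RInt_scal (V := R_CompleteNormedModule) f), (RInt_scal (V := R_CompleteNormedModule) g);
      try apply ex_RInt_cont; auto.
  - apply ex_RInt_cont. intros t.
    apply (continuous_scal_r (V := R_NormedModule)); auto.
  - apply ex_RInt_cont. intros t.
    apply (continuous_scal_r (V := R_NormedModule)); auto.
Qed.

Lemma RInt_extR (f g : R -> R) a b : (forall t, f t = g t) -> RInt f a b = RInt g a b.
Proof. intros H; apply RInt_ext; auto. Qed.

Lemma cint_scal c f : (forall t, continuous f t) ->
  cint (fun t => c * f t)%C = (c * cint f)%C.
Proof.
  intros Hf; apply C_eq.
  - change (@eq R (RInt (fun t => Re c * Re (f t) - Im c * Im (f t)) 0 (2 * PI))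
      (Re c * RInt (fun t => Re (f t)) 0 (2 * PI) - Im c * RInt (fun t => Im (f t)) 0 (2 * PI))).
    rewrite (RInt_extR _ (fun t => Re c * Re (f t) + (- Im c) * Im (f t))) by (intros; ring).
    rewrite RInt_lin; auto using cont_Re, cont_Im. ring.
  - change (@eq R (RInt (fun t => Re c * Im (f t) + Im c * Re (f t)) 0 (2 * PI))
      (Re c * RInt (fun t => Im (f t)) 0 (2 * PI) + Im c * RInt (fun t => Re (f t)) 0 (2 * PI))).
    rewrite RInt_lin; auto using cont_Re, cont_Im.
Qed.

(** The bound is twice the length of the interval times [M]: the two components
  are estimated separately. *)
Lemma cint_bound f M : (forall t, continuous f t) ->
  (forall t, 0 <= t <= 2 * PI -> Cmod (f t) <= M) -> Cmod (cint f) <= 4 * PI * M.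
Proof.
  intros Hf HM. eapply Rle_trans; [apply Cmod_le_ReIm|]. pose proof two_PI_pos.
  assert (A1 : Rabs (RInt (fun t => Re (f t)) 0 (2 * PI)) <= (2 * PI - 0) * M).
  { apply abs_RInt_le_const; [lra|apply ex_RInt_cont, cont_Re; auto|].
    intros; eapply Rle_trans; [apply re_le_Cmod|auto]. }
  assert (A2 : Rabs (RInt (fun t => Im (f t)) 0 (2 * PI)) <= (2 * PI - 0) * M).
  { apply abs_RInt_le_const; [lra|apply ex_RInt_cont, cont_Im; auto|].
    intros; eapply Rle_trans; [apply im_le_Cmod|auto]. }
  simpl. lra.
Qed.

Lemma cint_derive f df : (forall t, cderive f t (df t)) -> (forall t, continuous df t) ->
  cint df = Cminus (f (2 * PI)) (f 0).
Proof.
  intros H Hc.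
  assert (K : forall u du : R -> R, (forall x, is_derive u x (du x)) -> (forall x, continuous du x) ->
    RInt du 0 (2 * PI) = u (2 * PI) - u 0).
  { intros u du h hc. apply is_RInt_unique.
    apply (is_RInt_derive (V := R_CompleteNormedModule)); auto. }
  apply C_eq.
  - exact (K (fun t => Re (f t)) (fun t => Re (df t)) (fun x => proj1 (H x)) (cont_Re df Hc)).
  - exact (K (fun t => Im (f t)) (fun t => Im (df t)) (fun x => proj2 (H x)) (cont_Im df Hc)).
Qed.

Lemma cderive_continuous f t v : cderive f t v -> continuous f t.
Proof.
  intros [a b]; apply continuous_C_iff; split;
    apply ex_derive_continuous_R; eexists; eassumption.
Qed.

Lemma cint_param_real (T : R -> Prop) (G G' : R -> R -> R) (t0 : R) :
  open T -> T t0 ->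
  (forall t, T t -> forall s, is_derive (fun t => G t s) t (G' t s)) ->
  (forall t, T t -> forall s, continuous (G t) s) ->
  (forall s, continuous (fun p : R * R => G' (fst p) (snd p)) (t0, s)) ->
  is_derive (fun t => RInt (G t) 0 (2 * PI)) t0 (RInt (G' t0) 0 (2 * PI)).
Proof.
  intros hT ht HG Hc HG'.
  rewrite (RInt_ext (G' t0) (fun s => Derive (fun t => G t s) t0)).
  2:{ intros s _. symmetry; apply is_derive_unique, HG; assumption. }
  apply (is_derive_RInt_param G).
  - generalize (hT t0 ht). apply filter_imp. intros t h s _. eexists; apply HG; exact h.
  - intros s _. apply (continuity_2d_pt_ext_loc G').
    + destruct (hT t0 ht) as [e he]. exists e. intros u v hu hv.
      symmetry; apply is_derive_unique, HG. apply he. exact hu.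
    + apply continuity_2d_pt_filterlim. apply HG'.
  - generalize (hT t0 ht). apply filter_imp. intros t h. apply ex_RInt_cont; auto.
Qed.

(** Differentiation under the integral sign. *)
Lemma cint_param (T : R -> Prop) (G G' : R -> R -> C) (t0 : R) :
  open T -> T t0 ->
  (forall t, T t -> forall s, cderive (fun t => G t s) t (G' t s)) ->
  (forall t, T t -> forall s, continuous (G t) s) ->
  (forall s, continuous (fun p : R * R => G' (fst p) (snd p)) (t0, s)) ->
  cderive (fun t => cint (G t)) t0 (cint (G' t0)).
Proof.
  intros hT ht HG Hc HG'; split; simpl.
  - apply (cint_param_real T (fun t s => Re (G t s)) (fun t s => Re (G' t s))); auto.
    + intros; apply HG; auto.
    + intros t h; apply cont_Re; auto.
    + intros s. apply (proj1 (proj1 (continuous_C_iff _ _) (HG' s))).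
  - apply (cint_param_real T (fun t s => Im (G t s)) (fun t s => Im (G' t s))); auto.
    + intros; apply HG; auto.
    + intros t h; apply cont_Im; auto.
    + intros s. apply (proj2 (proj1 (continuous_C_iff _ _) (HG' s))).
Qed.

Lemma continuous_RtoC {T : UniformSpace} (f : T -> R) z :
  continuous f z -> continuous (fun w => RtoC (f w)) z.
Proof. intros H; apply continuous_C_iff; split; simpl; [exact H|apply continuous_const]. Qed.

Lemma continuous_RtoC_Re {T : UniformSpace} (f : T -> C) z :
  continuous f z -> continuous (fun w => RtoC (Re (f w))) z.
Proof. intros H; apply continuous_RtoC. apply (proj1 (proj1 (continuous_C_iff f z) H)). Qed.

Lemma continuous_RtoC_Im {T : UniformSpace} (f : T -> C) z :
  continuous f z -> continuous (fun w => RtoC (Im (f w))) z.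
Proof. intros H; apply continuous_RtoC. apply (proj2 (proj1 (continuous_C_iff f z) H)). Qed.

(** Continuity of expressions built from continuous functions. *)
Ltac cont := repeat match goal with
  | |- forall _, _ => intro
  | H : forall s, continuous ?f s |- continuous ?f _ => apply H
  | |- continuous (fun _ => ?c) _ => apply continuous_const
  | |- continuous (fun x => x) _ => apply continuous_id
  | |- continuous (fun x => Cplus (@?f x) (@?g x)) _ => apply (continuous_Cplus f g)
  | |- continuous (fun x => Cminus (@?f x) (@?g x)) _ =>
      apply (continuous_Cplus f (fun x => Copp (g x)))
  | |- continuous (fun x => Cmult (@?f x) (@?g x)) _ => apply (continuous_Cmult f g)
  | |- continuous (fun x => RtoC (Re (@?f x))) _ => apply (continuous_RtoC_Re f)
  | |- continuous (fun x => RtoC (Im (@?f x))) _ => apply (continuous_RtoC_Im f)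
  | |- continuous (fun x => RtoC (fst x)) _ => apply (continuous_RtoC (fun p => fst p)), continuous_fst
  | |- continuous (fun x => snd x) _ => apply continuous_snd
  | |- continuous (fun x => ?h (@?f x)) _ => apply (continuous_comp f h)
  end; auto.

(** Derivative in [t] of the integral of [h] over the curve [a + t v(.)],
  against a fixed weight. *)
Lemma cint_homotopy (U : C -> Prop) h (a : C) (v kap : R -> C) (T : R -> Prop) t :
  open U -> Cn 1 U h -> (forall s, continuous v s) -> (forall s, continuous kap s) ->
  open T -> (forall t, T t -> forall s, U (a + RtoC t * v s)%C) -> T t ->
  cderive (fun t => cint (fun s => h (a + RtoC t * v s) * kap s)%C) t
    (cint (fun s => (dx h (a + RtoC t * v s) * RtoC (Re (v s)) +
                     dy h (a + RtoC t * v s) * RtoC (Im (v s))) * kap s)%C).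
Proof.
  intros hU Hh Hv Hk hT HT ht. pose proof Hh as (H0 & H1 & [Hx _] & [Hy _]).
  apply (cint_param T (fun t s => h (a + RtoC t * v s) * kap s)%C
    (fun t s => (dx h (a + RtoC t * v s) * RtoC (Re (v s)) +
                     dy h (a + RtoC t * v s) * RtoC (Im (v s))) * kap s)%C); auto.
  - intros t' h' s. eapply cderive_val.
    + apply (cderive_mult (fun t => h (a + RtoC t * v s)%C) (fun _ => kap s)); [|apply cderive_const].
      apply (cderive_comp U h (fun t => (a + RtoC t * v s)%C) t' (v s)); auto.
      eapply cderive_val.
      * apply (cderive_plus (fun _ => a)); [apply cderive_const|].
        apply (cderive_mult (fun t => RtoC t) (fun _ => v s)); [|apply cderive_const].
        apply cderive_RtoC, is_derive_id_R.
      * change (@one R_AbsRing) with 1. ring.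
    + ring.
  - cont.
  - cont.
Qed.

(** The derivative of [h] along a closed curve has integral zero. *)
Lemma cint_closed_curve (U : C -> Prop) h (g g' : R -> C) :
  open U -> Cn 1 U h -> (forall s, cderive g s (g' s)) -> (forall s, continuous g' s) ->
  g (2 * PI) = g 0 -> (forall s, U (g s)) ->
  cint (fun s => dx h (g s) * RtoC (Re (g' s)) + dy h (g s) * RtoC (Im (g' s)))%C = 0%C.
Proof.
  intros hU Hh Hg Hg' Hper HU. pose proof Hh as (H0 & H1 & [Hx _] & [Hy _]).
  assert (Cg : forall s, continuous g s) by (intros; eapply cderive_continuous; apply Hg).
  rewrite (cint_derive (fun s => h (g s))).
  - rewrite Hper. ring.
  - intros s. apply (cderive_comp U); auto.
  - cont.
Qed.

(** The point [exp(i t)] of the unit circle. *)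
Definition cis (t : R) : C := (cos t, sin t).

(** The circle of radius [r] about 0. *)
Definition circ (r s : R) : C := (RtoC r * cis s)%C.

Lemma Cmod_cis t : Cmod (cis t) = 1.
Proof.
  unfold Cmod, cis; simpl. rewrite !Rmult_1_r.
  rewrite Rplus_comm. pose proof (sin2_cos2 t) as H. unfold Rsqr in H. rewrite H. apply sqrt_1.
Qed.

Lemma cderive_cis t : cderive cis t (Ci * cis t)%C.
Proof. split; simpl; unfold cis; simpl; auto_derive; auto; ring. Qed.

Lemma cderive_circ r s : cderive (circ r) s (Ci * circ r s)%C.
Proof.
  eapply cderive_val.
  - apply (cderive_mult (fun _ => RtoC r)); [apply cderive_const|apply cderive_cis].
  - unfold circ. ring.
Qed.

Lemma continuous_cis t : continuous cis t.
Proof. eapply cderive_continuous, cderive_cis. Qed.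

Lemma continuous_circ r s : continuous (circ r) s.
Proof. eapply cderive_continuous, cderive_circ. Qed.

Lemma circ_2PI r : circ r (2 * PI) = circ r 0.
Proof. unfold circ, cis. rewrite cos_2PI, sin_2PI, cos_0, sin_0. reflexivity. Qed.

Lemma Cmod_circ r s : 0 <= r -> Cmod (circ r s) = r.
Proof. intros hr. unfold circ. rewrite Cmod_mult, Cmod_R, Cmod_cis, Rabs_right by lra. ring. Qed.

Lemma circ_nz r s : 0 < r -> circ r s <> 0%C.
Proof. intros hr e. pose proof (Cmod_circ r s) as E. rewrite e, Cmod_0 in E. lra. Qed.

Lemma RtoC_nz r : r <> 0 -> RtoC r <> 0%C.
Proof. intros h e. apply h, (f_equal Re e). Qed.

Lemma cint_circle (U : C -> Prop) h r : open U -> Cn 1 U h -> (forall s, U (circ r s)) ->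
  cint (fun s => dx h (circ r s) * RtoC (Re (Ci * circ r s)) +
                 dy h (circ r s) * RtoC (Im (Ci * circ r s)))%C = 0%C.
Proof.
  intros hU Hh HU. pose proof (continuous_circ r).
  apply (cint_closed_curve U h (circ r)); auto using cderive_circ, circ_2PI. cont.
Qed.

(** Radial derivative of a circle integral: Green's formula in polar form. *)
Lemma circle_derive (U : C -> Prop) k (T : R -> Prop) r :
  open U -> Cn 1 U k -> open T -> (forall r, T r -> 0 < r) ->
  (forall r, T r -> forall s, U (circ r s)) -> T r ->
  cderive (fun r => cint (fun s => k (circ r s))) r
    (cint (fun s => RtoC 2 * (Cconj (cis s) * dbar k (circ r s)))%C).
Proof.
  intros hU Hk hT Hpos HT hr. pose proof Hk as (H0 & H1 & [Hx _] & [Hy _]).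
  pose proof continuous_cis. pose proof (continuous_circ r).
  assert (E0 : forall r s, (0 + RtoC r * cis s)%C = circ r s) by (intros; unfold circ; ring).
  assert (P := cint_homotopy U k 0%C cis (fun _ => RtoC 1) T r hU Hk continuous_cis
    (fun s => continuous_const _ _) hT).
  specialize (P ltac:(intros; rewrite E0; auto) hr).
  pose proof (cint_circle U k r hU Hk (HT r hr)) as Q.
  refine (cderive_ext_loc _ _ _ _ _ (cderive_val _ _ _ _ P _)).
  - apply filter_forall. intros t. apply cint_ext. intros s. rewrite E0. ring.
  - (* the angular derivative integrates to zero and may be added *)
    rewrite (cint_ext _ (fun s => dx k (circ r s) * RtoC (Re (cis s)) +
      dy k (circ r s) * RtoC (Im (cis s)))%C) by (intros; rewrite E0; ring).
    match goal with |- ?A = ?B => match type of Q with ?q = _ =>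
      transitivity (A + Ci * / RtoC r * q)%C; [rewrite Q; ring|] end end.
    rewrite <- cint_scal, <- cint_plus by cont.
    apply cint_ext. intros s. unfold dbar.
    set (X := dx k _). set (Y := dy k _).
    assert (ER : RtoC (Re (Ci * circ r s)) = (RtoC r * RtoC (Re (Ci * cis s)))%C)
      by (apply C_eq; unfold Re, Im; simpl; ring).
    assert (EI : RtoC (Im (Ci * circ r s)) = (RtoC r * RtoC (Im (Ci * cis s)))%C)
      by (apply C_eq; unfold Re, Im; simpl; ring).
    rewrite ER, EI.
    transitivity ((X * RtoC (Re (cis s)) + Y * RtoC (Im (cis s))) + Ci *
      (X * RtoC (Re (Ci * cis s)) + Y * RtoC (Im (Ci * cis s))))%C.
    + field. apply RtoC_nz. specialize (Hpos r hr). lra.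
    + apply C_eq; unfold Re, Im; simpl; field.
Qed.

(** ** The function [1 / z] *)

Lemma Cnorm2_pos (z : C) : z <> 0%C -> Re z ^ 2 + Im z ^ 2 <> 0.
Proof.
  intros H K. apply H. apply Cmod_eq_0. rewrite <- Cmod2_alt in K.
  destruct (Rmult_integral _ _ K) as [|K']; [assumption|].
  now rewrite Rmult_1_r in K'.
Qed.

Lemma cderive_inv g t v : cderive g t v -> g t <> 0%C ->
  cderive (fun s => / g s)%C t (- (v * (/ g t * / g t)))%C.
Proof.
  intros [a b] h. pose proof (Cnorm2_pos _ h) as hn. split.
  - evar_last.
    + apply is_derive_Rmult; [exact a|].
      apply (is_derive_inv (fun s => Re (g s) ^ 2 + Im (g s) ^ 2)); [|exact hn].
      apply is_derive_plus_R; apply is_derive_pow; eassumption.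
    + cbv beta. destruct (g t) as [x y], v as [p q]. unfold Re, Im in *. simpl in *.
      unfold plus; simpl. field. rewrite !Rmult_1_r in hn. exact hn.
  - evar_last.
    + apply is_derive_Rmult; [apply is_derive_opp_R; exact b|].
      apply (is_derive_inv (fun s => Re (g s) ^ 2 + Im (g s) ^ 2)); [|exact hn].
      apply is_derive_plus_R; apply is_derive_pow; eassumption.
    + cbv beta. destruct (g t) as [x y], v as [p q]. unfold Re, Im in *. simpl in *.
      unfold plus, opp; simpl. field. rewrite !Rmult_1_r in hn. exact hn.
Qed.

(** The punctured plane. *)
Definition nonzeroC (z : C) : Prop := z <> 0%C.

Lemma open_nonzeroC : open nonzeroC.
Proof.
  intros z hz. generalize (open_exterior 0 z (proj1 (Cmod_gt_0 z) hz)).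
  apply filter_imp. intros w hw. apply Cmod_gt_0, hw.
Qed.

Lemma continuous_Cinv (z : C) : z <> 0%C -> continuous Cinv z.
Proof.
  intros hz.
  apply (continuous_ext (fun z => Cconj z * RtoC (/ (Re z ^ 2 + Im z ^ 2)))%C).
  { intros w. apply C_eq; unfold Re, Im; simpl; unfold Rdiv; ring. }
  pose proof (proj1 (continuous_C_iff (fun w : C => w) z) (continuous_id z)) as [a b].
  apply continuous_Cmult; [apply continuous_Cconj, continuous_id|].
  apply continuous_RtoC. apply (continuous_comp (fun z => Re z ^ 2 + Im z ^ 2) Rinv).
  - apply continuous_plus_R; simpl;
      apply continuous_mult_R; auto;
      apply continuous_mult_R; auto; apply continuous_const.
  - apply continuity_pt_filterlim, continuity_pt_inv.
    + apply derivable_continuous_pt, derivable_pt_id.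
    + apply Cnorm2_pos; assumption.
Qed.

Lemma is_pd_inv b (z : C) : z <> 0%C -> is_pd b Cinv z (- (dz1 b * (/ z * / z)))%C.
Proof.
  intros hz. pose proof (cderive_inv _ _ _ (is_pd_id b z)) as H.
  cbv beta in H. rewrite slice_coord in H. exact (H hz).
Qed.

Lemma Cn_inv n : Cn n nonzeroC Cinv.
Proof.
  induction n as [|n IH].
  - split; auto. intros; apply continuous_Cinv; assumption.
  - apply Cn_intro.
    + intros; apply continuous_Cinv; assumption.
    + intros z hz; apply diff_at_is; intros b; eexists; apply is_pd_inv; assumption.
    + intros b. apply (Cn_ext n nonzeroC (fun z => (- dz1 b) * (/ z * / z))%C).
      * apply open_nonzeroC.
      * intros z hz. rewrite (is_pd_unique _ _ _ _ (is_pd_inv b z hz)). ring.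
      * apply (Cn_mult n nonzeroC (fun _ => _)); [apply open_nonzeroC| |].
        apply Cn_const, open_nonzeroC.
        apply Cn_mult; auto using open_nonzeroC.
Qed.

Lemma Lop_invpow l n (z : C) : z <> 0%C ->
  Lop l (fun w => (/ w) ^ n)%C z = (- (INR n * (/ z) ^ S n * lz l))%C.
Proof.
  intros hz. rewrite Lop_pd. unfold lz.
  rewrite !(is_pd_unique _ _ _ _ (is_pd_pow _ Cinv _ _ n (is_pd_inv _ z hz))).
  destruct n; simpl; ring.
Qed.

Lemma d_invpow n (z : C) : z <> 0%C ->
  dx (fun w => (/ w) ^ n)%C z = (- (INR n * (/ z) ^ S n))%C /\
  dy (fun w => (/ w) ^ n)%C z = (Ci * - (INR n * (/ z) ^ S n))%C.
Proof.
  intros hz. rewrite <- Lop_X, <- Lop_Y, !Lop_invpow by exact hz.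
  unfold lz, lX, lY; cbn [fst snd]. split; ring.
Qed.

(** ** Mean value inequality *)

(** The factor 2 comes from estimating the two components separately. *)
Lemma mean_value (f f' : R -> C) a b M : a < b ->
  (forall t, a < t < b -> cderive f t (f' t)) ->
  (forall t, a <= t <= b -> continuous f t) ->
  (forall t, a <= t <= b -> Cmod (f' t) <= M) ->
  Cmod (f b - f a) <= 2 * M * (b - a).
Proof.
  intros hab H Hc HM.
  assert (K : forall u u' : R -> R, (forall t, a < t < b -> is_derive u t (u' t)) ->
    (forall t, a <= t <= b -> continuous u t) -> (forall t, a <= t <= b -> Rabs (u' t) <= M) ->
    Rabs (u b - u a) <= M * (b - a)).
  { intros u u' h1 h2 h3.
    destruct (MVT_gen u a b u') as (c & hc & e).
    - rewrite Rmin_left, Rmax_right by lra. exact h1.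
    - rewrite Rmin_left, Rmax_right by lra. intros x hx.
      apply continuity_pt_filterlim, h2, hx.
    - rewrite Rmin_left, Rmax_right in hc by lra.
      rewrite e, Rabs_mult, (Rabs_right (b - a)) by lra.
      apply Rmult_le_compat_r; [lra|auto]. }
  eapply Rle_trans; [apply Cmod_le_ReIm|].
  pose proof (K (fun t => Re (f t)) (fun t => Re (f' t)) (fun t h => proj1 (H t h))
    (fun t h => proj1 (proj1 (continuous_C_iff f t) (Hc t h)))
    (fun t h => Rle_trans _ _ _ (re_le_Cmod _) (HM t h))) as K1.
  pose proof (K (fun t => Im (f t)) (fun t => Im (f' t)) (fun t h => proj2 (H t h))
    (fun t h => proj2 (proj1 (continuous_C_iff f t) (Hc t h)))
    (fun t h => Rle_trans _ _ _ (im_le_Cmod _) (HM t h))) as K2.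
  change (Rabs (Re (f b) - Re (f a)) + Rabs (Im (f b) - Im (f a)) <= 2 * M * (b - a)).
  lra.
Qed.

Lemma Cminus_eq_0 (a b : C) : Cmod (a - b) <= 0 -> a = b.
Proof.
  intros H. pose proof (Cmod_ge_0 (a - b)).
  assert (E : (a - b)%C = 0%C) by (apply Cmod_eq_0; lra).
  replace a with ((a - b) + b)%C by ring. rewrite E. ring.
Qed.

Lemma cint_zero (f : R -> C) : (forall t, f t = 0%C) -> cint f = 0%C.
Proof.
  intros H. rewrite (cint_ext _ (fun _ => RtoC 0)) by exact H.
  apply Cminus_eq_0. replace (cint (fun _ => RtoC 0) - 0)%C with (cint (fun _ => RtoC 0)) by ring.
  eapply Rle_trans; [apply (cint_bound _ 0)|lra].
  - intros; apply continuous_const.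
  - intros; rewrite Cmod_0; lra.
Qed.

(** ** Laurent coefficients of a function on circles about 0 *)

(** The integral over [0, 2 pi] of [h(zeta) zeta^(-n)] with [zeta = r exp(i s)]: up
  to the factor [2 pi], the [n]-th Laurent coefficient of [h] on this circle. *)
Definition ecoef (h : C -> C) (n : nat) (r : R) : C :=
  cint (fun s => h (circ r s) * (/ circ r s) ^ n)%C.

Lemma Cn_kernel n U h p : open U -> Cn n U h ->
  Cn n (fun z => U z /\ nonzeroC z) (fun z => h z * (/ z) ^ p)%C.
Proof.
  intros hU H. assert (hV := open_and _ _ hU open_nonzeroC).
  apply (Cn_mult n _ h (fun z => (/ z) ^ p)%C hV).
  - eapply Cn_sub; [|exact H]. tauto.
  - apply Cn_pow; auto. eapply Cn_sub; [|apply Cn_inv]. tauto.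
Qed.

(** Only [dbar h] enters, because [zeta^(-n)] is holomorphic. *)
Lemma ecoef_derive (U : C -> Prop) h n (T : R -> Prop) r :
  open U -> Cn 1 U h -> open T -> (forall r, T r -> 0 < r) ->
  (forall r, T r -> forall s, U (circ r s)) -> T r ->
  cderive (ecoef h n) r
    (cint (fun s => RtoC 2 * (Cconj (cis s) *
       (dbar h (circ r s) * (/ circ r s) ^ n)))%C).
Proof.
  intros hU Hh hT hp HT hr.
  assert (hV := open_and _ _ hU open_nonzeroC).
  eapply cderive_val.
  - apply (circle_derive (fun z => U z /\ nonzeroC z) (fun z => h z * (/ z) ^ n)%C T r hV); auto.
    + apply Cn_kernel; auto.
    + intros t ht s. split; [auto|]. apply circ_nz; auto.
  - apply cint_ext. intros s. do 2 f_equal. rewrite <- Lop_Zbar.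
    assert (hz : (circ r s) <> 0%C) by (apply circ_nz; auto).
    rewrite (Lop_mult lZbar h (fun z => (/ z) ^ n)%C), Lop_invpow, lz_Zbar; auto.
    + ring.
    + eapply Cn_diff; [exact Hh|]. auto.
    + eapply (Cn_diff 0 nonzeroC); [|exact hz]. apply Cn_pow; auto using open_nonzeroC, Cn_inv.
Qed.

Lemma continuous_circ_invpow r n s : 0 < r -> continuous (fun s => ((/ circ r s) ^ n)%C) s.
Proof.
  intros hr. apply (continuous_comp (circ r) (fun w => (/ w) ^ n)%C); [apply continuous_circ|].
  apply (Cn_continuous 0 nonzeroC); [|apply circ_nz; auto].
  apply Cn_pow; auto using open_nonzeroC, Cn_inv.
Qed.

Lemma ecoef_bound h n r M : 0 < r -> (forall s, continuous (fun s => h (circ r s)) s) ->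
  (forall s, 0 <= s <= 2 * PI -> Cmod (h (circ r s)) <= M) ->
  Cmod (ecoef h n r) <= 4 * PI * (M * (/ r) ^ n).
Proof.
  intros hr Hc HM. apply cint_bound.
  - intros s. apply continuous_Cmult; [apply Hc|apply continuous_circ_invpow; auto].
  - intros s hs. rewrite Cmod_mult, Cmod_pow, Cmod_inv, Cmod_circ by (try apply circ_nz; lra).
    apply Rmult_le_compat_r; [|auto]. apply pow_le. left; apply Rinv_0_lt_compat; auto.
Qed.

(** ** Holomorphic functions on the disk *)

(** Holomorphic functions on the unit disk: functions of class C^1 which satisfy
  the Cauchy-Riemann equation. *)
Definition holomorphic (h : C -> C) : Prop :=
  Cn 1 unit_disk h /\ forall z, unit_disk z -> dbar h z = 0%C.

Lemma disk_circ r s : 0 <= r < 1 -> unit_disk (circ r s).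
Proof. intros h. unfold unit_disk. rewrite Cmod_circ; lra. Qed.

Lemma open_Ioo a b : open (fun r : R => a < r < b).
Proof. apply open_and; [apply open_gt | apply open_lt]. Qed.

Lemma cont_on_circle (U : C -> Prop) n h r : Cn n U h -> (forall s, U (circ r s)) ->
  forall s, continuous (fun s => h (circ r s)) s.
Proof.
  intros H hr s. apply (continuous_comp (circ r) h); [apply continuous_circ|].
  eapply Cn_continuous; [exact H|auto].
Qed.

Lemma ecoef_const h n r r' : holomorphic h -> 0 < r -> r < r' -> r' < 1 ->
  ecoef h n r' = ecoef h n r.
Proof.
  intros [Hh H0] h1 h2 h3.
  assert (D : forall t, 0 < t < 1 -> cderive (ecoef h n) t 0).
  { intros t ht. eapply cderive_val.
    - apply (ecoef_derive unit_disk h n (fun r => 0 < r < 1)); auto using open_disk, open_Ioo.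
      + intros; lra.
      + intros; apply disk_circ; lra.
    - apply cint_zero. intros s. rewrite H0 by (apply disk_circ; lra). ring. }
  apply Cminus_eq_0. replace 0 with (2 * 0 * (r' - r)) by ring.
  apply (mean_value _ (fun _ => RtoC 0)); auto.
  - intros; apply D; lra.
  - intros; eapply cderive_continuous, D; lra.
  - intros; rewrite Cmod_0; lra.
Qed.

(** ** Finite sums and convergent series of complex numbers *)

(** The sum of the [a i] with [i < n]. *)
Fixpoint csum (n : nat) (a : nat -> C) : C :=
  match n with O => RtoC 0 | S m => (csum m a + a m)%C end.

(** The series with terms [a n] converges to [l]. *)
Definition is_cser (a : nat -> C) (l : C) : Prop :=
  forall eps, 0 < eps -> exists M0, forall M, (M0 <= M)%nat -> Cmod (csum M a - l) < eps.

Lemma csum_ext n a b : (forall i, (i < n)%nat -> a i = b i) -> csum n a = csum n b.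
Proof. induction n; simpl; intros H; auto. rewrite IHn, H; auto. Qed.

Lemma csum_scal n c a : csum n (fun i => c * a i)%C = (c * csum n a)%C.
Proof. induction n; simpl; [ring|]. rewrite IHn; ring. Qed.

Lemma csum_plus n a b : csum n (fun i => a i + b i)%C = (csum n a + csum n b)%C.
Proof. induction n; simpl; [ring|]. rewrite IHn; ring. Qed.

Lemma csum_cint M (g : nat -> R -> C) : (forall n s, continuous (g n) s) ->
  cint (fun s => csum M (fun n => g n s)) = csum M (fun n => cint (g n)) /\
  forall s, continuous (fun s => csum M (fun n => g n s)) s.
Proof.
  intros Hg. induction M as [|M [IH1 IH2]]; simpl.
  - split; [|intros; apply continuous_const].
    apply cint_zero; reflexivity.
  - split.
    + rewrite cint_plus, IH1; auto.
    + intros; apply continuous_Cplus; auto.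
Qed.

Lemma cgeom q M : (1 - q)%C <> 0%C ->
  (/ (1 - q) = csum M (fun n => q ^ n) + q ^ M * / (1 - q))%C.
Proof.
  intros hq. induction M as [|M IH].
  - simpl. ring.
  - rewrite IH at 1. simpl. field. exact hq.
Qed.

Lemma Cmod_1_minus q : 1 - Cmod q <= Cmod (1 - q).
Proof.
  pose proof (Cmod_triangle (1 - q) q) as H.
  replace (1 - q + q)%C with (RtoC 1) in H by ring. rewrite Cmod_1 in H. lra.
Qed.

(** The Cauchy kernel [zeta / (zeta - z)] at the point [zeta] of the circle of
  radius [R] with argument [s]. *)
Definition cker (z : C) (R s : R) : C := (/ (1 - z * / circ R s))%C.

Lemma cker_bounds z R s : Cmod z < R ->
  (1 - z * / circ R s)%C <> 0%C /\ Cmod (z * / circ R s) = Cmod z / R /\ Cmod z / R < 1 /\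
  Cmod (cker z R s) <= / (1 - Cmod z / R).
Proof.
  intros hz. pose proof (Cmod_ge_0 z) as h0. assert (hR : 0 < R) by lra.
  assert (E : Cmod (z * / circ R s) = Cmod z / R).
  { rewrite Cmod_mult, Cmod_inv, Cmod_circ by (try apply circ_nz; lra). reflexivity. }
  assert (L : Cmod z / R < 1) by (apply (Rdiv_lt_1 (Cmod z) R hR); exact hz).
  pose proof (Cmod_1_minus (z * / circ R s)) as K. rewrite E in K.
  assert (N : (1 - z * / circ R s)%C <> 0%C).
  { intros h. rewrite h, Cmod_0 in K. lra. }
  repeat (split; [assumption|]). unfold cker.
  rewrite Cmod_inv by exact N. apply Rinv_le_contravar; lra.
Qed.

Lemma continuous_cker z R s : Cmod z < R -> continuous (cker z R) s.
Proof.
  intros hz. pose proof (Cmod_ge_0 z) as h0. assert (hR : 0 < R) by lra.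
  apply (continuous_comp (fun s => (1 - z * / circ R s)%C) Cinv).
  - apply (continuous_ext (fun s => 1 + (- z) * (/ circ R s) ^ 1)%C).
    { intros x. match goal with |- ?a = ?b => change (@eq C a b) end. ring. }
    cont. apply continuous_circ_invpow; auto.
  - apply continuous_Cinv, cker_bounds; auto.
Qed.

(** Expansion of the Cauchy kernel in a geometric series. *)
Lemma cauchy_kernel_series (g : R -> C) z R G : (forall s, continuous g s) ->
  (forall s, 0 <= s <= 2 * PI -> Cmod (g s) <= G) -> Cmod z < R ->
  is_cser (fun n => z ^ n * cint (fun s => g s * (/ circ R s) ^ n))%C
    (cint (fun s => g s * cker z R s)%C).
Proof.
  intros Hg HG hz eps heps. pose proof (Cmod_ge_0 z) as h0. assert (hR : 0 < R) by lra.
  pose proof PI_RGT_0 as hPI.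
  assert (HG0 : 0 <= G) by (eapply Rle_trans; [apply Cmod_ge_0|apply (HG 0)]; lra).
  assert (L0 : 0 <= Cmod z / R) by (apply Rdiv_le_0_compat; lra).
  destruct (cker_bounds z R 0 hz) as (_ & _ & L & _).
  set (q := Cmod z / R) in *.
  set (B := 4 * PI * (G * / (1 - q)) + 1).
  assert (HB : 1 <= B).
  { unfold B. apply Rle_trans with (0 + 1); [lra|]. apply Rplus_le_compat_r, Rmult_le_pos; [lra|].
    apply Rmult_le_pos; [lra|left; apply Rinv_0_lt_compat; lra]. }
  destruct (pow_lt_1_zero q) with (y := eps / B) as [M0 HM0].
  { rewrite Rabs_right; lra. }
  { apply Rdiv_lt_0_compat; lra. }
  exists M0. intros M hM. specialize (HM0 M hM).
  assert (hq : 0 <= q ^ M) by (apply pow_le; auto). rewrite Rabs_right in HM0 by lra.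
  assert (Hp : forall n s, continuous (fun s => ((/ circ R s) ^ n)%C) s)
    by (intros; apply continuous_circ_invpow; auto).
  assert (Hk : forall s, continuous (cker z R) s) by (intros; apply continuous_cker; auto).
  destruct (csum_cint M (fun n s => z ^ n * (g s * (/ circ R s) ^ n))%C) as [S1 S2].
  { cont. }
  rewrite (cint_ext (fun s => g s * cker z R s)%C
    (fun s => csum M (fun n => z ^ n * (g s * (/ circ R s) ^ n)) +
      z ^ M * (g s * ((/ circ R s) ^ M * cker z R s)))%C).
  2:{ intros s. unfold cker at 1. rewrite (cgeom (z * / circ R s) M) by (apply cker_bounds; auto).
      rewrite (csum_ext M (fun n => z ^ n * (g s * (/ circ R s) ^ n))%C
        (fun n => g s * (z * / circ R s) ^ n)%C) by (intros; rewrite Cpow_mult_l; ring).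
      rewrite (csum_scal M (g s) (fun n => (z * / circ R s) ^ n)%C), Cpow_mult_l.
      unfold cker. ring. }
  rewrite cint_plus, S1, (cint_scal (z ^ M)%C (fun s => g s * ((/ circ R s) ^ M * cker z R s))%C);
    [|cont|exact S2|cont].
  rewrite (csum_ext M _ (fun n => cint (fun s => z ^ n * (g s * (/ circ R s) ^ n)))%C).
  2:{ intros i _. rewrite cint_scal; [reflexivity|]. cont. }
  match goal with |- Cmod (?a - (?b + ?y)) < _ =>
    replace (a - (b + y))%C with (- y)%C by ring end.
  rewrite Cmod_opp, <- cint_scal by cont.
  eapply Rle_lt_trans.
  - apply (cint_bound _ (G * (q ^ M * / (1 - q)))); [cont|].
    intros s hs. destruct (cker_bounds z R s hz) as (_ & E & _ & K).
    replace (z ^ M * (g s * ((/ circ R s) ^ M * cker z R s)))%C with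
      (g s * ((z * / circ R s) ^ M * cker z R s))%C by (rewrite Cpow_mult_l; ring).
    rewrite !Cmod_mult, Cmod_pow, E. fold q in K |- *.
    apply Rmult_le_compat; auto using Cmod_ge_0.
    + apply Rmult_le_pos; auto using Cmod_ge_0.
    + apply Rmult_le_compat_l; auto.
  - apply Rle_lt_trans with (B * q ^ M); [unfold B; lra|].
    apply Rmult_lt_reg_l with (/ B); [apply Rinv_0_lt_compat; lra|].
    unfold Rdiv in HM0. rewrite <- Rmult_assoc, Rinv_l by lra. lra.
Qed.

Lemma is_cser_unique a l l' : is_cser a l -> is_cser a l' -> l = l'.
Proof.
  intros H H'. apply Cminus_eq_0. apply Rnot_lt_le. intros K.
  destruct (H (Cmod (l - l') / 2)) as [M HM]; [lra|].
  destruct (H' (Cmod (l - l') / 2)) as [M' HM']; [lra|].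
  specialize (HM (Nat.max M M') (Nat.le_max_l _ _)).
  specialize (HM' (Nat.max M M') (Nat.le_max_r _ _)).
  pose proof (Cmod_triangle (csum (Nat.max M M') a - l') (- (csum (Nat.max M M') a - l))) as T.
  rewrite Cmod_opp in T.
  replace (csum (Nat.max M M') a - l' + - (csum (Nat.max M M') a - l))%C with (l - l')%C in T by ring.
  lra.
Qed.

(** ** Cauchy's formula and Taylor series *)

Lemma dbar_zero_dy h z : dbar h z = 0%C -> dy h z = (Ci * dx h z)%C.
Proof.
  unfold dbar. intros H.
  assert (E : (dx h z + Ci * dy h z)%C = 0%C).
  { replace (dx h z + Ci * dy h z)%C with (RtoC 2 * (RtoC (1/2) * (dx h z + Ci * dy h z)))%C.
    - rewrite H. ring.
    - apply C_eq; simpl; field. }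
  replace (dy h z) with ((- Ci) * (dx h z + Ci * dy h z) + Ci * dx h z)%C.
  - rewrite E. ring.
  - apply C_eq; simpl; ring.
Qed.

Lemma Ci_nz : Ci <> 0%C.
Proof. intros e; apply (f_equal Im) in e; simpl in e; lra. Qed.

(** The derivative of a function with [dy = i dx] in the direction [w]. *)
Lemma complex_direction (d w : C) : (d * RtoC (Re w) + Ci * d * RtoC (Im w))%C = (d * w)%C.
Proof. apply C_eq; unfold Re, Im; simpl; ring. Qed.

(** Cauchy's integral formula: the integral over the circle of radius [R] is
  carried to the point [z] along the homotopy [z + t (zeta - z)], along which
  it is constant. *)
Lemma cauchy_formula h z R : holomorphic h -> Cmod z < R -> R < 1 ->
  cint (fun s => h (circ R s) * cker z R s)%C = (h z * cint (cker z R))%C.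
Proof.
  intros [Hh H0] hz hR1. pose proof (Cmod_ge_0 z) as h0. assert (hR : 0 < R) by lra.
  pose proof Hh as (_ & _ & [Hx _] & [Hy _]). pose proof (continuous_circ R).
  pose (v := fun s => (circ R s - z)%C).
  (* the parameters for which the homotopy certainly stays in the disk *)
  pose (T := fun t => Rabs (1 - t) * Cmod z + Rabs t * R < 1).
  assert (Cv : forall s, continuous v s) by (unfold v; cont).
  assert (Ck : forall s, continuous (cker z R) s) by (intros; apply continuous_cker; auto).
  assert (Cabs : forall x, continuous Rabs x)
    by (intros; apply continuity_pt_filterlim, Rcontinuity_abs).
  assert (hT : open T).
  { apply (open_comp (fun t => Rabs (1 - t) * Cmod z + Rabs t * R) (fun x => x < 1)); [|apply open_lt].
    intros t _. apply (continuous_plus_R (fun t => Rabs (1 - t) * Cmod z) (fun t => Rabs t * R)).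
    - apply (continuous_mult_R (fun t => Rabs (1 - t)) (fun _ => Cmod z)); [|apply continuous_const].
      apply (continuous_comp (fun t => 1 - t) Rabs); auto.
      apply continuous_minus_R; [apply continuous_const|apply continuous_id].
    - apply (continuous_mult_R Rabs (fun _ => R)); [auto|apply continuous_const]. }
  assert (TD : forall t, T t -> forall s, unit_disk (z + RtoC t * v s)%C).
  { intros t ht s. unfold unit_disk, v.
    replace (z + RtoC t * (circ R s - z))%C with
      (RtoC (1 - t) * z + RtoC t * circ R s)%C by (rewrite RtoC_minus; ring).
    eapply Rle_lt_trans; [apply Cmod_triangle|].
    rewrite !Cmod_mult, !Cmod_R, Cmod_circ by lra. exact ht. }
  assert (T01 : forall t, 0 <= t <= 1 -> T t).
  { intros t ht. unfold T. rewrite !Rabs_right by lra. nra. }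
  pose (phi := fun t => cint (fun s => h (z + RtoC t * v s) * cker z R s)%C).
  pose (dphi := fun t => cint (fun s => (dx h (z + RtoC t * v s) * RtoC (Re (v s)) +
    dy h (z + RtoC t * v s) * RtoC (Im (v s))) * cker z R s)%C).
  assert (D : forall t, T t -> cderive phi t (dphi t)).
  { intros t ht. apply (cint_homotopy unit_disk h z v (cker z R) T t); auto using open_disk. }
  assert (D0 : forall t, 0 < t < 1 -> dphi t = 0%C).
  { intros t ht. assert (hTt : T t) by (apply T01; lra).
    assert (Q : cint (fun s => dx h (z + RtoC t * v s) * RtoC (Re (RtoC t * (Ci * circ R s))) +
      dy h (z + RtoC t * v s) * RtoC (Im (RtoC t * (Ci * circ R s))))%C = 0%C).
    { apply (cint_closed_curve unit_disk h (fun s => z + RtoC t * v s)%C); auto using open_disk.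
      - intros s. eapply cderive_val.
        + apply (cderive_plus (fun _ => z)); [apply cderive_const|].
          apply (cderive_mult (fun _ => RtoC t)); [apply cderive_const|].
          apply (cderive_plus (circ R) (fun _ => (- z)%C)); [apply cderive_circ|apply cderive_const].
        + ring.
      - cont.
      - unfold v. rewrite circ_2PI. reflexivity. }
    pose proof Ci_nz. assert (htc : RtoC t <> 0%C) by (apply RtoC_nz; lra).
    match type of Q with ?q = _ => transitivity (/ (Ci * RtoC t) * q)%C; [|rewrite Q; ring] end.
    rewrite <- cint_scal by cont.
    apply cint_ext. intros s. rewrite !(dbar_zero_dy h _ (H0 _ (TD t hTt s))), !complex_direction.
    (* the kernel cancels the factor [zeta - z] of the velocity *)
    destruct (cker_bounds z R s hz) as (N & _). pose proof (circ_nz R s hR) as N2.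
    unfold v, cker. set (c := circ R s) in *.
    assert (N5 : (c - z)%C <> 0%C).
    { intros e. apply N. replace z with c; [field; exact N2|].
      replace c with ((c - z) + z)%C at 1 by ring. rewrite e. ring. }
    field. repeat split; auto. }
  assert (E : phi 1 = phi 0).
  { apply Cminus_eq_0. eapply Rle_trans; [apply (mean_value phi (fun _ => RtoC 0) 0 1 0); try lra|lra].
    - intros t ht. rewrite <- (D0 t ht). apply D, T01; lra.
    - intros t ht. eapply cderive_continuous, D, T01; auto.
    - intros; rewrite Cmod_0; lra. }
  rewrite <- cint_scal by exact Ck. transitivity (phi 1); [|rewrite E]; apply cint_ext; intros s; unfold v.
  - replace (z + RtoC 1 * (circ R s - z))%C with (circ R s) by ring. reflexivity.
  - replace (z + RtoC 0 * (circ R s - z))%C with z by ring. reflexivity.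
Qed.

Lemma cint_const c : cint (fun _ => c) = (RtoC (2 * PI) * c)%C.
Proof.
  apply C_eq; simpl; rewrite RInt_const_R; unfold scal; simpl; unfold mult, Re, Im; simpl; ring.
Qed.

Lemma cint_invpow r n : 0 < r -> (0 < n)%nat -> cint (fun s => (/ circ r s) ^ n)%C = 0%C.
Proof.
  intros hr hn.
  assert (Q := cint_circle nonzeroC (fun w => (/ w) ^ n)%C r open_nonzeroC
    (Cn_pow 1 nonzeroC Cinv n open_nonzeroC (Cn_inv 1)) (fun s => circ_nz r s hr)).
  rewrite (cint_ext _ (fun s => - (INR n * Ci) * (/ circ r s) ^ n)%C) in Q.
  - rewrite cint_scal in Q by (intros; apply continuous_circ_invpow; auto).
    assert (hn' : RtoC (INR n) <> 0%C) by (apply RtoC_nz; apply lt_0_INR in hn; lra).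
    set (I := cint _) in *.
    replace I with (/ (- (RtoC (INR n) * Ci)) * (- (RtoC (INR n) * Ci) * I))%C; [rewrite Q; ring|].
    field. split; auto using Ci_nz.
  - intros s. pose proof (circ_nz r s hr) as N.
    destruct (d_invpow n (circ r s) N) as [-> ->]. rewrite complex_direction, Cpow_S.
    field. exact N.
Qed.

Lemma csum_first M (a : nat -> C) : (forall n, (0 < n)%nat -> a n = 0%C) -> csum (S M) a = a O.
Proof.
  intros H. induction M as [|M IH]; [simpl; ring|].
  change (csum (S M) a + a (S M) = a O)%C. rewrite IH, (H (S M)) by lia. ring.
Qed.

Lemma cint_cker z R : Cmod z < R -> cint (cker z R) = RtoC (2 * PI).
Proof.
  intros hz. pose proof (Cmod_ge_0 z) as h0. assert (hR : 0 < R) by lra.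
  assert (S1 := cauchy_kernel_series (fun _ => RtoC 1) z R 1 (fun s => continuous_const _ _)
    (fun s _ => Req_le _ _ Cmod_1) hz).
  rewrite (cint_ext _ (cker z R)) in S1 by (intros; ring).
  eapply is_cser_unique; [exact S1|].
  intros eps he. exists 1%nat. intros M hM. destruct M as [|M]; [lia|].
  rewrite csum_first.
  - rewrite (cint_ext _ (fun _ => RtoC 1)) by (intros; simpl; ring).
    rewrite cint_const. simpl.
    replace (1 * (RtoC (2 * PI) * 1) - RtoC (2 * PI))%C with (RtoC 0) by ring.
    rewrite Cmod_0; lra.
  - intros n hn. rewrite (cint_ext _ (fun s => (/ circ R s) ^ n)%C) by (intros; ring).
    rewrite cint_invpow by auto. ring.
Qed.

(** The Taylor coefficients at 0 of a holomorphic function on the disk; any radius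
  in (0, 1) gives the same value. *)
Definition coef (h : C -> C) (n : nat) : C := (ecoef h n (1 / 2) / RtoC (2 * PI))%C.

Lemma coef_eq h n r : holomorphic h -> 0 < r < 1 -> coef h n = (ecoef h n r / RtoC (2 * PI))%C.
Proof.
  intros Hh hr. unfold coef. f_equal.
  destruct (Rtotal_order r (1/2)) as [L|[L|L]].
  - apply ecoef_const; auto; lra.
  - now subst.
  - symmetry; apply ecoef_const; auto; lra.
Qed.

Lemma RtoC_2PI_nz : RtoC (2 * PI) <> 0%C.
Proof. apply RtoC_nz. pose proof two_PI_pos. lra. Qed.

Lemma is_cser_scal a l c : is_cser a l -> is_cser (fun n => c * a n)%C (c * l)%C.
Proof.
  intros H eps he.
  pose proof (Cmod_ge_0 c) as hc.
  destruct (H (eps / (Cmod c + 1))) as [M0 HM0]; [apply Rdiv_lt_0_compat; lra|].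
  exists M0. intros M hM. specialize (HM0 M hM).
  rewrite csum_scal. replace (c * csum M a - c * l)%C with (c * (csum M a - l))%C by ring.
  rewrite Cmod_mult. apply Rle_lt_trans with ((Cmod c) * (eps / (Cmod c + 1))).
  - apply Rmult_le_compat_l; lra.
  - apply Rlt_le_trans with ((Cmod c + 1) * (eps / (Cmod c + 1))).
    + apply Rmult_lt_compat_r; [apply Rdiv_lt_0_compat; lra|lra].
    + apply Req_le. field. lra.
Qed.

Lemma is_cser_ext a b l : (forall n, a n = b n) -> is_cser a l -> is_cser b l.
Proof.
  intros E H eps he. destruct (H eps he) as [M0 HM0]. exists M0. intros M hM.
  rewrite <- (csum_ext M a b) by auto. auto.
Qed.

Lemma circle_cont_bounded (f : R -> C) : (forall s, continuous f s) ->
  exists G, 0 <= G /\ forall s, 0 <= s <= 2 * PI -> Cmod (f s) <= G.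
Proof.
  intros H.
  destruct (bounded_continuity (K := R_AbsRing) (V := R_NormedModule) (fun s => Re (f s)) 0 (2 * PI)) as [A HA].
  { intros x _. apply (cont_Re f H x). }
  destruct (bounded_continuity (K := R_AbsRing) (V := R_NormedModule) (fun s => Im (f s)) 0 (2 * PI)) as [B HB].
  { intros x _. apply (cont_Im f H x). }
  assert (K : forall s, 0 <= s <= 2 * PI -> Cmod (f s) <= A + B).
  { intros s hs. eapply Rle_trans; [apply Cmod_le_ReIm|].
    specialize (HA s hs). specialize (HB s hs). unfold norm in HA, HB; simpl in HA, HB.
    unfold abs in HA, HB; simpl in HA, HB. lra. }
  exists (A + B). split; [|exact K].
  eapply Rle_trans; [apply Cmod_ge_0|apply (K 0)]. pose proof two_PI_pos; lra.
Qed.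

(** A holomorphic function on the disk is the sum of its Taylor series. *)
Lemma holomorphic_series h z : holomorphic h -> unit_disk z ->
  is_cser (fun n => coef h n * z ^ n)%C (h z).
Proof.
  intros Hh hz. unfold unit_disk in hz. pose proof (Cmod_ge_0 z) as h0.
  set (R := (1 + Cmod z) / 2).
  assert (h1 : Cmod z < R) by (unfold R; lra). assert (h2 : R < 1) by (unfold R; lra).
  assert (Hc : forall s, continuous (fun s => h (circ R s)) s).
  { apply (cont_on_circle unit_disk 1); [apply Hh|]. intros; apply disk_circ; lra. }
  destruct (circle_cont_bounded _ Hc) as (G & _ & HG).
  pose proof (cauchy_kernel_series _ z R G Hc HG h1) as S1.
  cbv beta in S1.
  rewrite (cauchy_formula h z R Hh h1 h2), (cint_cker z R h1) in S1.
  apply (is_cser_scal _ _ (/ RtoC (2 * PI))%C) in S1.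
  replace (h z) with (/ RtoC (2 * PI) * (h z * RtoC (2 * PI)))%C by (field; apply RtoC_2PI_nz).
  revert S1. apply is_cser_ext. intros n.
  rewrite (coef_eq h n R Hh) by lra. unfold ecoef. field. apply RtoC_2PI_nz.
Qed.

Lemma bernoulli n d : 0 <= d <= 1 -> 1 - INR n * d <= (1 - d) ^ n.
Proof.
  intros hd. induction n as [|n IH]; [simpl; lra|].
  rewrite S_INR. simpl. pose proof (pos_INR n).
  nra.
Qed.

(** Cauchy's estimate on the whole disk, with the factor 2 of [cint_bound]. *)
Lemma coef_bound h n M : holomorphic h -> (forall z, unit_disk z -> Cmod (h z) <= M) ->
  Cmod (coef h n) <= 2 * M.
Proof.
  intros Hh HM. set (a := Cmod (coef h n)).

  assert (HM0 : 0 <= M).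
  { eapply Rle_trans; [apply Cmod_ge_0|apply (HM 0%C)]. unfold unit_disk; rewrite Cmod_0; lra. }
  assert (K : forall r, 0 < r < 1 -> a * r ^ n <= 2 * M).
  { intros r hr. unfold a. rewrite (coef_eq h n r Hh hr).
    rewrite Cmod_div by apply RtoC_2PI_nz.
    pose proof two_PI_pos as hp. rewrite Cmod_R, (Rabs_right (2 * PI)) by lra.
    assert (B : Cmod (ecoef h n r) <= 4 * PI * (M * (/ r) ^ n)).
    { apply ecoef_bound; [lra| |].
      - apply (cont_on_circle unit_disk 1); [apply Hh|]. intros; apply disk_circ; lra.
      - intros; apply HM, disk_circ; lra. }
    assert (hrn : 0 < r ^ n) by (apply pow_lt; lra).
    rewrite pow_inv in B.
    apply (Rmult_le_compat_r (r ^ n)) in B; [|lra].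
    replace (4 * PI * (M * / r ^ n) * r ^ n) with ((2 * PI) * (2 * M)) in B by (field; lra).
    apply Rmult_le_reg_l with (2 * PI); [lra|].
    eapply Rle_trans; [|exact B]. apply Req_le. field. lra. }
  apply Rnot_lt_le. intros L.
  pose proof (pos_INR n) as hn.
  (* the estimate [a r^n <= 2 M] fails at the radius [r = 1 - d] if [a > 2 M] *)
  set (d := Rmin (1 / 2) ((a - 2 * M) / (2 * (a * INR n + 1)))).
  assert (hp : 0 < 2 * (a * INR n + 1)) by nra.
  assert (hd0 : 0 < d) by (unfold d; apply Rmin_glb_lt; [lra|apply Rdiv_lt_0_compat; lra]).
  assert (hd1 : d <= 1 / 2) by apply Rmin_l.
  assert (hd2 : d * (2 * (a * INR n + 1)) <= a - 2 * M).
  { apply Rle_trans with ((a - 2 * M) / (2 * (a * INR n + 1)) * (2 * (a * INR n + 1))).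
    - apply Rmult_le_compat_r; [lra|apply Rmin_r].
    - apply Req_le. field. nra. }
  specialize (K (1 - d) ltac:(lra)).
  pose proof (bernoulli n d ltac:(lra)) as B.
  apply (Rmult_le_compat_l a) in B; [|lra]. nra.
Qed.

(** Integrating the derivative of [h(z) / z^(n+1)] around a circle gives the
  coefficients of the derivative of [h]. *)
Lemma coef_dx h n : holomorphic h ->
  coef (dx h) n = (RtoC (INR (S n)) * coef h (S n))%C.
Proof.
  intros [Hh H0]. unfold coef.
  enough (E : ecoef (dx h) n (1/2) = (RtoC (INR (S n)) * ecoef h (S n) (1/2))%C).
  { rewrite E. unfold Cdiv. ring. }
  set (r := 1 / 2). assert (hr : 0 < r) by (unfold r; lra).
  assert (HD : forall s, unit_disk (circ r s)) by (intros; apply disk_circ; unfold r; lra).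
  assert (HN : forall s, nonzeroC (circ r s)) by (intros; apply circ_nz; auto).
  assert (Q := cint_circle _ (fun z => h z * (/ z) ^ S n)%C r (open_and _ _ open_disk open_nonzeroC)
    (Cn_kernel 1 unit_disk h (S n) open_disk Hh) (fun s => conj (HD s) (HN s))).
  assert (C1 : forall s, continuous (fun s => (dx h (circ r s) * (/ circ r s) ^ n)%C) s).
  { intros s. apply continuous_Cmult; [|apply continuous_circ_invpow; auto].
    apply (cont_on_circle unit_disk 0 (dx h) r); auto. apply Hh. }
  assert (C2 : forall s, continuous (fun s => (h (circ r s) * (/ circ r s) ^ S n)%C) s).
  { intros s. apply continuous_Cmult; [|apply continuous_circ_invpow; auto].
    apply (cont_on_circle unit_disk 1 h r); auto. }
  rewrite (cint_ext _ (fun s => Ci * (dx h (circ r s) * (/ circ r s) ^ n) +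
    - (Ci * RtoC (INR (S n))) * (h (circ r s) * (/ circ r s) ^ S n))%C) in Q.
  - rewrite (cint_plus (fun s : R => Ci * (dx h (circ r s) * (/ circ r s) ^ n))%C) in Q by cont.
    rewrite (cint_scal Ci _ C1), (cint_scal _ _ C2) in Q.
    change (Ci * ecoef (dx h) n r + - (Ci * RtoC (INR (S n))) * ecoef h (S n) r = 0)%C in Q.
    set (X := ecoef (dx h) n r) in *. set (Y := ecoef h (S n) r) in *.
    set (m := RtoC (INR (S n))) in *.
    replace X with ((- Ci) * (Ci * X + - (Ci * m) * Y) + m * Y)%C by (apply C_eq; simpl; ring).
    rewrite Q. ring.
  - intros s. set (w := circ r s).
    assert (hd : diff_at h w) by (eapply Cn_diff; [exact Hh|apply HD]).
    assert (hk : diff_at (fun z => (/ z) ^ S n)%C w).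
    { eapply (Cn_diff 0 nonzeroC); [|apply HN]. apply Cn_pow; auto using open_nonzeroC, Cn_inv. }
    pose proof (pd_mult true h (fun z => (/ z) ^ S n)%C w hd hk) as Ex.
    pose proof (pd_mult false h (fun z => (/ z) ^ S n)%C w hd hk) as Ey.
    unfold pd in Ex, Ey. destruct (d_invpow (S n) w (HN s)) as [Ix Iy].
    rewrite Ex, Ey, Ix, Iy, (dbar_zero_dy h w) by apply H0, HD.
    match goal with |- (?d * _ + _ * ?i)%C = _ =>
      transitivity (d * RtoC (Re (Ci * w)) + Ci * d * i)%C; [ring|] end.
    rewrite complex_direction, !Cpow_S. field. apply HN.
Qed.

(** * Words of operators and polyanalytic functions *)

(** ** Commutation *)

Lemma Lop_comm (U : C -> Prop) l l' f z : open U -> Cn 2 U f -> U z ->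
  Lop l (Lop l' f) z = Lop l' (Lop l f) z.
Proof.
  intros hU H hz.
  assert (K : forall l1 l2, Lop l1 (Lop l2 f) z =
    (fst l2 * (fst l1 * dx (dx f) z + snd l1 * dy (dx f) z) +
     snd l2 * (fst l1 * dx (dy f) z + snd l1 * dy (dy f) z))%C).
  { intros l1 l2.
    assert (dX : diff_at (dx f) z) by (apply (Cn_diff 0 U); [apply (Cn_pd 1 U f true); exact H|exact hz]).
    assert (dY : diff_at (dy f) z) by (apply (Cn_diff 0 U); [apply (Cn_pd 1 U f false); exact H|exact hz]).
    unfold Lop at 2.
    rewrite (Lop_plus l1 (fun z => fst l2 * dx f z)%C (fun z => snd l2 * dy f z)%C).
    - rewrite (Lop_scal l1 (fst l2) (dx f)), (Lop_scal l1 (snd l2) (dy f)); auto.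
    - apply (diff_at_mult (fun _ => fst l2)); auto. apply diff_at_const.
    - apply (diff_at_mult (fun _ => snd l2)); auto. apply diff_at_const. }
  rewrite !K, (pd_comm U f z hU H hz). ring.
Qed.

Lemma smooth_Lop U l f : open U -> smooth U f -> smooth U (Lop l f).
Proof. intros hU H n. apply Cn_Lop; auto. Qed.

Lemma smooth_wd U w f : open U -> smooth U f -> smooth U (wd w f).
Proof. intros hU H n. apply Cn_wd; auto. Qed.

Lemma wd_Lop_comm (U : C -> Prop) w l f z : open U -> smooth U f -> U z ->
  wd w (Lop l f) z = Lop l (wd w f) z.
Proof.
  revert f z; induction w as [|l' w IH]; intros f z hU H hz; simpl; auto.
  rewrite <- IH; auto using smooth_Lop.
  apply (wd_ext w U); auto.
  - apply smooth_Lop; auto. apply smooth_Lop; auto.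
  - intros y hy. apply (Lop_comm U); auto.
Qed.

Lemma wd_ext' w (U : C -> Prop) f g : open U -> smooth U f ->
  (forall z, U z -> f z = g z) -> forall z, U z -> wd w f z = wd w g z.
Proof. intros; apply (wd_ext w U); auto. Qed.

(** ** Bounds for arbitrary words from bounds on the [dalpha] *)

Lemma xy_word_dalpha (U : C -> Prop) w : (forall l, In l w -> l = lX \/ l = lY) ->
  forall f, open U -> smooth U f -> exists a1 a2, (a1 + a2 = length w)%nat /\
  forall z, U z -> wd w f z = dalpha a1 a2 f z.
Proof.
  induction w as [|l w IH]; intros Hw f hU H.
  - exists O, O. split; auto.
  - destruct (IH (fun l' h => Hw l' (or_intror h)) (Lop l f) hU (smooth_Lop U l f hU H))
      as (a1 & a2 & ha & E).
    destruct (Hw l (or_introl eq_refl)) as [->| ->].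
    + exists (S a1), a2. split; [simpl; lia|]. intros z hz. simpl wd. rewrite E by auto.
      rewrite !dalpha_wd, !wd_app. simpl.
      apply (wd_ext' _ U); auto.
      * apply smooth_wd; auto using smooth_Lop.
      * intros y hy. apply (wd_Lop_comm U); auto.
    + exists a1, (S a2). split; [simpl; lia|]. intros z hz. simpl wd. rewrite E by auto.
      rewrite !dalpha_wd. reflexivity.
Qed.

Lemma words_bound_xy (U : C -> Prop) M w : open U -> forall f, smooth U f ->
  (forall w', length w' = length w -> (forall l, In l w' -> l = lX \/ l = lY) ->
     forall z, U z -> Cmod (wd w' f z) <= M) ->
  (forall l, In l w -> Cmod (fst l) + Cmod (snd l) <= 1) ->
  forall z, U z -> Cmod (wd w f z) <= M.
Proof.
  intros hU. induction w as [|l w IH]; intros f H Hxy Hl z hz.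
  - apply (Hxy nil); auto. intros l [].
  - apply IH; auto using smooth_Lop.
    2:{ intros; apply Hl; right; auto. }
    intros w' hw' hl y hy.
    assert (sX : smooth U (dx f)) by (intros n; apply (Cn_pd n U f true); auto).
    assert (sY : smooth U (dy f)) by (intros n; apply (Cn_pd n U f false); auto).
    assert (sc : forall c g, smooth U g -> smooth U (fun z => c * g z)%C).
    { intros c g hg n. apply (Cn_mult n U (fun _ => c)); auto. apply Cn_const; auto. }
    unfold Lop. rewrite (wd_plus w' U (fun z => fst l * dx f z)%C (fun z => snd l * dy f z)%C).
    2: auto. 2: apply sc; auto. 2: apply sc; auto. 2: auto.
    rewrite (wd_scal w' U (fst l) (dx f)), (wd_scal w' U (snd l) (dy f)); auto.
    assert (bX : Cmod (wd w' (dx f) y) <= M).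
    { specialize (Hxy (lX :: w')). simpl in Hxy. rewrite Lop_X in Hxy. apply Hxy; auto.
      intros l' [<-|h]; auto. }
    assert (bY : Cmod (wd w' (dy f) y) <= M).
    { specialize (Hxy (lY :: w')). simpl in Hxy. rewrite Lop_Y in Hxy. apply Hxy; auto.
      intros l' [<-|h]; auto. }
    assert (b1 := Hl l (or_introl eq_refl)).
    eapply Rle_trans; [apply Cmod_triangle|]. rewrite !Cmod_mult.
    pose proof (Cmod_ge_0 (fst l)). pose proof (Cmod_ge_0 (snd l)).
    pose proof (Cmod_ge_0 (wd w' (dx f) y)). nra.
Qed.

(** A bound for the derivatives [dalpha] of a given order holds for all words of
  this length whose letters have coefficients of total modulus at most 1. *)
Lemma words_bound (U : C -> Prop) M w f : open U -> smooth U f ->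
  (forall a1 a2, (a1 + a2 = length w)%nat -> forall z, U z -> Cmod (dalpha a1 a2 f z) <= M) ->
  (forall l, In l w -> Cmod (fst l) + Cmod (snd l) <= 1) ->
  forall z, U z -> Cmod (wd w f z) <= M.
Proof.
  intros hU H Ha. apply words_bound_xy; auto.
  intros w' hl hw' z hz.
  destruct (xy_word_dalpha U w' hw' f hU H) as (a1 & a2 & ha & E).
  rewrite E by auto. apply Ha; auto. lia.
Qed.

(** ** Holomorphic components of a polyanalytic function *)

Lemma inv_fact_bounds n : 0 < / INR (fact n) <= 1.
Proof.
  split; [apply Rinv_0_lt_compat, INR_fact_lt_0|].
  rewrite <- Rinv_1. apply Rinv_le_contravar; [lra|]. apply (le_INR 1), lt_O_fact.
Qed.

(** The coefficients [(-1)^l / l!]. *)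
Definition cfac (l : nat) : C := RtoC ((-1) ^ l / INR (fact l)).

(** [sum_(l < L) (-1)^l / l! conj(z)^l dbar^l G].  For a polyanalytic [G] of
  order [L] it is the holomorphic function which is the coefficient of
  [conj(z)^0] in [G]. *)
Definition polypart (L : nat) (G : C -> C) (z : C) : C :=
  csum L (fun l => cfac l * (Cconj z ^ l * Nat.iter l dbar G z))%C.

Lemma Cn_dbar_iter n l U G : open U -> Cn (l + n) U G -> Cn n U (Nat.iter l dbar G).
Proof.
  intros hU H. rewrite dbar_wd. apply Cn_wd; auto. rewrite repeat_length. exact H.
Qed.

Lemma Cn_polyterm n l c U G : open U -> Cn (l + n) U G ->
  Cn n U (fun z => c * (Cconj z ^ l * Nat.iter l dbar G z))%C.
Proof.
  intros hU H.
  apply (Cn_mult n U (fun _ => c)); auto; [apply Cn_const; auto|].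
  apply (Cn_mult n U (fun z => Cconj z ^ l)%C); auto using Cn_dbar_iter.
  apply Cn_pow; auto. apply Cn_conj; auto. apply Cn_id; auto.
Qed.

Lemma Cn_polypart n L U G : open U -> Cn (pred L + n) U G -> Cn n U (polypart L G).
Proof.
  intros hU. unfold polypart. induction L as [|L IH]; intros H; simpl.
  - apply Cn_const; auto.
  - apply (Cn_plus n U (fun z => csum L _)); auto.
    + apply IH. eapply Cn_le; [|exact H]. simpl; lia.
    + apply Cn_polyterm; auto.
Qed.

Lemma cfac_S l : (cfac (S l) * INR (S l) = - cfac l)%C.
Proof.
  unfold cfac. rewrite <- RtoC_mult, <- RtoC_opp. f_equal.
  rewrite fact_simpl, mult_INR. simpl pow. field. split; [apply INR_fact_neq_0|apply not_0_INR; lia].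
Qed.

(** The sum of the derivatives telescopes. *)
Lemma dbar_polypart L U G z : open U -> Cn (S L) U G -> U z ->
  dbar (polypart (S L) G) z = (cfac L * (Cconj z ^ L * Nat.iter (S L) dbar G z))%C.
Proof.
  intros hU. induction L as [|L IH]; intros H hz.
  - assert (E : polypart 1 G = G).
    { apply functional_extensionality; intros y. unfold polypart, cfac; simpl.
      replace (RtoC (1 / 1)) with (RtoC 1) by (f_equal; field). ring. }
    rewrite E. unfold cfac; simpl. replace (RtoC (1 / 1)) with (RtoC 1) by (f_equal; field). ring.
  - change (polypart (S (S L)) G) with (fun y => polypart (S L) G y +
      cfac (S L) * (Cconj y ^ S L * Nat.iter (S L) dbar G y))%C.
    match goal with |- dbar ?h z = _ => transitivity (Lop lZbar h z);
      [rewrite Lop_Zbar; reflexivity|] end.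
    assert (d3 : diff_at (Nat.iter (S L) dbar G) z).
    { apply (Cn_diff 0 U); auto. apply Cn_dbar_iter; auto.
      eapply Cn_le; [|exact H]. lia. }
    assert (d2 : diff_at (fun y => Cconj y ^ S L)%C z).
    { apply (Cn_diff 0 U); auto. apply Cn_pow; auto. apply Cn_conj; auto. apply Cn_id; auto. }
    assert (d4 : diff_at (fun y => Cconj y ^ S L * Nat.iter (S L) dbar G y)%C z)
      by (apply (diff_at_mult (fun y => Cconj y ^ S L)%C); auto).
    rewrite (Lop_plus lZbar (polypart (S L) G)).
    + rewrite (Lop_scal lZbar (cfac (S L))) by auto.
      rewrite (Lop_mult lZbar (fun y => Cconj y ^ S L)%C) by auto.
      rewrite Lop_zbarpow, lzbar_Zbar, Lop_Zbar, IH; auto.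
      2:{ eapply Cn_le; [|exact H]. lia. }
      change (dbar (Nat.iter (S L) dbar G) z) with (Nat.iter (S (S L)) dbar G z).
      simpl pred. set (X := Nat.iter (S L) dbar G z). set (Y := Nat.iter (S (S L)) dbar G z).
      transitivity (cfac L * (Cconj z ^ L * X) + (cfac (S L) * INR (S L)) * (Cconj z ^ L * X) +
        cfac (S L) * (Cconj z ^ S L * Y))%C; [ring|].
      rewrite cfac_S. ring.
    + apply (Cn_diff 0 U); auto. apply Cn_polypart; auto. eapply Cn_le; [|exact H]. simpl; lia.
    + apply (diff_at_mult (fun _ => cfac (S L))); auto. apply diff_at_const.
Qed.

Lemma csum_S n a : csum (S n) a = (csum n a + a n)%C.
Proof. reflexivity. Qed.

Lemma csum_RtoC n (a : nat -> R) : csum (S n) (fun i => RtoC (a i)) = RtoC (sum_f_R0 a n).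
Proof.
  induction n as [|n IH]; [simpl; ring|].
  rewrite csum_S, IH. simpl. now rewrite RtoC_plus.
Qed.

(** The binomial expansion of [(1 - 1)^N], divided by [N!]. *)
Lemma alternating_binomial N : (1 <= N)%nat ->
  csum (S N) (fun j => RtoC (/ INR (fact j)) * cfac (N - j))%C = 0%C.
Proof.
  intros hN.
  rewrite (csum_ext _ _ (fun j => RtoC (/ INR (fact N) * (Binomial.C N j * 1 ^ j * (-1) ^ (N - j))))).
  - rewrite csum_RtoC. f_equal.
    rewrite (sum_eq _ (fun j => (Binomial.C N j * 1 ^ j * (-1) ^ (N - j)) * / INR (fact N)) N)
      by (intros; ring).
    rewrite <- scal_sum, <- binomial. replace (1 + -1) with 0 by ring.
    rewrite pow_i by lia. ring.
  - intros i hi. unfold cfac. rewrite <- RtoC_mult. f_equal.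
    unfold Binomial.C. rewrite pow1. field.
    repeat split; apply INR_fact_neq_0.
Qed.

(** The algebra behind [pcomp_sum], with [w = conj(z)] and [D p = dbar^p f (z)]: the
  coefficient of each [D p] with [p > 0] is an alternating binomial sum. *)
Lemma polyanalytic_inversion (w : C) (D : nat -> C) N : (1 <= N)%nat ->
  csum N (fun j => RtoC (/ INR (fact j)) * (w ^ j *
    csum (N - j) (fun l => cfac l * (w ^ l * D (l + j)%nat))))%C = D O.
Proof.
  intros hN. induction hN as [|N hN IH].
  - unfold cfac; simpl. replace (RtoC (/ 1)) with (RtoC 1) by (f_equal; field).
    replace (RtoC (1 / 1)) with (RtoC 1) by (f_equal; field). ring.
  - rewrite (csum_ext _ _ (fun j => RtoC (/ INR (fact j)) * (w ^ j *
      csum (N - j) (fun l => cfac l * (w ^ l * D (l + j)%nat))) +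
      w ^ N * D N * (RtoC (/ INR (fact j)) * cfac (N - j)))%C).
    + rewrite csum_plus, csum_scal, alternating_binomial by auto.
      rewrite csum_S, IH, Nat.sub_diag. simpl. ring.
    + intros j hj. replace (S N - j)%nat with (S (N - j)) by lia. rewrite csum_S.
      replace (N - j + j)%nat with N by lia.
      replace (w ^ N)%C with (w ^ j * w ^ (N - j))%C by (rewrite <- Cpow_add_r; f_equal; lia).
      ring.
Qed.

(** The [j]-th component of [f], counted so that
  [f = sum_(j < N) conj(z)^j / j! H_j]. *)
Definition pcomp (N : nat) (f : C -> C) (j : nat) : C -> C :=
  polypart (N - j) (Nat.iter j dbar f).

Lemma pcomp_sum N f z : (1 <= N)%nat ->
  f z = csum N (fun j => RtoC (/ INR (fact j)) * (Cconj z ^ j * pcomp N f j z))%C.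
Proof.
  intros hN. symmetry.
  etransitivity; [|exact (polyanalytic_inversion (Cconj z) (fun p => Nat.iter p dbar f z) N hN)].
  apply csum_ext. intros j hj. unfold pcomp, polypart. do 2 f_equal.
  apply csum_ext. intros l _. now rewrite Nat.iter_add.
Qed.

Lemma Cn_pcomp N U f j n : open U -> (j < N)%nat -> Cn (N + n) U f -> Cn (S n) U (pcomp N f j).
Proof.
  intros hU hj H. apply Cn_polypart; auto. apply Cn_dbar_iter; auto.
  eapply Cn_le; [|exact H]. lia.
Qed.

Lemma dbar_pcomp N U f j z : open U -> (j < N)%nat -> Cn N U f -> U z ->
  dbar (pcomp N f j) z = (cfac (N - j - 1) * (Cconj z ^ (N - j - 1) * Nat.iter N dbar f z))%C.
Proof.
  intros hU hj H hz. unfold pcomp. replace (N - j)%nat with (S (N - j - 1)) at 1 by lia.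
  rewrite (dbar_polypart _ U); auto.
  - do 2 f_equal. rewrite <- Nat.iter_add. do 2 f_equal. lia.
  - apply Cn_dbar_iter; auto. eapply Cn_le; [|exact H]. lia.
Qed.

Lemma pcomp_holomorphic N f j : (j < N)%nat -> polyanalytic N f -> holomorphic (pcomp N f j).
Proof.
  intros hj [H H0]. split.
  - apply (Cn_pcomp N unit_disk f j 0); auto using open_disk. now rewrite Nat.add_0_r.
  - intros z hz. rewrite (dbar_pcomp N unit_disk) by auto using open_disk.
    rewrite H0 by auto. ring.
Qed.

(** ** Complex derivatives of holomorphic functions *)

Lemma coef_ext h g n : (forall z, unit_disk z -> h z = g z) -> coef h n = coef g n.
Proof.
  intros E. unfold coef. f_equal. apply cint_ext. intros s. rewrite E; auto.
  apply disk_circ; lra.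
Qed.

Lemma dz_holomorphic h : smooth unit_disk h -> holomorphic h ->
  holomorphic (dz h) /\ forall n, coef (dz h) n = (RtoC (INR (S n)) * coef h (S n))%C.
Proof.
  intros Hs Hh. pose proof open_disk as hU.
  assert (E : forall z, unit_disk z -> dx h z = dz h z).
  { intros z hz. unfold dz, Lop, lZ.
    rewrite (dbar_zero_dy h z) by (apply Hh; auto). apply C_eq; simpl; field. }
  split.
  - split; [apply smooth_Lop; auto|]. intros z hz. rewrite <- Lop_Zbar. unfold dz.
    rewrite (Lop_comm unit_disk); auto.
    rewrite <- (Lop_ext lZ unit_disk (fun _ => RtoC 0)); auto.
    + apply Lop_const.
    + intros w hw. rewrite Lop_Zbar. symmetry; apply Hh; auto.
    + apply diff_at_const.
  - intros n. rewrite <- coef_dx by auto. symmetry; apply coef_ext; auto.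
Qed.

(** The product (n+1) ... (n+m). *)
Fixpoint rising (n m : nat) : R :=
  match m with O => 1 | S m' => rising n m' * INR (S (n + m')) end.

Lemma dz_iter_holomorphic m : forall h, smooth unit_disk h -> holomorphic h ->
  holomorphic (wd (repeat lZ m) h) /\
  forall n, coef (wd (repeat lZ m) h) n = (RtoC (rising n m) * coef h (n + m))%C.
Proof.
  induction m as [|m IH]; intros h Hs Hh; cbn [repeat wd rising].
  - split; auto. intros n. rewrite Nat.add_0_r. ring.
  - destruct (dz_holomorphic h Hs Hh) as [H1 H2].
    destruct (IH (dz h) (smooth_Lop _ _ _ open_disk Hs) H1) as [H3 H4].
    split; auto. intros n. change (Lop lZ h) with (dz h). rewrite H4.
    rewrite H2, RtoC_mult, Nat.add_succ_r. ring.
Qed.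

(** * Normally convergent series of functions *)

(** The remainder of a series after the term of index [K]. *)
Definition tail (M : nat -> R) (K : nat) : R := Series M - sum_n M K.

Lemma tail_lim M eps : ex_series M -> 0 < eps ->
  exists K0, forall K, (K0 <= K)%nat -> Rabs (tail M K) < eps.
Proof.
  intros H he. apply Series_correct in H. apply is_series_Reals in H.
  destruct (H eps he) as [K0 HK]. exists K0. intros K hK. specialize (HK K hK).
  unfold tail. rewrite sum_n_Reals. unfold R_dist in HK. rewrite Rabs_minus_sym. exact HK.
Qed.

Lemma ex_series_dom (a M : nat -> R) : (forall n, Rabs (a n) <= M n) -> ex_series M -> ex_series a.
Proof. intros H. apply (ex_series_le (K := R_AbsRing) (V := R_CompleteNormedModule)). exact H. Qed.

Lemma tail_bound (a M : nat -> R) K : (forall n, Rabs (a n) <= M n) -> ex_series M ->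
  Rabs (Series a - sum_n a K) <= tail M K.
Proof.
  intros H HM. assert (Ha := ex_series_dom a M H HM).
  unfold tail. rewrite (Series_incr_n a (S K)), (Series_incr_n M (S K)) by (try lia; auto).
  rewrite !sum_n_Reals. simpl pred.
  match goal with |- Rabs ?x <= ?y => replace x with (Series (fun k => a (S K + k)%nat)) by ring;
    replace y with (Series (fun k => M (S K + k)%nat)) by ring end.
  assert (HM' : ex_series (fun k => M (S K + k)%nat)) by (apply ex_series_incr_n; auto).
  eapply Rle_trans; [apply Series_Rabs|].
  - apply (ex_series_dom _ (fun k => M (S K + k)%nat)); auto. intros n. rewrite Rabs_Rabsolu. apply H.
  - apply Series_le; auto. intros n; split; [apply Rabs_pos|apply H].
Qed.

Lemma series_bound (a M : nat -> R) : (forall n, Rabs (a n) <= M n) -> ex_series M ->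
  Rabs (Series a) <= Series M.
Proof.
  intros H HM. eapply Rle_trans; [apply Series_Rabs|].
  - apply (ex_series_dom _ M); auto. intros n. rewrite Rabs_Rabsolu. apply H.
  - apply Series_le; auto. intros n; split; [apply Rabs_pos|apply H].
Qed.

Lemma continuous_Rsum_n {T : UniformSpace} (u : nat -> T -> R) z K :
  (forall n, continuous (u n) z) -> continuous (fun w => sum_n (fun n => u n w) K) z.
Proof.
  intros H. induction K as [|K IH].
  - apply (continuous_ext (u O)); auto. intros x. rewrite sum_O. reflexivity.
  - apply (continuous_ext (fun w => sum_n (fun n => u n w) K + u (S K) w)).
    + intros x. rewrite sum_Sn. reflexivity.
    + apply continuous_plus_R; auto.
Qed.

Lemma continuous_Series {T : UniformSpace} (Om : T -> Prop) (u : nat -> T -> R) M z :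
  open Om -> (forall n w, Om w -> Rabs (u n w) <= M n) -> ex_series M ->
  (forall n, continuous (u n) z) -> Om z ->
  continuous (fun w => Series (fun n => u n w)) z.
Proof.
  intros hS Hb HM Hc hz. apply filterlim_locally. intros eps.
  assert (he3 : 0 < eps / 3) by (pose proof (cond_pos eps); lra).
  destruct (tail_lim M (eps / 3) HM he3) as [K HK]. specialize (HK K (le_n K)).
  assert (Hs := continuous_Rsum_n u z K Hc).
  assert (L := proj1 (filterlim_locally _ _) Hs (mkposreal _ he3)).
  generalize (filter_and _ _ L (hS z hz)). apply filter_imp. intros w [h1 h2].
  pose proof (tail_bound (fun n => u n w) M K (fun n => Hb n w h2) HM) as t1.
  pose proof (tail_bound (fun n => u n z) M K (fun n => Hb n z hz) HM) as t2.
  change (Rabs (sum_n (fun n => u n w) K - sum_n (fun n => u n z) K) < eps / 3) in h1.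
  change (Rabs (Series (fun n => u n w) - Series (fun n => u n z)) < eps).
  pose proof (Rle_abs (tail M K)).
  set (A := Series (fun n => u n w)) in *. set (B := Series (fun n => u n z)) in *.
  set (A' := sum_n (fun n => u n w) K) in *. set (B' := sum_n (fun n => u n z) K) in *.
  replace (A - B) with ((A - A') + (A' - B') + (- (B - B'))) by ring.
  eapply Rle_lt_trans; [apply Rabs_triang|]. rewrite Rabs_Ropp.
  pose proof (Rabs_triang (A - A') (A' - B')). lra.
Qed.

Lemma is_derive_Series (u u' : nat -> R -> R) M t0 (e : posreal) :
  (forall n t, Boule t0 e t -> is_derive (u n) t (u' n t)) ->
  (forall n t, Boule t0 e t -> Rabs (u n t) <= M n) ->
  (forall n t, Boule t0 e t -> Rabs (u' n t) <= M n) ->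
  ex_series M ->
  is_derive (fun t => Series (fun n => u n t)) t0 (Series (fun n => u' n t0)).
Proof.
  intros H Hb Hb' HM. apply is_derive_Reals.
  assert (hB : Boule t0 e t0).
  { unfold Boule. rewrite Rminus_diag, Rabs_R0. apply cond_pos. }
  apply (CVU_derivable (fun n t => sum_n (fun k => u k t) n)
    (fun n t => sum_n (fun k => u' k t) n) (fun t => Series (fun n => u n t))
    (fun t => Series (fun n => u' n t)) t0 e); auto.
  - intros eps he. destruct (tail_lim M eps HM he) as [K HK]. exists K.
    intros n y hn hy. specialize (HK n hn).
    eapply Rle_lt_trans; [apply (tail_bound (fun k => u' k y) M); auto|].
    eapply Rle_lt_trans; [apply Rle_abs|exact HK].
  - intros y hy. apply is_lim_seq_Reals.
    apply (Series_correct (fun n => u n y)). apply (ex_series_dom _ M); auto.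
  - intros n y hy. apply is_derive_Reals.
    apply (is_derive_sum_n (K := R_AbsRing) (V := R_NormedModule) u n y (fun k => u' k y)).
    intros k _. auto.
Qed.

(** ** Complex series *)

(** The sum of a complex series, taken componentwise; it is meaningful when both
  components converge. *)
Definition cser (a : nat -> C) : C :=
  (Series (fun n => Re (a n)), Series (fun n => Im (a n))).

Lemma csum_sum_n K a : csum (S K) a = (sum_n (fun n => Re (a n)) K, sum_n (fun n => Im (a n)) K).
Proof.
  induction K as [|K IH].
  - rewrite !sum_O. apply C_eq; unfold Re, Im; simpl; ring.
  - rewrite !sum_Sn. change (csum (S (S K)) a) with (csum (S K) a + a (S K))%C. rewrite IH.
    apply C_eq; reflexivity.
Qed.

Lemma csum_tail a M K : (forall n, Cmod (a n) <= M n) -> ex_series M ->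
  Cmod (csum (S K) a - cser a) <= 2 * tail M K.
Proof.
  intros H HM.
  pose proof (tail_bound (fun n => Re (a n)) M K (fun n => Rle_trans _ _ _ (re_le_Cmod _) (H n)) HM) as t1.
  pose proof (tail_bound (fun n => Im (a n)) M K (fun n => Rle_trans _ _ _ (im_le_Cmod _) (H n)) HM) as t2.
  rewrite Rabs_minus_sym in t1, t2.
  eapply Rle_trans; [apply Cmod_le_ReIm|]. rewrite csum_sum_n.
  change (Rabs (sum_n (fun n => Re (a n)) K - Series (fun n => Re (a n))) +
    Rabs (sum_n (fun n => Im (a n)) K - Series (fun n => Im (a n))) <= 2 * tail M K).
  lra.
Qed.

Lemma is_cser_cser a M : (forall n, Cmod (a n) <= M n) -> ex_series M -> is_cser a (cser a).
Proof.
  intros H HM eps he. destruct (tail_lim M (eps / 2) HM) as [K HK]; [lra|].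
  exists (S K). intros n hn. destruct n as [|n]; [lia|]. specialize (HK n ltac:(lia)).
  pose proof (csum_tail a M n H HM). pose proof (Rle_abs (tail M n)). lra.
Qed.

Lemma csum_bound n a (M : nat -> R) : (forall i, Cmod (a i) <= M i) ->
  Cmod (csum (S n) a) <= sum_n M n.
Proof.
  intros H. induction n as [|n IH].
  - rewrite sum_O. simpl. replace (0 + a O)%C with (a O) by ring. auto.
  - rewrite sum_Sn. change (csum (S (S n)) a) with (csum (S n) a + a (S n))%C.
    eapply Rle_trans; [apply Cmod_triangle|]. apply Rplus_le_compat; auto.
Qed.

Lemma cser_bound a M : (forall n, Cmod (a n) <= M n) -> ex_series M -> Cmod (cser a) <= Series M.
Proof.
  intros H HM. apply Rnot_lt_le. intros L.
  destruct (is_cser_cser a M H HM (Cmod (cser a) - Series M)) as [K HK]; [lra|].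
  specialize (HK (S K) ltac:(lia)).
  pose proof (csum_bound K a M H) as B.
  assert (P : sum_n M K <= Series M).
  { pose proof (tail_bound (fun _ => 0) M K) as t.
    assert (E : 0 <= tail M K).
    { eapply Rle_trans; [apply Rabs_pos|]. apply t; auto. intros n. rewrite Rabs_R0.
      eapply Rle_trans; [apply Cmod_ge_0|apply H]. }
    unfold tail in E. lra. }
  pose proof (Cmod_triangle (csum (S K) a) (- (csum (S K) a - cser a))) as T.
  rewrite Cmod_opp in T.
  replace (csum (S K) a + - (csum (S K) a - cser a))%C with (cser a) in T by ring. lra.
Qed.

Lemma cser_ext a b : (forall n, a n = b n) -> cser a = cser b.
Proof. intros E; apply C_eq; simpl; apply Series_ext; intros; now rewrite E. Qed.

Lemma continuous_cser (Om : C -> Prop) (g : nat -> C -> C) M z :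
  open Om -> (forall n w, Om w -> Cmod (g n w) <= M n) -> ex_series M ->
  (forall n, continuous (g n) z) -> Om z -> continuous (fun w => cser (fun n => g n w)) z.
Proof.
  intros hS Hb HM Hc hz. apply continuous_C_iff; split; simpl.
  - apply (continuous_Series Om (fun n w => Re (g n w)) M); auto.
    + intros n w h. eapply Rle_trans; [apply re_le_Cmod|auto].
    + intros n. apply (proj1 (proj1 (continuous_C_iff _ _) (Hc n))).
  - apply (continuous_Series Om (fun n w => Im (g n w)) M); auto.
    + intros n w h. eapply Rle_trans; [apply im_le_Cmod|auto].
    + intros n. apply (proj2 (proj1 (continuous_C_iff _ _) (Hc n))).
Qed.

Lemma is_pd_cser (Om : C -> Prop) (g : nat -> C -> C) M b z :
  open Om -> (forall n w, Om w -> diff_at (g n) w) ->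
  (forall n w, Om w -> Cmod (g n w) <= M n) ->
  (forall n w, Om w -> Cmod (pd b (g n) w) <= M n) -> ex_series M -> Om z ->
  is_pd b (fun w => cser (fun n => g n w)) z (cser (fun n => pd b (g n) z)).
Proof.
  intros hS Hd Hb Hb' HM hz.
  destruct (slice_lim b z Om (hS z hz)) as [e he].
  assert (HS : forall t, Boule (coord b z) e t -> Om (slice b z t)) by (intros t ht; apply he; exact ht).
  assert (Hsl : forall t, slice b (slice b z t) = slice b z).
  { intros t; apply functional_extensionality; intros s; destruct b; reflexivity. }
  assert (Hco : forall t, coord b (slice b z t) = t) by (intros; destruct b; reflexivity).
  assert (D : forall n t, Boule (coord b z) e t ->
    cderive (fun s => g n (slice b z s)) t (pd b (g n) (slice b z t))).
  { intros n t ht. pose proof (pd_is b (g n) _ (Hd n _ (HS t ht))) as P.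
    unfold is_pd in P. rewrite Hsl, Hco in P. exact P. }
  split; simpl.
  - pose proof (is_derive_Series (fun n t => Re (g n (slice b z t)))
      (fun n t => Re (pd b (g n) (slice b z t))) M (coord b z) e) as P.
    cbv beta in P. rewrite slice_coord in P. apply P; auto.
    + intros n t ht. apply (proj1 (D n t ht)).
    + intros n t ht. eapply Rle_trans; [apply re_le_Cmod|auto].
    + intros n t ht. eapply Rle_trans; [apply re_le_Cmod|auto].
  - pose proof (is_derive_Series (fun n t => Im (g n (slice b z t)))
      (fun n t => Im (pd b (g n) (slice b z t))) M (coord b z) e) as P.
    cbv beta in P. rewrite slice_coord in P. apply P; auto.
    + intros n t ht. apply (proj2 (D n t ht)).
    + intros n t ht. eapply Rle_trans; [apply im_le_Cmod|auto].
    + intros n t ht. eapply Rle_trans; [apply im_le_Cmod|auto].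
Qed.

(** ** Families bounded by a weight, up to polynomial factors in the index *)

(** [|g_n| <= A (n+1)^p E_n] on [Om n] for some [A] and [p].  Polynomial factors
  are allowed because a derivative of [z^n] costs a factor [n]. *)
Definition Bd (Om : nat -> C -> Prop) (E : nat -> R) (g : nat -> C -> C) : Prop :=
  exists A p, 0 <= A /\ forall n z, Om n z -> Cmod (g n z) <= A * INR (S n) ^ p * E n.

Lemma INR_S_ge1 n : 1 <= INR (S n).
Proof. rewrite S_INR. pose proof (pos_INR n). lra. Qed.

Lemma INR_S_pow_ge1 n p : 1 <= INR (S n) ^ p.
Proof. apply pow_R1_Rle, INR_S_ge1. Qed.

Lemma respects_Bd Om E : respects (Bd Om E) Om.
Proof.
  intros g h H (A & p & hA & Hb). exists A, p. split; auto. intros n z hz. rewrite <- H; auto.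
Qed.

Lemma Bd_plus Om E g h : (forall n, 0 <= E n) -> Bd Om E g -> Bd Om E h ->
  Bd Om E (fun n z => g n z + h n z)%C.
Proof.
  intros hE (A & p & hA & Hg) (B & q & hB & Hh). exists (A + B), (p + q)%nat. split; [lra|].
  intros n z hz. eapply Rle_trans; [apply Cmod_triangle|].
  specialize (Hg n z hz). specialize (Hh n z hz). rewrite pow_add.
  pose proof (INR_S_pow_ge1 n p). pose proof (INR_S_pow_ge1 n q).
  set (x := INR (S n) ^ p) in *. set (y := INR (S n) ^ q) in *.

  assert (A * x * E n <= A * (x * y) * E n).
  { apply Rmult_le_compat_r; auto. apply Rmult_le_compat_l; auto. nra. }
  assert (B * y * E n <= B * (x * y) * E n).
  { apply Rmult_le_compat_r; auto. apply Rmult_le_compat_l; auto. nra. }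
  lra.
Qed.

Lemma Bd_mult Om E1 E2 g h : (forall n, 0 <= E1 n) -> Bd Om E1 g -> Bd Om E2 h ->
  Bd Om (fun n => E1 n * E2 n) (fun n z => g n z * h n z)%C.
Proof.
  intros hE (A & p & hA & Hg) (B & q & hB & Hh). exists (A * B), (p + q)%nat.
  split; [apply Rmult_le_pos; auto|].
  intros n z hz. rewrite Cmod_mult, pow_add.

  replace (A * B * (INR (S n) ^ p * INR (S n) ^ q) * (E1 n * E2 n)) with
    ((A * INR (S n) ^ p * E1 n) * (B * INR (S n) ^ q * E2 n)) by ring.
  apply Rmult_le_compat; auto; apply Cmod_ge_0.
Qed.

(** The weights for which a bounded family has a normally convergent sum. *)
Definition summable_weight (E : nat -> R) : Prop :=
  forall p, ex_series (fun n => INR (S n) ^ p * E n).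

(** Termwise differentiation to all orders. *)
Lemma Reg_cser (U : C -> Prop) E n : open U -> summable_weight E -> forall g,
  Reg (Bd (fun _ => U) E) (fun _ : nat => U) n g -> Cn n U (fun z => cser (fun i => g i z)).
Proof.
  intros hU HE. induction n as [|n IH]; intros g (Hc & (A & p & hA & Hb) & Hd).
  - split; auto. intros z hz.
    apply (continuous_cser U g (fun i => A * (INR (S i) ^ p * E i))); auto.
    + intros i w hw. rewrite <- Rmult_assoc. auto.
    + apply (ex_series_scal_l_R A). apply HE.
  - destruct Hd as [Hd Hr].
    assert (D : forall b z, U z ->
      is_pd b (fun w => cser (fun i => g i w)) z (cser (fun i => pd b (g i) z))).
    { intros b z hz. destruct n as [|n'];
      destruct (Hr b) as (Hc' & (A' & p' & hA' & Hb') & _).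
      all: apply (is_pd_cser U g (fun i => A * (INR (S i) ^ p * E i) + A' * (INR (S i) ^ p' * E i))); auto.
      all: try (apply ex_series_plus_R;
        apply ex_series_scal_l_R; apply HE).
      all: intros i w hw; specialize (Hb i w hw); specialize (Hb' i w hw);
        rewrite Rmult_assoc in Hb, Hb';
        pose proof (Cmod_ge_0 (g i w)); pose proof (Cmod_ge_0 (pd b (g i) w)); lra. }
    apply Cn_intro.
    + intros z hz.
      apply (continuous_cser U g (fun i => A * (INR (S i) ^ p * E i))); auto.
      * intros i w hw. rewrite <- Rmult_assoc. auto.
      * apply (ex_series_scal_l_R A). apply HE.
    + intros z hz. apply diff_at_is. intros b; eexists; apply D; auto.
    + intros b. apply (Cn_ext n U (fun z => cser (fun i => pd b (g i) z))); auto.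
      intros z hz. symmetry. apply is_pd_unique, D; auto.
Qed.

(** ** Termwise application of operators *)

Lemma is_cser_plus a b l l' : is_cser a l -> is_cser b l' -> is_cser (fun n => a n + b n)%C (l + l')%C.
Proof.
  intros H H' eps he. destruct (H (eps / 2)) as [M HM]; [lra|]. destruct (H' (eps / 2)) as [M' HM']; [lra|].
  exists (Nat.max M M'). intros n hn. specialize (HM n ltac:(lia)). specialize (HM' n ltac:(lia)).
  rewrite csum_plus. replace (csum n a + csum n b - (l + l'))%C with ((csum n a - l) + (csum n b - l'))%C by ring.
  eapply Rle_lt_trans; [apply Cmod_triangle|]. lra.
Qed.

Lemma is_cser_eq a l M : (forall n, Cmod (a n) <= M n) -> ex_series M -> is_cser a l -> l = cser a.
Proof. intros H HM Hl. eapply is_cser_unique; [exact Hl|]. apply (is_cser_cser a M); auto. Qed.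

Lemma cser_scal c a M : (forall n, Cmod (a n) <= M n) -> ex_series M ->
  cser (fun n => c * a n)%C = (c * cser a)%C.
Proof.
  intros H HM. symmetry. apply (is_cser_eq _ _ (fun n => Cmod c * M n)).
  - intros n. rewrite Cmod_mult. apply Rmult_le_compat_l; auto. apply Cmod_ge_0.
  - apply ex_series_scal_l_R; auto.
  - apply is_cser_scal, (is_cser_cser a M); auto.
Qed.

Lemma cser_plus a b M M' : (forall n, Cmod (a n) <= M n) -> ex_series M ->
  (forall n, Cmod (b n) <= M' n) -> ex_series M' ->
  cser (fun n => a n + b n)%C = (cser a + cser b)%C.
Proof.
  intros H HM H' HM'. symmetry. apply (is_cser_eq _ _ (fun n => M n + M' n)).
  - intros n. eapply Rle_trans; [apply Cmod_triangle|]. apply Rplus_le_compat; auto.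
  - apply ex_series_plus_R; auto.
  - apply is_cser_plus; [apply (is_cser_cser a M)|apply (is_cser_cser b M')]; auto.
Qed.

Lemma Reg_bound {I} P (Om : I -> C -> Prop) n g : Reg P Om n g -> P g.
Proof. destruct n; intros H; apply H. Qed.

Lemma Reg_scal {I} (P : (I -> C -> C) -> Prop) (Om : I -> C -> Prop) n c :
  (forall i, open (Om i)) -> respects P Om ->
  (forall g, P g -> P (fun i z => c * g i z)%C) -> forall g,
  Reg P Om n g -> Reg P Om n (fun i z => c * g i z)%C.
Proof.
  intros hS hP hscal. induction n as [|n IH]; intros g (Hc & Hp & Hd).
  - split; [|split; [|exact Logic.I]]; auto. intros i z hz; apply continuous_Cmult; auto. apply continuous_const.
  - destruct Hd as [Hd Hr]. split; [|split; [|split]]; auto.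
    + intros i z hz; apply continuous_Cmult; auto. apply continuous_const.
    + intros i z hz; apply (diff_at_mult (fun _ => c)); auto. apply diff_at_const.
    + intros b. eapply Reg_ext; [exact hS|exact hP| |apply (IH (fun i => pd b (g i))); apply Hr].
      intros i z hz. cbv beta. rewrite (pd_mult b (fun _ => c)), pd_const; auto. ring.
      apply diff_at_const.
Qed.

Lemma Bd_scal Om E c g : Bd Om E g -> Bd Om E (fun n z => c * g n z)%C.
Proof.
  intros (A & p & hA & H). pose proof (Cmod_ge_0 c). exists (Cmod c * A), p. split; [apply Rmult_le_pos; auto|].
  intros n z hz. rewrite Cmod_mult, !Rmult_assoc. apply Rmult_le_compat_l; auto.
  rewrite <- Rmult_assoc. auto.
Qed.

Lemma Reg_Bd_Lop Om E n l g : (forall i, open (Om i)) -> (forall n, 0 <= E n) ->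
  Reg (Bd Om E) Om (S n) g -> Reg (Bd Om E) Om n (fun i => Lop l (g i)).
Proof.
  intros hS hE (_ & _ & _ & H).
  apply (Reg_plus (Bd Om E) Om n hS (respects_Bd Om E) (fun g h => Bd_plus Om E g h hE)
    (fun i z => fst l * pd true (g i) z)%C (fun i z => snd l * pd false (g i) z)%C);
    (apply Reg_scal; [exact hS|apply respects_Bd|intros; apply Bd_scal; assumption|]).
  - apply (H true).
  - apply (H false).
Qed.

Lemma Bd_dom (U : C -> Prop) E g z : summable_weight E -> Bd (fun _ => U) E g -> U z ->
  exists M, (forall n, Cmod (g n z) <= M n) /\ ex_series M.
Proof.
  intros HE (A & p & hA & H) hz. exists (fun n => A * (INR (S n) ^ p * E n)). split.
  - intros n. rewrite <- Rmult_assoc. auto.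
  - apply (ex_series_scal_l_R A). apply HE.
Qed.

(** Words of operators may be applied termwise. *)
Lemma wd_cser (U : C -> Prop) E w : open U -> (forall n, 0 <= E n) -> summable_weight E -> forall g z,
  Reg (Bd (fun _ => U) E) (fun _ : nat => U) (length w) g -> U z ->
  wd w (fun z => cser (fun i => g i z)) z = cser (fun i => wd w (g i) z).
Proof.
  intros hU hE HE. induction w as [|l w IH]; intros g z H hz; [reflexivity|].
  simpl. rewrite <- (IH (fun i => Lop l (g i))); auto.
  2:{ apply Reg_Bd_Lop; auto. }
  apply (wd_ext w U); auto.
  - apply Cn_Lop; auto. apply (Reg_cser U E (S (length w)) hU HE); auto.
  - intros y hy. destruct H as (Hc & Hb & Hd & Hr).
    destruct (Bd_dom U E g y HE Hb hy) as (M0 & HM0 & HM0').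
    assert (D : forall b, exists M, ((forall n, Cmod (pd b (g n) y) <= M n) /\ ex_series M) /\
      pd b (fun w => cser (fun i => g i w)) y = cser (fun i => pd b (g i) y)).
    { intros b. pose proof (Reg_bound _ _ _ _ (Hr b)) as Hb'.
      destruct (Bd_dom U E _ y HE Hb' hy) as (M1 & HM1 & HM1').
      exists M1. split; [auto|]. apply is_pd_unique.
      destruct Hb as (A & p & hA & Hb). destruct Hb' as (A' & p' & hA' & Hb').
      apply (is_pd_cser U g (fun i => A * (INR (S i) ^ p * E i) + A' * (INR (S i) ^ p' * E i))); auto.
      3:{ apply ex_series_plus_R;
          apply ex_series_scal_l_R; apply HE. }
      all: intros i x hx; specialize (Hb i x hx); specialize (Hb' i x hx);
        rewrite Rmult_assoc in Hb, Hb';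
        pose proof (Cmod_ge_0 (g i x)); pose proof (Cmod_ge_0 (pd b (g i) x)); lra. }
    destruct (D true) as (M1 & [K1 K1'] & E1). destruct (D false) as (M2 & [K2 K2'] & E2).
    rewrite Lop_pd, E1, E2.
    rewrite <- (cser_scal (fst l) _ M1), <- (cser_scal (snd l) _ M2) by auto.
    symmetry. apply (cser_plus _ _ (fun n => Cmod (fst l) * M1 n) (fun n => Cmod (snd l) * M2 n)).
    + intros n. rewrite Cmod_mult. apply Rmult_le_compat_l; auto. apply Cmod_ge_0.
    + apply ex_series_scal_l_R; auto.
    + intros n. rewrite Cmod_mult. apply Rmult_le_compat_l; auto. apply Cmod_ge_0.
    + apply ex_series_scal_l_R; auto.
Qed.

(** ** Stretched exponential weights *)

(** For [y > 0] and [q > 0], [y^q exp(-y)] is at most [q^q]. *)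
Lemma Rpower_exp_bound y q : 0 < y -> 0 < q -> Rpower y q * exp (- y) <= Rpower q q.
Proof.
  intros hy hq. unfold Rpower. rewrite <- exp_plus.
  destruct (Rle_lt_or_eq_dec (q * ln y + - y) (q * ln q)) as [L|L].
  - assert (K : ln (y / q) <= y / q - 1).
    { assert (hyq : 0 < y / q) by (apply Rdiv_lt_0_compat; auto).
      pose proof (exp_ineq1_le (y / q - 1)) as K.
      rewrite <- (ln_exp (y / q - 1)).
      apply ln_le; auto. lra. }
    rewrite ln_div in K by auto.
    apply (Rmult_le_compat_l q) in K; [|lra].
    replace (q * (y / q - 1)) with (y - q) in K by (field; lra). lra.
  - left. apply exp_increasing. exact L.
  - right. now rewrite L.
Qed.

(** The weight [exp (- c (n+1)^beta)]. *)
Definition W (c beta : R) (n : nat) : R := exp (- c * Rpower (INR (S n)) beta).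

Lemma W_pos c b n : 0 < W c b n.
Proof. apply exp_pos. Qed.

Lemma INR_S_pos n : 0 < INR (S n).
Proof. apply lt_0_INR; lia. Qed.

(** Moments of the weight. For [beta = k / (k + 1)] the exponent [m / beta] is
  [(1 + 1/k) m]. *)
Lemma W_moment c beta m n : 0 < c -> 0 < beta -> (0 < m)%nat ->
  INR (S n) ^ m * W c beta n <= Rpower (INR m / (beta * c)) (INR m / beta).
Proof.
  intros hc hb hm. set (x := INR (S n)). assert (hx : 0 < x) by apply INR_S_pos.
  assert (hm' : 0 < INR m) by (apply lt_0_INR; auto).
  set (q := INR m / beta). assert (hq : 0 < q) by (apply Rdiv_lt_0_compat; auto).
  set (y := c * Rpower x beta).
  assert (hy : 0 < y) by (apply Rmult_lt_0_compat; auto; apply exp_pos).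
  pose proof (Rpower_exp_bound y q hy hq) as K.
  assert (E : x ^ m = Rpower y q * Rpower (/ c) q).
  { rewrite Rpower_mult_distr; auto; [|apply Rinv_0_lt_compat; auto].
    unfold y. replace (c * Rpower x beta * / c) with (Rpower x beta) by (field; lra).
    rewrite Rpower_mult. unfold q. replace (beta * (INR m / beta)) with (INR m) by (field; lra).
    symmetry; apply Rpower_pow; auto. }
  unfold W. fold x. rewrite E. replace (- c * Rpower x beta) with (- y) by (unfold y; ring).
  replace (INR m / (beta * c)) with (q * / c) by (unfold q; field; split; lra).
  rewrite <- Rpower_mult_distr; auto; [|apply Rinv_0_lt_compat; auto].
  assert (0 < Rpower (/ c) q) by apply exp_pos. fold q.
  replace (Rpower y q * Rpower (/ c) q * exp (- y)) with (Rpower y q * exp (- y) * Rpower (/ c) q) by ring.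
  apply Rmult_le_compat_r; lra.
Qed.

Lemma ex_series_inv_sq : ex_series (fun n => / (INR (S n)) ^ 2).
Proof.
  apply (ex_series_dom _ (fun n => 2 * (/ INR (S n) - / INR (S (S n))))).
  - intros n. assert (hx := INR_S_pos n). rewrite Rabs_right.
    + rewrite (S_INR (S n)). set (x := INR (S n)) in *.
      assert (h1 : 1 <= x) by apply INR_S_ge1.
      replace (2 * (/ x - / (x + 1))) with (2 * x / (x + 1) * / x ^ 2) by (field; lra).
      assert (0 < / x ^ 2) by (apply Rinv_0_lt_compat; nra).
      assert (1 <= 2 * x / (x + 1)).
      { apply Rmult_le_reg_r with (x + 1); [lra|]. unfold Rdiv. rewrite Rmult_assoc, Rinv_l by lra. lra. }
      nra.
    + apply Rle_ge. left. apply Rinv_0_lt_compat. apply pow_lt; auto.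
  - apply (ex_series_scal_l_R 2).
    exists 1. apply is_series_Reals. intros eps he.
    destruct (archimed_cor1 eps he) as (K & h1 & h2). exists K. intros n hn.
    unfold R_dist.
    assert (E : sum_f_R0 (fun n => / INR (S n) - / INR (S (S n))) n = 1 - / INR (S (S n))).
    { clear hn. induction n as [|n IH]; [simpl; field|]. rewrite tech5, IH. ring. }
    change (Rabs (sum_f_R0 (fun n => / INR (S n) - / INR (S (S n))) n - 1) < eps).
    rewrite E. replace (1 - / INR (S (S n)) - 1) with (- / INR (S (S n))) by ring.
    rewrite Rabs_Ropp, Rabs_right.
    + eapply Rle_lt_trans; [|exact h1]. apply Rinv_le_contravar; [apply lt_0_INR; auto|apply le_INR; lia].
    + apply Rle_ge; left; apply Rinv_0_lt_compat, INR_S_pos.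
Qed.

Lemma W_summable c beta : 0 < c -> 0 < beta -> summable_weight (W c beta).
Proof.
  intros hc hb p.
  set (K := Rpower (INR (p + 2) / (beta * c)) (INR (p + 2) / beta)).
  apply (ex_series_dom _ (fun n => K * / (INR (S n)) ^ 2)).
  - intros n. assert (hx := INR_S_pos n).
    pose proof (W_moment c beta (p + 2) n hc hb ltac:(lia)) as M. fold K in M.
    rewrite Rabs_right.
    + rewrite pow_add in M. assert (h2 : 0 < INR (S n) ^ 2) by (apply pow_lt; auto).
      apply Rmult_le_reg_r with (INR (S n) ^ 2); auto.
      rewrite (Rmult_assoc K), Rinv_l by lra. lra.
    + apply Rle_ge, Rmult_le_pos; [apply pow_le; lra|left; apply W_pos].
  - apply (ex_series_scal_l_R K). apply ex_series_inv_sq.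
Qed.

Lemma summable_weight_le E E' A : (forall n, 0 <= E n <= A * E' n) -> summable_weight E' -> summable_weight E.
Proof.
  intros H HE p. apply (ex_series_dom _ (fun n => A * (INR (S n) ^ p * E' n))).
  - intros n. destruct (H n) as [h1 h2]. assert (0 <= INR (S n) ^ p) by (apply pow_le, pos_INR).
    rewrite Rabs_right by (apply Rle_ge, Rmult_le_pos; auto).
    replace (A * (INR (S n) ^ p * E' n)) with (INR (S n) ^ p * (A * E' n)) by ring.
    apply Rmult_le_compat_l; auto.
  - apply (ex_series_scal_l_R A). apply HE.
Qed.

Lemma geom_summable q : 0 < q < 1 -> summable_weight (fun n => q ^ n).
Proof.
  intros hq. assert (hl : ln q < 0) by (rewrite <- ln_1; apply ln_increasing; lra).
  apply (summable_weight_le _ (W (- ln q) 1) (/ q)); [|apply W_summable; lra].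
  intros n. split; [apply pow_le; lra|]. right.
  unfold W. rewrite Rpower_1 by apply INR_S_pos.
  replace (- - ln q * INR (S n)) with (INR (S n) * ln q) by ring.
  change (exp (INR (S n) * ln q)) with (Rpower q (INR (S n))). rewrite Rpower_pow by lra.
  simpl. field. lra.
Qed.

(** ** Regular families of monomials *)

Lemma Bd_le Om E E' g : (exists A q, 0 <= A /\ forall n, 0 <= E n <= A * INR (S n) ^ q * E' n) ->
  Bd Om E g -> Bd Om E' g.
Proof.
  intros (A & q & hA & H) (B & p & hB & Hg). exists (B * A), (p + q)%nat. split; [apply Rmult_le_pos; auto|].
  intros n z hz. eapply Rle_trans; [apply Hg; auto|]. destruct (H n) as [h1 h2]. rewrite pow_add.
  replace (B * A * (INR (S n) ^ p * INR (S n) ^ q) * E' n) with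
    (B * INR (S n) ^ p * (A * INR (S n) ^ q * E' n)) by ring.
  apply Rmult_le_compat_l; auto. apply Rmult_le_pos; auto. apply pow_le, pos_INR.
Qed.

Lemma Reg_Bd_const Om E N (c : nat -> C) : (forall i, open (Om i)) ->
  (forall n, 0 <= E n) -> (exists A p, 0 <= A /\ forall n, Cmod (c n) <= A * INR (S n) ^ p * E n) ->
  Reg (Bd Om E) Om N (fun n _ => c n).
Proof.
  intros hS hE (A & p & hA & H). apply Reg_const; auto using respects_Bd.
  - exists A, p. auto.
  - exists A, p. split; auto. intros n z hz. rewrite Cmod_0.
    apply Rmult_le_pos; auto. apply Rmult_le_pos; auto. apply pow_le, pos_INR.
Qed.

Lemma Reg_Bd_mult Om E1 E2 E N g h : (forall i, open (Om i)) ->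
  (forall n, 0 <= E1 n) -> (forall n, 0 <= E2 n) ->
  (exists A q, 0 <= A /\ forall n, 0 <= E1 n * E2 n <= A * INR (S n) ^ q * E n) ->
  (forall n, 0 <= E n) ->
  Reg (Bd Om E1) Om N g -> Reg (Bd Om E2) Om N h -> Reg (Bd Om E) Om N (fun n z => g n z * h n z)%C.
Proof.
  intros hS h1 h2 H hE. apply Reg_mult; auto using respects_Bd.
  - intros; apply Bd_plus; auto.
  - intros u v hu hv. apply (Bd_le Om (fun n => E1 n * E2 n)); auto. apply Bd_mult; auto.
Qed.

Lemma Reg_Bd_const_le Om E N (c : nat -> C) A : (forall i, open (Om i)) -> (forall n, 0 <= E n) ->
  0 <= A -> (forall n, Cmod (c n) <= A * E n) -> Reg (Bd Om E) Om N (fun n _ => c n).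
Proof.
  intros hS hE hA H. apply Reg_Bd_const; auto. exists A, 0%nat. split; auto.
  intros n. rewrite Rmult_1_r. auto.
Qed.

(** Multiplication by a family of weight 1 does not change the weight. *)
Lemma Reg_Bd_mult1 Om E N g h : (forall i, open (Om i)) -> (forall n, 0 <= E n) ->
  Reg (Bd Om (fun _ => 1)) Om N g -> Reg (Bd Om E) Om N h ->
  Reg (Bd Om E) Om N (fun n z => g n z * h n z)%C.
Proof.
  intros hS hE. apply Reg_Bd_mult; auto; [intros; lra|].
  exists 1, 0%nat. split; [lra|]. intros n. specialize (hE n). lra.
Qed.

Lemma dz1_mod b : Cmod (dz1 b) = 1.
Proof. destruct b; [apply Cmod_1|apply Cmod_Ci]. Qed.

(** All the shifts [p] are treated at once, because a derivative of [z^(n-p)] is a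
  multiple of [z^(n-p-1)]; once the truncated difference [n - p] is zero, so is
  the factor. *)
Lemma Reg_zpow (Om : nat -> C -> Prop) (rho E : nat -> R) N : (forall i, open (Om i)) ->
  (forall n z, Om n z -> Cmod z <= rho n) -> (forall n, 0 <= E n) ->
  (forall p, exists A q, 0 <= A /\ forall n, rho n ^ (n - p) <= A * INR (S n) ^ q * E n) ->
  forall p, Reg (Bd Om E) Om N (fun n z => z ^ (n - p))%C.
Proof.
  intros hS hrho hE H.
  assert (HB : forall p, Bd Om E (fun n z => z ^ (n - p))%C).
  { intros p. destruct (H p) as (A & q & hA & HA). exists A, q. split; auto. intros n z hz.
    eapply Rle_trans; [|apply HA]. rewrite Cmod_pow. apply pow_incr. split; [apply Cmod_ge_0|auto]. }
  assert (Hc : forall p i z, continuous (fun z => z ^ (i - p))%C z).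
  { intros p i z. apply (Cn_continuous 0 (fun _ => True)); auto.
    apply (Cn_pow 0 _ (fun z => z)); [apply open_true|apply Cn_id, open_true]. }
  induction N as [|N IH]; intros p.
  - split; [|split; [|exact Logic.I]]; auto.
  - split; [|split; [|split]]; auto.
    + intros i z hz. apply diff_at_is. intros b; eexists. apply (is_pd_pow b (fun z => z)), is_pd_id.
    + intros b.
      apply (Reg_ext (Bd Om E) Om N hS (respects_Bd Om E)
        (fun n z => (INR (n - p) * dz1 b) * z ^ (n - S p))%C).
      * intros i z hz.
        rewrite (is_pd_unique _ _ _ _ (is_pd_pow b (fun z => z) z _ (i - p) (is_pd_id b z))).
        replace (pred (i - p)) with (i - S p)%nat by lia. ring.
      * apply (Reg_Bd_mult1 Om E N (fun n _ => INR (n - p) * dz1 b)%C); auto.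
        apply Reg_Bd_const; auto; [intros; lra|]. exists 1, 1%nat. split; [lra|]. intros n.
        rewrite Cmod_mult, dz1_mod, Cmod_R, Rabs_right by (apply Rle_ge, pos_INR).
        pose proof (le_INR (n - p) (S n) ltac:(lia)). rewrite pow_1. lra.
Qed.

Lemma Reg_zpow0 (Om : nat -> C -> Prop) (rho E : nat -> R) N : (forall i, open (Om i)) ->
  (forall n z, Om n z -> Cmod z <= rho n) -> (forall n, 0 <= E n) ->
  (forall p, exists A, 0 <= A /\ forall n, rho n ^ (n - p) <= A * E n) ->
  Reg (Bd Om E) Om N (fun n z => z ^ n)%C.
Proof.
  intros hS hrho hE H.
  apply (Reg_ext (Bd Om E) Om N hS (respects_Bd Om E) (fun n z => z ^ (n - 0))%C).
  - intros i z _. now rewrite Nat.sub_0_r.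
  - apply (Reg_zpow Om rho); auto. intros p. destruct (H p) as (A & hA & HA).
    exists A, 0%nat. split; auto. intros n. rewrite Rmult_1_r. auto.
Qed.

Lemma Reg_zbarpow (Om : nat -> C -> Prop) rho N : (forall i, open (Om i)) ->
  (forall n z, Om n z -> Cmod z <= rho) ->
  forall j, Reg (Bd Om (fun _ => 1)) Om N (fun n z => Cconj z ^ j)%C.
Proof.
  intros hS hrho.
  assert (HB : forall j, Bd Om (fun _ => 1) (fun n z => Cconj z ^ j)%C).
  { intros j. exists (Rabs rho ^ j), 0%nat. split; [apply pow_le, Rabs_pos|]. intros n z hz.
    rewrite Cmod_pow, Cmod_conj. rewrite !Rmult_1_r. apply pow_incr.
    split; [apply Cmod_ge_0|]. eapply Rle_trans; [eauto|apply Rle_abs]. }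
  assert (Hc : forall j z, continuous (fun z => Cconj z ^ j)%C z).
  { intros j z. apply (Cn_continuous 0 (fun _ => True)); auto.
    apply Cn_pow, Cn_conj, Cn_id; apply open_true. }
  induction N as [|N IH]; intros j.
  - split; [|split; [|exact Logic.I]]; auto.
  - split; [|split; [|split]]; auto.
    + intros i z hz. apply diff_at_is. intros b; eexists.
      apply (is_pd_pow b (fun z => Cconj z)), is_pd_conj, is_pd_id.
    + intros b.
      apply (Reg_ext (Bd Om (fun _ => 1)) Om N hS (respects_Bd Om _)
        (fun n z => (INR j * Cconj (dz1 b)) * Cconj z ^ pred j)%C).
      * intros i z hz.
        rewrite (is_pd_unique _ _ _ _ (is_pd_pow b (fun z => Cconj z) z _ j (is_pd_conj _ _ _ _ (is_pd_id b z)))).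
        ring.
      * apply Reg_scal; auto using respects_Bd. intros; apply Bd_scal; auto.
Qed.

(** The monomials [a_n conj(z)^j z^n] on bounded sets. *)
Lemma Reg_monomials (Om : nat -> C -> Prop) (rho E1 E2 E : nat -> R) (a : nat -> C) A j N :
  (forall i, open (Om i)) -> (forall n z, Om n z -> Cmod z <= rho n <= 2) ->
  (forall n, 0 <= E1 n) -> (forall n, 0 <= E2 n) -> (forall n, 0 <= E n) -> 0 <= A ->
  (forall n, Cmod (a n) <= A * E1 n) ->
  (forall p, exists B, 0 <= B /\ forall n, rho n ^ (n - p) <= B * E2 n) ->
  (forall n, E1 n * E2 n <= E n) ->
  Reg (Bd Om E) Om N (fun n z => a n * (Cconj z ^ j * z ^ n))%C.
Proof.
  intros hS hrho h1 h2 hE hA Ha Hz HE.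
  apply (Reg_Bd_mult Om E1 E2 E N (fun n _ => a n) (fun n z => Cconj z ^ j * z ^ n)%C); auto.
  - exists 1, 0%nat. split; [lra|]. intros n. split; [apply Rmult_le_pos; auto|].
    specialize (HE n). lra.
  - apply (Reg_Bd_const_le Om E1 N a A); auto.
  - apply (Reg_Bd_mult1 Om E2 N (fun n z => Cconj z ^ j)%C (fun n z => z ^ n)%C); auto.
    + apply (Reg_zbarpow Om 2); auto. intros n z hz. specialize (hrho n z hz). lra.
    + apply (Reg_zpow0 Om rho); auto. intros n z hz. apply hrho; auto.
Qed.

(** * Power series *)

Lemma pow_shift_bound rho p n : 0 < rho <= 1 -> rho ^ (n - p) <= / rho ^ p * rho ^ n.
Proof.
  intros h. assert (hp : 0 < rho ^ p) by (apply pow_lt; lra).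
  apply Rmult_le_reg_l with (rho ^ p); auto. rewrite <- Rmult_assoc, Rinv_r, Rmult_1_l by lra.
  rewrite <- pow_add. destruct (Nat.le_gt_cases p n) as [L|L].
  - right; f_equal; lia.
  - replace (p + (n - p))%nat with (n + (p - n))%nat by lia. rewrite pow_add.
    assert (rho ^ (p - n) <= 1) by (rewrite <- (pow1 (p - n)); apply pow_incr; lra).
    assert (0 < rho ^ n) by (apply pow_lt; lra). nra.
Qed.

(** The family of Taylor monomials of a holomorphic function is regular on
  every smaller disk. *)
Lemma Reg_taylor h rho N : holomorphic h -> 0 < rho < 1 ->
  exists E, (forall n, 0 <= E n) /\ summable_weight E /\
  Reg (Bd (fun _ => disk rho) E) (fun _ : nat => disk rho) N (fun n z => coef h n * z ^ n)%C.
Proof.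
  intros Hh hrho. set (r := (1 + rho) / 2). assert (hr : rho < r < 1) by (unfold r; lra).
  set (q := rho / r).
  assert (hq : 0 < q < 1).
  { split; [apply Rdiv_lt_0_compat; lra|]. apply (Rdiv_lt_1 rho r); lra. }
  exists (fun n => q ^ n). split; [intros; apply pow_le; lra|]. split; [apply geom_summable; auto|].
  assert (Hc : forall s, continuous (fun s => h (circ r s)) s).
  { apply (cont_on_circle unit_disk 1); [apply Hh|]. intros; apply disk_circ; lra. }
  destruct (circle_cont_bounded _ Hc) as (G & hG & HG).
  assert (HS : forall i : nat, open (disk rho)) by (intros; apply open_diskr).
  apply (Reg_Bd_mult (fun _ => disk rho) (fun n => (/ r) ^ n) (fun n => rho ^ n) (fun n => q ^ n) N
    (fun n _ => coef h n) (fun n z => z ^ n)%C); auto.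
  - intros n; apply pow_le; left; apply Rinv_0_lt_compat; lra.
  - intros n; apply pow_le; lra.
  - exists 1, 0%nat. split; [lra|]. intros n. rewrite <- Rpow_mult_distr.
    replace (/ r * rho) with q by (unfold q, Rdiv; ring).
    assert (0 <= q ^ n) by (apply pow_le; lra). lra.
  - intros n; apply pow_le; lra.
  - apply (Reg_Bd_const_le _ _ N _ (2 * G)); auto.
    + intros n; apply pow_le; left; apply Rinv_0_lt_compat; lra.
    + lra.
    + intros n. rewrite (coef_eq h n r Hh) by lra. rewrite Cmod_div by apply RtoC_2PI_nz.
      pose proof two_PI_pos as hp. rewrite Cmod_R, (Rabs_right (2 * PI)) by lra.
      pose proof (ecoef_bound h n r G ltac:(lra) Hc HG) as B.
      apply Rmult_le_reg_r with (2 * PI); [lra|]. unfold Rdiv.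
      rewrite Rmult_assoc, Rinv_l by lra. lra.
  - apply (Reg_zpow0 (fun _ => disk rho) (fun _ => rho)); auto.
    + intros n z hz. left; exact hz.
    + intros n; apply pow_le; lra.
    + intros p. exists (/ rho ^ p). split.
      * left; apply Rinv_0_lt_compat, pow_lt; lra.
      * intros n. apply pow_shift_bound; lra.
Qed.

Lemma holomorphic_cser h z : holomorphic h -> unit_disk z ->
  h z = cser (fun n => coef h n * z ^ n)%C.
Proof.
  intros Hh hz. unfold unit_disk in hz. pose proof (Cmod_ge_0 z).
  destruct (Reg_taylor h ((1 + Cmod z) / 2) 0 Hh ltac:(lra)) as (E & hE & HE & HR).
  pose proof (Reg_bound _ _ _ _ HR) as HB.
  assert (hz' : disk ((1 + Cmod z) / 2) z) by (unfold disk; lra).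
  destruct (Bd_dom _ E _ z HE HB hz') as (M & HM & HM').
  eapply is_cser_eq; [exact HM|exact HM'|]. apply holomorphic_series; auto.
Qed.

Lemma holomorphic_smooth h : holomorphic h -> smooth unit_disk h.
Proof.
  intros Hh N. apply Cn_local. intros z hz. unfold unit_disk in hz. pose proof (Cmod_ge_0 z).
  set (rho := (1 + Cmod z) / 2). assert (hr : 0 < rho < 1) by (unfold rho; lra).
  exists (disk rho). split; [unfold disk, rho; lra|].
  destruct (Reg_taylor h rho N Hh hr) as (E & hE & HE & HR).
  apply (Cn_ext N (disk rho) (fun z => cser (fun n => coef h n * z ^ n)%C)); [apply open_diskr| |].
  - intros w hw. symmetry; apply holomorphic_cser; auto. unfold unit_disk, disk in *. lra.
  - apply (Reg_cser (disk rho) E N (open_diskr rho) HE (fun n z => coef h n * z ^ n)%C HR).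
Qed.

Lemma Cn_csum n U (g : nat -> C -> C) K : open U -> (forall j, (j < K)%nat -> Cn n U (g j)) ->
  Cn n U (fun z => csum K (fun j => g j z)).
Proof.
  intros hU. induction K as [|K IH]; intros H; simpl.
  - apply Cn_const; auto.
  - apply (Cn_plus n U (fun z => csum K (fun j => g j z)) (g K)); auto.
Qed.

Lemma wd_csum w (U : C -> Prop) (g : nat -> C -> C) K z : open U ->
  (forall j, (j < K)%nat -> smooth U (g j)) -> U z ->
  wd w (fun z => csum K (fun j => g j z)) z = csum K (fun j => wd w (g j) z).
Proof.
  intros hU. induction K as [|K IH]; intros H hz; simpl.
  - apply wd_zero.
  - rewrite (wd_plus w U (fun z => csum K (fun j => g j z)) (g K)), IH; auto.
    + apply Cn_csum; auto. intros j hj; apply H; lia.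
    + apply H; lia.
Qed.

Lemma smooth_zbarpow U j : open U -> smooth U (fun z => Cconj z ^ j)%C.
Proof. intros hU n. apply Cn_pow, Cn_conj, Cn_id; auto. Qed.

Lemma smooth_mult U f g : open U -> smooth U f -> smooth U g -> smooth U (fun z => f z * g z)%C.
Proof. intros hU h1 h2 n. apply Cn_mult; auto. Qed.

Lemma smooth_const U c : open U -> smooth U (fun _ => c).
Proof. intros hU n. apply Cn_const; auto. Qed.

Lemma polyanalytic_smooth N f : (1 <= N)%nat -> polyanalytic N f -> smooth unit_disk f.
Proof.
  intros hN Hf n. pose proof open_disk as hU.
  apply (Cn_ext n unit_disk (fun z => csum N (fun j => RtoC (/ INR (fact j)) * (Cconj z ^ j * pcomp N f j z)))%C); auto.
  - intros z hz. symmetry; apply pcomp_sum; auto.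
  - apply (Cn_csum n unit_disk (fun j z => RtoC (/ INR (fact j)) * (Cconj z ^ j * pcomp N f j z))%C); auto.
    intros j hj. apply smooth_mult; auto using smooth_const. apply smooth_mult; auto using smooth_zbarpow.
    apply holomorphic_smooth, pcomp_holomorphic; auto.
Qed.

(** Words applied to the monomials [conj(z)^j z^n] on the closed disk: every letter
  costs at most a factor [n + j]. *)
Lemma monomial_word w : (forall l, In l w -> Cmod (lz l) <= 1 /\ Cmod (lzbar l) <= 1) ->
  forall j n z, Cmod z <= 1 -> Cmod (wd w (fun z => Cconj z ^ j * z ^ n)%C z) <= INR (n + j) ^ length w.
Proof.
  pose (T := fun _ : C => True). assert (hT : open T) by apply open_true.
  assert (Hm : forall j n, smooth T (fun z => Cconj z ^ j * z ^ n)%C).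
  { intros j n p. apply (Cn_mult p T (fun z => Cconj z ^ j)%C (fun z => z ^ n)%C); auto.
    apply Cn_pow, Cn_conj, Cn_id; auto. apply (Cn_pow p T (fun z => z)); auto. apply Cn_id; auto. }
  induction w as [|l w IH]; intros Hl j n z hz.
  - simpl. rewrite Cmod_mult, !Cmod_pow, Cmod_conj.
    assert (Cmod z ^ j <= 1) by (rewrite <- (pow1 j); apply pow_incr; split; [apply Cmod_ge_0|auto]).
    assert (Cmod z ^ n <= 1) by (rewrite <- (pow1 n); apply pow_incr; split; [apply Cmod_ge_0|auto]).
    assert (0 <= Cmod z ^ j) by (apply pow_le, Cmod_ge_0).
    nra.
  - simpl.
    assert (E : Lop l (fun z => Cconj z ^ j * z ^ n)%C = fun z =>
      ((RtoC (INR j) * lzbar l) * (Cconj z ^ pred j * z ^ n) + (RtoC (INR n) * lz l) * (Cconj z ^ j * z ^ pred n))%C).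
    { apply functional_extensionality; intros y.
      rewrite (Lop_mult l (fun z => Cconj z ^ j)%C (fun z => z ^ n)%C).
      - rewrite Lop_zbarpow, Lop_zpow. ring.
      - apply (Cn_diff 0 T); [apply Cn_pow, Cn_conj, Cn_id; auto|exact Logic.I].
      - apply (Cn_diff 0 T); [apply (Cn_pow 1 T (fun z => z)); auto; apply Cn_id; auto|exact Logic.I]. }
    rewrite E.
    rewrite (wd_plus w T (fun z => (RtoC (INR j) * lzbar l) * (Cconj z ^ pred j * z ^ n))%C
      (fun z => (RtoC (INR n) * lz l) * (Cconj z ^ j * z ^ pred n))%C); auto.
    2,3: apply smooth_mult; auto using smooth_const. 2: exact Logic.I.
    rewrite (wd_scal w T (RtoC (INR j) * lzbar l) (fun z => Cconj z ^ pred j * z ^ n)%C); auto. 2: apply Hm. 2: exact Logic.I.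
    rewrite (wd_scal w T (RtoC (INR n) * lz l) (fun z => Cconj z ^ j * z ^ pred n)%C); auto. 2: apply Hm. 2: exact Logic.I.
    destruct (Hl l (or_introl eq_refl)) as [l1 l2].
    assert (Hl' : forall l, In l w -> Cmod (lz l) <= 1 /\ Cmod (lzbar l) <= 1) by (intros; apply Hl; right; auto).
    pose proof (IH Hl' (pred j) n z hz) as B1. pose proof (IH Hl' j (pred n) z hz) as B2.
    eapply Rle_trans; [apply Cmod_triangle|]. rewrite !Cmod_mult, !Cmod_R, !Rabs_right by (apply Rle_ge, pos_INR).
    pose proof (pos_INR j). pose proof (pos_INR n).
    assert (P : forall a b, (a <= b)%nat -> INR a ^ length w <= INR b ^ length w).
    { intros a b hab. apply pow_incr. split; [apply pos_INR|apply le_INR; auto]. }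
    pose proof (P (n + pred j)%nat (n + j)%nat ltac:(lia)) as P1.
    pose proof (P (pred n + j)%nat (n + j)%nat ltac:(lia)) as P2.
    set (X := INR (n + j) ^ length w) in *.
    set (b1 := Cmod (wd w (fun z => Cconj z ^ pred j * z ^ n)%C z)) in *.
    set (b2 := Cmod (wd w (fun z => Cconj z ^ j * z ^ pred n)%C z)) in *.
    assert (0 <= b1) by apply Cmod_ge_0. assert (0 <= b2) by apply Cmod_ge_0.

    rewrite (plus_INR n j).
    assert (K1 : INR j * Cmod (lzbar l) * b1 <= INR j * X).
    { rewrite Rmult_assoc. apply Rmult_le_compat_l; auto. nra. }
    assert (K2 : INR n * Cmod (lz l) * b2 <= INR n * X).
    { rewrite Rmult_assoc. apply Rmult_le_compat_l; auto. nra. }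
    lra.
Qed.

(** ** From coefficient decay to Gevrey bounds *)

Lemma Rpower_INR_split m a b : 0 < a -> 0 < b -> (0 < m)%nat ->
  Rpower (INR m * a) (b * INR m) = Rpower a b ^ m * Rpower (INR m) (b * INR m).
Proof.
  intros ha hb hm. assert (0 < INR m) by (apply lt_0_INR; auto).
  rewrite <- Rpower_mult_distr by auto. rewrite Rmult_comm. f_equal.
  rewrite <- (Rpower_pow m) by apply exp_pos. rewrite Rpower_mult. reflexivity.
Qed.

Lemma W_half c b n : W c b n = W (c / 2) b n * W (c / 2) b n.
Proof. unfold W. rewrite <- exp_plus. f_equal. field. Qed.

Lemma W_moment_gevrey k c m n : 0 < k -> 0 < c ->
  INR (S n) ^ m * W c (k / (k + 1)) n <=
  Rpower ((k + 1) / (k * c)) (1 + 1 / k) ^ m * Rpower (INR m) ((1 + 1 / k) * INR m).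
Proof.
  intros hk hc. destruct m as [|m].
  - rewrite Rmult_0_r. unfold Rpower at 2. rewrite Rmult_0_l, exp_0.
    assert (W c (k / (k + 1)) n <= 1).
    { unfold W. apply Rle_trans with (exp 0); [|rewrite exp_0; lra]. left. apply exp_increasing.
      assert (0 < Rpower (INR (S n)) (k / (k + 1))) by apply exp_pos.
      pose proof (Rmult_lt_0_compat c _ hc H). lra. }
    lra.
  - assert (hb : 0 < k / (k + 1)) by (apply Rdiv_lt_0_compat; lra).
    eapply Rle_trans; [apply W_moment; auto; lia|].
    rewrite <- Rpower_INR_split; [|apply Rdiv_lt_0_compat; nra| |lia].
    + right. f_equal; field; lra.
    + assert (0 < 1 / k) by (apply Rdiv_lt_0_compat; lra). lra.
Qed.

Lemma sup_norm_le (U : C -> Prop) h b : (forall z, U z -> Cmod (h z) <= b) ->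
  Rbar_le (sup_norm U h) (Finite b).
Proof.
  intros H. apply (proj2 (Lub_Rbar_correct _)). intros x (u & hu & ->). apply H; auto.
Qed.

Lemma sup_norm_ge (U : C -> Prop) h b z : Rbar_le (sup_norm U h) (Finite b) -> U z -> Cmod (h z) <= b.
Proof.
  intros H hz.
  assert (K := proj1 (Lub_Rbar_correct (fun r => exists u, U u /\ r = Cmod (h u))) (Cmod (h z)) (ex_intro _ z (conj hz eq_refl))).
  exact (Rbar_le_trans _ _ _ K H).
Qed.

Lemma csum_bound_const K (a : nat -> C) b : (forall i, (i < K)%nat -> Cmod (a i) <= b) ->
  Cmod (csum K a) <= INR K * b.
Proof.
  intros H. induction K as [|K IH].
  - simpl. rewrite Cmod_0. lra.
  - change (csum (S K) a) with (csum K a + a K)%C. rewrite S_INR.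
    eapply Rle_trans; [apply Cmod_triangle|]. specialize (IH (fun i h => H i ltac:(lia))).
    specialize (H K ltac:(lia)). lra.
Qed.

Lemma lXY_norms w a2 a1 : w = repeat lY a2 ++ repeat lX a1 ->
  forall l, In l w -> Cmod (lz l) <= 1 /\ Cmod (lzbar l) <= 1.
Proof.
  intros -> l h. apply in_app_or in h. destruct h as [h|h]; apply repeat_spec in h; subst l.
  - unfold lz, lzbar, lY; simpl.
    replace (0 + 1 * Ci)%C with Ci by ring. replace (0 - 1 * Ci)%C with (- Ci)%C by ring.
    rewrite Cmod_opp, Cmod_Ci. lra.
  - unfold lz, lzbar, lX; simpl.
    replace (1 + 0 * Ci)%C with (RtoC 1) by ring. replace (1 - 0 * Ci)%C with (RtoC 1) by ring.
    rewrite Cmod_1. lra.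
Qed.

Lemma cser_component N f j z : (j < N)%nat -> polyanalytic N f -> unit_disk z ->
  cser (fun n => (RtoC (/ INR (fact j)) * coef (pcomp N f j) n) * (Cconj z ^ j * z ^ n))%C =
  (RtoC (/ INR (fact j)) * (Cconj z ^ j * pcomp N f j z))%C.
Proof.
  intros hj Hf hz. pose proof (pcomp_holomorphic N f j hj Hf) as Hh.
  rewrite (holomorphic_cser (pcomp N f j) z) by auto.
  destruct (Reg_taylor (pcomp N f j) ((1 + Cmod z) / 2) 0 Hh) as (E & hE & HE & HR').
  { unfold unit_disk in hz. pose proof (Cmod_ge_0 z). lra. }
  destruct (Bd_dom _ E _ z HE (Reg_bound _ _ _ _ HR')) as (M & HM & HM').
  { unfold unit_disk in hz. unfold disk. lra. }
  rewrite <- (cser_scal (Cconj z ^ j) _ M HM HM').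
  rewrite <- (cser_scal (RtoC (/ INR (fact j))) _ (fun n => Cmod (Cconj z ^ j) * M n)).
  - apply cser_ext. intros n. ring.
  - intros n. rewrite Cmod_mult. apply Rmult_le_compat_l; auto. apply Cmod_ge_0.
  - apply ex_series_scal_l_R; auto.
Qed.

(** Half of the exponent of the weight absorbs the powers of [n] produced by
  differentiation, the other half makes the series converge. *)
Lemma gevrey_of_decay N k f C0 c : (1 <= N)%nat -> 0 < k -> polyanalytic N f -> 0 < C0 -> 0 < c ->
  (forall j n, (j < N)%nat -> Cmod (coef (pcomp N f j) n) <= C0 * W c (k / (k + 1)) n) ->
  gevrey_polyanalytic N k f.
Proof.
  intros hN hk Hf hC hc Hdec. split; auto.
  set (beta := k / (k + 1)) in *. assert (hb : 0 < beta) by (apply Rdiv_lt_0_compat; lra).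
  set (V := Series (W (c / 2) beta)).
  assert (HV : ex_series (W (c / 2) beta)).
  { pose proof (W_summable (c / 2) beta ltac:(lra) hb 0%nat) as K. revert K.
    apply ex_series_ext. intros n; simpl; ring. }
  assert (hV : 0 <= V).
  { eapply Rle_trans; [apply Rabs_pos|apply (series_bound (fun _ => 0))]; auto.
    intros n. rewrite Rabs_R0. left; apply W_pos. }
  set (Q := Rpower ((k + 1) / (k * (c / 2))) (1 + 1 / k)).
  assert (hQ : 0 < Q) by apply exp_pos.
  assert (hN' : 1 <= INR N) by (apply (le_INR 1); auto).
  (* each of the [N] terms is at most [C0 V (N Q)^m m^((1 + 1/k) m)]; the first
    summand takes care of the constants, the second of the powers *)
  exists (INR N * C0 * V + INR N * Q + 1). split.
  { assert (0 <= INR N * C0 * V) by (apply Rmult_le_pos; [nra|auto]). nra. }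
  intros a1 a2. cbv zeta. set (m := (a1 + a2)%nat). apply sup_norm_le. intros z hz.
  set (G := Rpower (INR m) ((1 + 1 / k) * INR m)).
  assert (hG : 0 < G) by apply exp_pos.
  rewrite dalpha_wd. set (w := repeat lY a2 ++ repeat lX a1).
  assert (hw : length w = m) by (unfold w, m; rewrite length_app, !repeat_length; lia).
  pose proof open_disk as hU.
  assert (Hh : forall j, (j < N)%nat -> holomorphic (pcomp N f j)) by (intros; apply pcomp_holomorphic; auto).
  assert (Hs : forall j, (j < N)%nat -> smooth unit_disk (fun z => RtoC (/ INR (fact j)) * (Cconj z ^ j * pcomp N f j z))%C).
  { intros j hj. apply smooth_mult; auto using smooth_const. apply smooth_mult; auto using smooth_zbarpow.
    apply holomorphic_smooth; auto. }
  rewrite (wd_ext' w unit_disk f (fun z => csum N (fun j => RtoC (/ INR (fact j)) * (Cconj z ^ j * pcomp N f j z)))%C); auto.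
  2:{ apply (polyanalytic_smooth N); auto. }
  2:{ intros y hy. apply pcomp_sum; auto. }
  rewrite (wd_csum w unit_disk (fun j z => RtoC (/ INR (fact j)) * (Cconj z ^ j * pcomp N f j z))%C); auto.
  assert (Term : forall j, (j < N)%nat -> Cmod (wd w (fun z => RtoC (/ INR (fact j)) * (Cconj z ^ j * pcomp N f j z))%C z)
    <= C0 * (INR N * Q) ^ m * G * V).
  { intros j hj.
    pose (g := fun n z => ((RtoC (/ INR (fact j)) * coef (pcomp N f j) n) * (Cconj z ^ j * z ^ n))%C).

    assert (hW : forall n, 0 <= W c beta n) by (intros; left; apply W_pos).
    pose proof (inv_fact_bounds j) as hfj.
    assert (hcf : forall n, Cmod (RtoC (/ INR (fact j)) * coef (pcomp N f j) n) <= C0 * W c beta n).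
    { intros n. rewrite Cmod_mult, Cmod_R, Rabs_right by lra.
      pose proof (Cmod_ge_0 (coef (pcomp N f j) n)). specialize (Hdec j n hj). nra. }
    assert (HR : forall p, Reg (Bd (fun _ => unit_disk) (W c beta)) (fun _ : nat => unit_disk) p g).
    { intros p. unfold g.
      apply (Reg_monomials (fun _ => unit_disk) (fun _ => 1) (W c beta) (fun _ => 1) (W c beta)
        _ C0 j p); auto; try (intros; lra).
      - intros n y hy. unfold unit_disk in hy. lra.
      - intros p'. exists 1. split; [lra|]. intros n. rewrite pow1. lra. }
    rewrite (wd_ext' w unit_disk _ (fun z => cser (fun n => g n z))); auto.
    2:{ intros y hy. symmetry; apply (cser_component N f j y); auto. }
    rewrite (wd_cser unit_disk (W c beta)); auto using W_summable.
    unfold V. rewrite <- Series_scal_l. apply cser_bound.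
    - intros n. unfold g.
      rewrite (wd_scal w unit_disk _ (fun z => Cconj z ^ j * z ^ n)%C); auto.
      2:{ apply smooth_mult; auto using smooth_zbarpow. intros p. apply (Cn_pow p _ (fun z => z)); auto. apply Cn_id; auto. }
      rewrite Cmod_mult.
      pose proof (monomial_word w (lXY_norms w a2 a1 eq_refl) j n z (Rlt_le _ _ hz)) as Mw. rewrite hw in Mw.
      assert (Mw2 : INR (n + j) ^ m <= INR N ^ m * INR (S n) ^ m).
      { rewrite <- Rpow_mult_distr. apply pow_incr. split; [apply pos_INR|].
        rewrite <- mult_INR. apply le_INR. nia. }
      pose proof (W_moment_gevrey k (c / 2) m n hk ltac:(lra)) as Wm. fold beta Q G in Wm.
      specialize (hcf n). rewrite W_half in hcf.
      assert (hw2 := W_pos (c / 2) beta n). set (w2 := W (c / 2) beta n) in *.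
      apply Rle_trans with ((C0 * (w2 * w2)) * (INR N ^ m * INR (S n) ^ m)).
      { apply Rmult_le_compat; auto; try apply Cmod_ge_0. eapply Rle_trans; eauto. }
      rewrite Rpow_mult_distr.
      replace (C0 * (w2 * w2) * (INR N ^ m * INR (S n) ^ m)) with
        (C0 * INR N ^ m * w2 * (INR (S n) ^ m * w2)) by ring.
      replace (C0 * (INR N ^ m * Q ^ m) * G * w2) with (C0 * INR N ^ m * w2 * (Q ^ m * G)) by ring.
      apply Rmult_le_compat_l; auto.
      assert (0 <= INR N ^ m) by (apply pow_le; lra).
      apply Rmult_le_pos; [apply Rmult_le_pos; lra|lra].
    - apply ex_series_scal_l_R; auto. }
  eapply Rle_trans; [apply csum_bound_const; exact Term|].
  replace (INR N * (C0 * (INR N * Q) ^ m * G * V)) with ((INR N * C0 * V) * (INR N * Q) ^ m * G) by ring.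
  apply Rmult_le_compat_r; [lra|]. rewrite pow_add, pow_1, Rmult_comm.
  assert (h1 : 0 <= INR N * C0 * V) by (apply Rmult_le_pos; auto; apply Rmult_le_pos; lra).
  assert (h2 : 0 <= INR N * Q) by (apply Rmult_le_pos; lra).
  apply Rmult_le_compat; auto; [apply pow_le; auto| |lra].
  apply pow_incr. lra.
Qed.

(** * The closed disk *)

Lemma closure_disk_iff z : closure unit_disk z <-> Cmod z <= 1.
Proof.
  split.
  - intros H. apply Rnot_lt_le. intros h.
    destruct (H (fun w => 1 < Cmod w) (open_exterior 1 z h)) as (w & h1 & h2).
    unfold unit_disk in h2. lra.
  - intros hz P [e he].
    pose proof (cond_pos e) as hp. set (t := Rmin (e / 2) (1 / 2)).
    assert (ht : 0 < t <= 1 / 2) by (split; [apply Rmin_glb_lt; lra|apply Rmin_r]).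
    assert (ht2 : t <= e / 2) by apply Rmin_l.
    exists (RtoC (1 - t) * z)%C. split.
    + apply he.
      pose proof (re_le_Cmod z) as r1. pose proof (im_le_Cmod z) as r2.
      assert (K : forall x, Rabs x <= 1 -> Rabs (((1 - t) * x) - x) < e).
      { intros x hx. replace ((1 - t) * x - x) with (- (t * x)) by ring.
        rewrite Rabs_Ropp, Rabs_mult, (Rabs_right t) by lra. nra. }
      split.
      * change (Rabs (((1 - t) * Re z - 0 * Im z) - Re z) < e).
        replace ((1 - t) * Re z - 0 * Im z) with ((1 - t) * Re z) by ring. apply K; lra.
      * change (Rabs (((1 - t) * Im z + 0 * Re z) - Im z) < e).
        replace ((1 - t) * Im z + 0 * Re z) with ((1 - t) * Im z) by ring. apply K; lra.
    + unfold unit_disk. rewrite Cmod_mult, Cmod_R, Rabs_right by lra.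
      nra.
Qed.

(** An open set containing the closed disk contains a larger disk. *)
Lemma neighbourhood_disk (U : C -> Prop) : open U -> (forall z, Cmod z <= 1 -> U z) ->
  exists R, 1 < R <= 2 /\ forall z, Cmod z < R -> U z.
Proof.
  intros hU HU.
  (* around a point of the closed disk, a square inside [U]; around any other
    point, a square that is small compared with its distance to the disk *)
  assert (Hd : forall p : R * R, exists d : posreal,
    (Cmod p <= 1 -> forall w : C, Rabs (Re w - Re p) < d -> Rabs (Im w - Im p) < d -> U w) /\
    (1 < Cmod p -> 4 * d <= Cmod p - 1)).
  { intros p. destruct (Rle_lt_dec (Cmod p) 1) as [h|h].
    - destruct (hU p (HU p h)) as [e he]. exists e. split; [|lra].
      intros _ w h1 h2. apply he. split; assumption.
    - assert (h' : 0 < (Cmod p - 1) / 4) by lra. exists (mkposreal _ h'). simpl. split; lra. }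
  pose (delta := fun p => proj1_sig (constructive_indefinite_description _ (Hd p))).
  assert (Hdelta : forall p, (Cmod p <= 1 -> forall w : C, Rabs (Re w - Re p) < delta p -> Rabs (Im w - Im p) < delta p -> U w) /\
    (1 < Cmod p -> 4 * delta p <= Cmod p - 1)).
  { intros p. apply (proj2_sig (constructive_indefinite_description _ (Hd p))). }
  clearbody delta.
  destruct (compactness_value_2d (-2) 2 (-2) 2 (fun u v => delta (u, v))) as [d H].
  exists (1 + Rmin d 1). pose proof (cond_pos d) as hd.
  assert (h1 : 0 < Rmin d 1) by (apply Rmin_glb_lt; lra).
  assert (h2 : Rmin d 1 <= 1) by apply Rmin_r. assert (h3 : Rmin d 1 <= d) by apply Rmin_l.
  split; [lra|]. intros z hz.
  pose proof (re_le_Cmod z) as r1. pose proof (im_le_Cmod z) as r2.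
  assert (b1 : -2 <= Re z <= 2) by (apply Rabs_le_between; lra).
  assert (b2 : -2 <= Im z <= 2) by (apply Rabs_le_between; lra).
  specialize (H (Re z) (Im z) b1 b2). apply NNPP in H.
  destruct H as (u & v & _ & _ & k1 & k2 & k3).
  destruct (Hdelta (u, v)) as [D1 D2].
  destruct (Rle_lt_dec (Cmod (u, v)) 1) as [h|h].
  - apply (D1 h); assumption.
  - pose proof (Cmod_close z (u, v) _ k1 k2) as K. apply Rabs_def2 in K. lra.
Qed.

(** * Decay of the weights *)

Lemma W_le c c' b n : c' <= c -> W c b n <= W c' b n.
Proof.
  intros h. unfold W. assert (0 < Rpower (INR (S n)) b) by apply exp_pos.
  assert (- c * Rpower (INR (S n)) b <= - c' * Rpower (INR (S n)) b) by nra.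
  destruct (Rle_lt_or_eq_dec _ _ H0) as [L|L]; [left; apply exp_increasing; auto|right; now rewrite L].
Qed.

Lemma exp_le_compat x y : x <= y -> exp x <= exp y.
Proof. intros [h|h]; [left; apply exp_increasing; auto|right; now rewrite h]. Qed.

Lemma inv_pow_exp s n : 0 < s <= 1 -> (/ (1 + s)) ^ n <= exp (1 / 2) * exp (- (s / 2) * INR (S n)).
Proof.
  intros hs.
  assert (K : exp (s / 2) <= 1 + s).
  { assert (E : exp (s / 2) * exp (- (s / 2)) = 1) by (rewrite <- exp_plus, Rplus_opp_r; apply exp_0).
    pose proof (exp_ineq1_le (- (s / 2))) as h. pose proof (exp_pos (s / 2)).

    apply Rmult_le_reg_r with (1 - s / 2); [lra|]. nra. }
  assert (K2 : / (1 + s) <= exp (- (s / 2))).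
  { rewrite exp_Ropp. apply Rinv_le_contravar; auto. apply exp_pos. }
  apply Rle_trans with (exp (- (s / 2)) ^ n).
  - apply pow_incr. split; auto. left; apply Rinv_0_lt_compat; lra.
    rewrite <- Rpower_pow by apply exp_pos. unfold Rpower. rewrite ln_exp, <- exp_plus.
    apply exp_le_compat. rewrite S_INR. nra.
Qed.

Lemma Rpower_ge_1_le x b : 1 <= x -> b <= 1 -> Rpower x b <= x.
Proof.
  intros hx hb. rewrite <- (Rpower_1 x) at 2 by lra.
  destruct hx as [hx|<-].
  - unfold Rpower. apply exp_le_compat.
    assert (0 < ln x) by (rewrite <- ln_1; apply ln_increasing; lra). nra.
  - unfold Rpower. rewrite ln_1, !Rmult_0_r. lra.
Qed.

Lemma geom_W s b n : 0 < s <= 1 -> b <= 1 -> (/ (1 + s)) ^ n <= exp (1 / 2) * W (s / 2) b n.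
Proof.
  intros hs hb. eapply Rle_trans; [apply inv_pow_exp; auto|].
  apply Rmult_le_compat_l; [left; apply exp_pos|]. apply exp_le_compat.
  pose proof (Rpower_ge_1_le (INR (S n)) b (INR_S_ge1 n) hb). nra.
Qed.

(** The competition between [exp (- C s^(-k))] and [(1+s)^(-n)]: the worst [s]
  is of the order of [n^(-1/(k+1))]. *)
Lemma flat_W k C s n : 0 < k -> 0 < C -> 0 < s <= 1 ->
  exp (- C * Rpower s (- k)) * (/ (1 + s)) ^ n <= exp (1 / 2) * W (Rmin (1 / 2) C) (k / (k + 1)) n.
Proof.
  intros hk hC hs.
  assert (hC0 : 0 < exp (- C * Rpower s (- k))) by apply exp_pos.
  eapply Rle_trans; [apply Rmult_le_compat_l; [lra|apply inv_pow_exp; auto]|].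
  replace (exp (- C * Rpower s (- k)) * (exp (1 / 2) * exp (- (s / 2) * INR (S n)))) with
    (exp (1 / 2) * (exp (- C * Rpower s (- k)) * exp (- (s / 2) * INR (S n)))) by ring.
  apply Rmult_le_compat_l; [left; apply exp_pos|].
  rewrite <- exp_plus. unfold W. apply exp_le_compat.
  set (x := INR (S n)). assert (hx : 0 < x) by apply INR_S_pos.
  set (m := Rmin (1 / 2) C). assert (m1 : m <= 1 / 2) by apply Rmin_l. assert (m2 : m <= C) by apply Rmin_r.

  set (y := Rpower x (k / (k + 1))). assert (hy : 0 < y) by apply exp_pos.
  set (q := Rpower s (- k)). assert (hq : 0 < q) by apply exp_pos.
  destruct (Rle_lt_dec (Rpower x (- (1 / (k + 1)))) s) as [h|h].
  - assert (y <= x * s).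
    { unfold y. replace (k / (k + 1)) with (1 + - (1 / (k + 1))) by (field; lra).
      rewrite Rpower_plus, Rpower_1 by auto. apply Rmult_le_compat_l; lra. }
    nra.
  - assert (y <= q).
    { unfold y, q. replace (k / (k + 1)) with ((- (1 / (k + 1))) * (- k)) by (field; lra).
      rewrite <- Rpower_mult. unfold Rpower at 1 3. apply exp_le_compat.
      assert (ln s <= ln (Rpower x (- (1 / (k + 1))))) by (apply ln_le; lra).
      nra. }
    nra.
Qed.

(** * From a flat extension to the Gevrey class *)

Lemma dbar_iter_ext (U : C -> Prop) p F f : open U -> smooth U F -> (forall z, U z -> F z = f z) ->
  forall z, U z -> Nat.iter p dbar F z = Nat.iter p dbar f z.
Proof. intros hU HF E z hz. rewrite !dbar_wd. apply (wd_ext' _ U); auto. Qed.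

Lemma pcomp_ext (U : C -> Prop) N j F f : open U -> smooth U F -> (forall z, U z -> F z = f z) ->
  forall z, U z -> pcomp N F j z = pcomp N f j z.
Proof.
  intros hU HF E z hz. unfold pcomp, polypart. apply csum_ext. intros l _.
  rewrite <- !Nat.iter_add. now rewrite (dbar_iter_ext U (l + j) F f).
Qed.

Lemma smooth_pcomp U N j F : open U -> smooth U F -> smooth U (pcomp N F j).
Proof.
  intros hU HF n. apply Cn_polypart; auto. apply Cn_dbar_iter; auto.
Qed.

Lemma cfac_le l : Cmod (cfac l) <= 1.
Proof.
  unfold cfac. rewrite Cmod_R. unfold Rdiv. rewrite Rabs_mult, pow_1_abs, Rmult_1_l.
  pose proof (inv_fact_bounds l). rewrite Rabs_right; lra.
Qed.

(** Decay of the Taylor coefficients of a holomorphic function with an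
  extension [h] for which [dbar h] is flat on the unit circle. *)
Lemma coef_decay_of_flat h k K C2 R : 0 < k -> 0 < C2 -> 0 <= K -> 1 < R <= 2 ->
  Cn 1 (disk R) h -> (forall z, unit_disk z -> dbar h z = 0%C) ->
  (forall z, 1 < Cmod z < R -> Cmod (dbar h z) <= K * exp (- C2 * Rpower (Cmod z - 1) (- k))) ->
  exists C0 c, 0 < C0 /\ 0 < c /\ forall n, Cmod (coef h n) <= C0 * W c (k / (k + 1)) n.
Proof.
  intros hk hC2 hK hR Hh Hd Hflat. pose proof (open_diskr R) as hU.
  set (R1 := (1 + R) / 2). assert (hR1 : 1 < R1 < R) by (unfold R1; lra).
  assert (HD : forall r, 0 < r < R -> forall s, disk R (circ r s)).
  { intros r hr s. unfold disk. rewrite Cmod_circ; lra. }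
  pose (D := fun n r => cint (fun s => RtoC 2 * (Cconj (cis s) *
       (dbar h (circ r s) * (/ circ r s) ^ n)))%C).
  assert (HDer : forall n r, 0 < r < R -> cderive (ecoef h n) r (D n r)).
  { intros n r hr. apply (ecoef_derive (disk R) h n (fun r => 0 < r < R)); auto.
    - apply open_Ioo.
    - intros; lra. }
  assert (Hcd : forall n r, 0 < r < R -> forall s, continuous (fun s => (RtoC 2 * (Cconj (cis s) *
       (dbar h (circ r s) * (/ circ r s) ^ n)))%C) s).
  { intros n r hr s. apply continuous_Cmult; [apply continuous_const|].
    apply continuous_Cmult; [|apply continuous_Cmult].
    - apply continuous_C_iff; split; simpl.
      + apply (proj1 (proj1 (continuous_C_iff _ _) (continuous_cis s))).
      + apply continuous_opp_R, (proj2 (proj1 (continuous_C_iff _ _) (continuous_cis s))).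
    - apply (cont_on_circle (disk R) 0 (dbar h) r); auto. rewrite <- Lop_Zbar. apply Cn_Lop; auto.
    - apply continuous_circ_invpow; lra. }
  set (b := k / (k + 1)). assert (hb : 0 < b <= 1).
  { unfold b. split; [apply Rdiv_lt_0_compat; lra|]. apply Rmult_le_reg_r with (k + 1); [lra|].
    unfold Rdiv. rewrite Rmult_assoc, Rinv_l; lra. }
  set (c := Rmin (Rmin (1 / 2) C2) ((R1 - 1) / 2)).
  assert (hc1 : c <= Rmin (1 / 2) C2) by apply Rmin_l. assert (hc2 : c <= (R1 - 1) / 2) by apply Rmin_r.
  assert (hc : 0 < c) by (repeat apply Rmin_glb_lt; lra).
  assert (Hc : forall s, continuous (fun s => h (circ R1 s)) s).
  { apply (cont_on_circle (disk R) 1); auto. apply HD; lra. }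
  destruct (circle_cont_bounded _ Hc) as (G & hG & HG).
  pose proof PI_RGT_0 as hPI.
  set (e2 := exp (1 / 2)). assert (he2 : 0 < e2) by apply exp_pos.
  exists (4 * PI * e2 * (G + 4 * K) + 1), c.
  split; [assert (0 <= 4 * PI * e2 * (G + 4 * K))
    by (apply Rmult_le_pos; [apply Rmult_le_pos|]; lra); lra|].
  split; auto. intros n.
  assert (E1 : ecoef h n 1 = ecoef h n (1 / 2)).
  { apply Cminus_eq_0. eapply Rle_trans; [apply (mean_value (ecoef h n) (fun _ => RtoC 0) (1 / 2) 1 0); try lra|lra].
    - intros t ht. eapply cderive_val; [apply HDer; lra|]. apply cint_zero. intros s.
      rewrite Hd by (apply disk_circ; lra). ring.
    - intros t ht. eapply cderive_continuous, HDer; lra.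
    - intros; rewrite Cmod_0; lra. }
  set (M := 8 * PI * (K * (e2 * W c b n))).
  assert (hW : 0 < W c b n) by apply W_pos.
  assert (hM : 0 <= M) by (unfold M; apply Rmult_le_pos; [lra|]; apply Rmult_le_pos; [lra|]; apply Rmult_le_pos; lra).
  assert (E2 : Cmod (ecoef h n R1 - ecoef h n 1) <= 2 * M * (R1 - 1)).
  { (* the bound on [dbar h] holds for [|z| > 1] only, and the value of the
      derivative at the endpoint [t = 1] is irrelevant *)
    apply (mean_value (ecoef h n) (fun t => if Rlt_dec 1 t then D n t else RtoC 0)); try lra.
    - intros t ht. destruct (Rlt_dec 1 t); [|lra]. apply HDer; lra.
    - intros t ht. eapply cderive_continuous, HDer; lra.
    - intros t ht. destruct (Rlt_dec 1 t) as [h1|h1]; [|rewrite Cmod_0; auto].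
      unfold D. replace M with (4 * PI * (2 * (K * (e2 * W c b n)))) by (unfold M; ring).
      apply cint_bound; [apply Hcd; lra|]. intros s _.
      rewrite !Cmod_mult, Cmod_conj, Cmod_cis, Cmod_R, Rabs_right by lra.
      rewrite Cmod_pow, Cmod_inv, Cmod_circ by (try apply circ_nz; lra).
      rewrite Rmult_1_l. apply Rmult_le_compat_l; [lra|].
      assert (B : Cmod (dbar h (circ t s)) <= K * exp (- C2 * Rpower (t - 1) (- k))).
      { replace t with (Cmod (circ t s)) at 2 by (apply Cmod_circ; lra). apply Hflat.
        rewrite Cmod_circ; lra. }
      pose proof (flat_W k C2 (t - 1) n hk hC2 ltac:(unfold R1 in ht; lra)) as Fl.
      replace (1 + (t - 1)) with t in Fl by ring.
      assert (hp : 0 <= (/ t) ^ n) by (apply pow_le; left; apply Rinv_0_lt_compat; lra).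
      apply Rle_trans with (K * exp (- C2 * Rpower (t - 1) (- k)) * (/ t) ^ n).
      + apply Rmult_le_compat_r; auto.
      + rewrite Rmult_assoc. apply Rmult_le_compat_l; auto.
        eapply Rle_trans; [exact Fl|]. apply Rmult_le_compat_l; [lra|]. apply W_le; auto. }
  assert (E3 : Cmod (ecoef h n R1) <= 4 * PI * (G * (e2 * W c b n))).
  { eapply Rle_trans; [apply (ecoef_bound h n R1 G); auto; lra|].
    apply Rmult_le_compat_l; [lra|]. apply Rmult_le_compat_l; auto.
    pose proof (geom_W (R1 - 1) b n ltac:(unfold R1; lra) (proj2 hb)) as Ge.
    replace (1 + (R1 - 1)) with R1 in Ge by ring.
    eapply Rle_trans; [exact Ge|]. apply Rmult_le_compat_l; [lra|]. apply W_le; auto. }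
  unfold coef. rewrite Cmod_div by apply RtoC_2PI_nz.
  rewrite Cmod_R, (Rabs_right (2 * PI)) by lra. rewrite <- E1.
  assert (h2PI : 1 <= 2 * PI) by (pose proof PI2_1; lra).
  apply Rle_trans with (Cmod (ecoef h n 1)).
  { pose proof (Cmod_ge_0 (ecoef h n 1)). apply Rmult_le_reg_r with (2 * PI); [lra|].
    unfold Rdiv. rewrite Rmult_assoc, Rinv_l by lra. nra. }
  pose proof (Cmod_triangle (ecoef h n R1) (- (ecoef h n R1 - ecoef h n 1))) as T.
  rewrite Cmod_opp in T.
  replace (ecoef h n R1 + - (ecoef h n R1 - ecoef h n 1))%C with (ecoef h n 1) in T by ring.
  assert (E4 : 2 * M * (R1 - 1) <= M).
  { assert (R1 - 1 <= 1 / 2) by (unfold R1; lra). nra. }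
  apply Rle_trans with (4 * PI * (G * (e2 * W c b n)) + M); [lra|].
  unfold M. set (w := W c b n) in *.
  assert (0 <= PI * (K * (e2 * w))) by (apply Rmult_le_pos; [lra|]; apply Rmult_le_pos; [lra|]; apply Rmult_le_pos; lra).
  replace ((4 * PI * e2 * (G + 4 * K) + 1) * w) with
    (4 * PI * (G * (e2 * w)) + 16 * (PI * (K * (e2 * w))) + w) by ring.
  lra.
Qed.

(** Finitely many pairs of constants can be replaced by a common one. *)
Lemma uniform_constants (N : nat) (P : nat -> R -> R -> Prop) :
  (forall j A c A' c', P j A c -> A <= A' -> 0 < c' <= c -> P j A' c') ->
  (forall j, (j < N)%nat -> exists A c, 0 < A /\ 0 < c /\ P j A c) ->
  exists A c, 0 < A /\ 0 < c /\ forall j, (j < N)%nat -> P j A c.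
Proof.
  intros Hm. induction N as [|N IH]; intros H.
  - exists 1, 1. repeat split; try lra; intros; lia.
  - destruct IH as (A & c & hA & hc & HP); [intros; apply H; lia|].
    destruct (H N ltac:(lia)) as (A' & c' & hA' & hc' & HP').
    exists (Rmax A A'), (Rmin c c'). split; [|split].
    + eapply Rlt_le_trans; [exact hA|apply Rmax_l].
    + apply Rmin_glb_lt; auto.
    + intros j hj. assert (0 < Rmin c c') by (apply Rmin_glb_lt; auto).
      destruct (Nat.eq_dec j N) as [->|hj'].
      * apply (Hm _ _ _ _ _ HP'); [apply Rmax_r|split; [auto|apply Rmin_r]].
      * apply (Hm _ A c); [apply HP; lia|apply Rmax_l|split; [auto|apply Rmin_l]].
Qed.

Lemma gevrey_of_flat_extension N k f : (1 <= N)%nat -> 0 < k -> polyanalytic N f ->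
  (exists (U : C -> Prop) (F : C -> C) (C1 C2 : R),
     open U /\ (forall z, closure unit_disk z -> U z) /\ smooth U F /\
     0 < C1 /\ 0 < C2 /\ (forall z, unit_disk z -> F z = f z) /\ dbar_flat N k C1 C2 U F) ->
  gevrey_polyanalytic N k f.
Proof.
  intros hN hk Hf (U & F & C1 & C2 & hU & HU & HF & hC1 & hC2 & HFf & Hflat).
  destruct (neighbourhood_disk U hU) as (R & hR & HR).
  { intros z hz. apply HU, closure_disk_iff; auto. }
  assert (HF' : smooth (disk R) F).
  { intros n. apply (Cn_sub n U); auto. }
  assert (HFD : smooth unit_disk F).
  { intros n. apply (Cn_sub n U); auto. intros z hz. apply HR. unfold unit_disk in hz. lra. }
  pose proof (open_diskr R) as hU'. pose proof open_disk as hD.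
  destruct (uniform_constants N (fun j A c => forall n,
    Cmod (coef (pcomp N f j) n) <= A * W c (k / (k + 1)) n)) as (A & c & hA & hc & HP).
  - intros j A c A' c' H h1 h2 n. eapply Rle_trans; [apply H|].
    pose proof (W_pos c (k / (k + 1)) n). pose proof (W_le c c' (k / (k + 1)) n (proj2 h2)).
    pose proof (Cmod_ge_0 (coef (pcomp N f j) n)). specialize (H n).
    assert (0 <= A) by (apply Rmult_le_reg_r with (W c (k / (k + 1)) n); lra).
    apply Rmult_le_compat; lra.
  - intros j hj.
    destruct (coef_decay_of_flat (pcomp N F j) k (2 ^ (N - j - 1) * C1) C2 R) as (C0 & c & h1 & h2 & H); auto.
    + apply Rmult_le_pos; [apply pow_le; lra|lra].
    + apply smooth_pcomp; auto.
    + intros z hz. rewrite (dbar_pcomp N unit_disk) by auto.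
      rewrite (dbar_iter_ext unit_disk N F f) by auto.
      rewrite (proj2 Hf z hz). ring.
    + intros z hz. rewrite (dbar_pcomp N (disk R)) by (auto; unfold disk; lra).
      rewrite !Cmod_mult, Cmod_pow, Cmod_conj.
      assert (B : Cmod (Nat.iter N dbar F z) <= C1 * exp (- C2 * Rpower (Cmod z - 1) (- k))).
      { apply Hflat; [apply HR; lra|]. rewrite closure_disk_iff. lra. }
      assert (P : Cmod z ^ (N - j - 1) <= 2 ^ (N - j - 1)) by (apply pow_incr; lra).
      assert (0 <= Cmod z ^ (N - j - 1)) by (apply pow_le; lra).
      pose proof (cfac_le (N - j - 1)). pose proof (Cmod_ge_0 (cfac (N - j - 1))).
      pose proof (Cmod_ge_0 (Nat.iter N dbar F z)).
      rewrite (Rmult_assoc (2 ^ (N - j - 1))).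
      rewrite <- (Rmult_1_l (2 ^ (N - j - 1) * _)).
      apply Rmult_le_compat; auto; [apply Rmult_le_pos; auto|].
      apply Rmult_le_compat; auto.
    + exists C0, c. split; [auto|split; [auto|]]. intros n.
      rewrite <- (coef_ext (pcomp N F j) (pcomp N f j)); auto.
      intros z hz. apply (pcomp_ext unit_disk); auto.
  - apply (gevrey_of_decay N k f A c); auto.
Qed.

(** * From the Gevrey class to decay of the coefficients *)

Lemma smooth_dbar_iter U l G : open U -> smooth U G -> smooth U (Nat.iter l dbar G).
Proof. intros hU H n. apply Cn_dbar_iter; auto. Qed.

(** Powers of [conj(z)] are constants for [d/dz]. *)
Lemma wd_dz_zbar (U : C -> Prop) m c l g z : open U -> smooth U g -> U z ->
  wd (repeat lZ m) (fun y => c * (Cconj y ^ l * g y))%C z =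
  (c * (Cconj z ^ l * wd (repeat lZ m) g z))%C.
Proof.
  intros hU. revert g z; induction m as [|m IH]; intros g z hg hz; [reflexivity|].
  simpl. rewrite <- IH; auto using smooth_Lop.
  assert (s1 : smooth U (fun y => Cconj y ^ l * g y)%C) by (apply smooth_mult; auto using smooth_zbarpow).
  apply (wd_ext' _ U); auto.
  - apply smooth_Lop; auto. apply smooth_mult; auto using smooth_const.
  - intros y hy.
    rewrite (Lop_scal lZ c (fun y => Cconj y ^ l * g y)%C) by (apply (Cn_diff 0 U); auto).
    rewrite (Lop_mult lZ (fun y => Cconj y ^ l)%C g).
    + rewrite Lop_zbarpow, lzbar_Z. ring.
    + apply (Cn_diff 0 U); auto. apply smooth_zbarpow; auto.
    + apply (Cn_diff 0 U); auto.
Qed.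

Lemma letters_Z_norm l : l = lZ \/ l = lZbar -> Cmod (fst l) + Cmod (snd l) <= 1.
Proof.
  assert (h : Cmod (RtoC (1 / 2)) = 1 / 2) by (rewrite Cmod_R, Rabs_right; lra).
  intros [->| ->]; unfold lZ, lZbar; simpl fst; simpl snd;
    rewrite ?Cmod_opp, Cmod_mult, Cmod_Ci, h; lra.
Qed.

(** Applied to the terms of [H_j], [(d/dz)^m] leaves words of length at most [m + N]
  in [f]. *)
Lemma dz_pcomp_bound N f j m M : (j < N)%nat -> smooth unit_disk f -> 0 <= M ->
  (forall a1 a2, (a1 + a2 <= m + N)%nat -> forall z, unit_disk z -> Cmod (dalpha a1 a2 f z) <= M) ->
  forall z, unit_disk z -> Cmod (wd (repeat lZ m) (pcomp N f j) z) <= INR N * M.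
Proof.
  intros hj Hs hM HM z hz. pose proof open_disk as hU. unfold pcomp, polypart.
  set (G := Nat.iter j dbar f). assert (HG : smooth unit_disk G) by (apply smooth_dbar_iter; auto).
  assert (HGl : forall l, smooth unit_disk (Nat.iter l dbar G)) by (intros; apply smooth_dbar_iter; auto).
  rewrite (wd_csum (repeat lZ m) unit_disk (fun l y => cfac l * (Cconj y ^ l * Nat.iter l dbar G y))%C); auto.
  2:{ intros l _. apply smooth_mult; auto using smooth_const. apply smooth_mult; auto using smooth_zbarpow. }
  apply Rle_trans with (INR (N - j) * M).
  - apply csum_bound_const. intros l hl.
    rewrite (wd_dz_zbar unit_disk); auto.
    rewrite !Cmod_mult, Cmod_pow, Cmod_conj.
    assert (B : Cmod (wd (repeat lZ m) (Nat.iter l dbar G) z) <= M).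
    { unfold G. rewrite <- Nat.iter_add, dbar_wd, <- wd_app.
      assert (hlen : length (repeat lZbar (l + j) ++ repeat lZ m) = (l + j + m)%nat)
        by (rewrite length_app, !repeat_length; reflexivity).
      apply (words_bound unit_disk M); auto.
      - intros a1 a2 ha y hy. apply HM; auto. lia.
      - intros l' hl'. apply letters_Z_norm. apply in_app_or in hl'.
        destruct hl' as [h|h]; apply repeat_spec in h; auto. }
    pose proof (cfac_le l). pose proof (Cmod_ge_0 (cfac l)).
    assert (P : Cmod z ^ l <= 1).
    { rewrite <- (pow1 l). apply pow_incr. split; [apply Cmod_ge_0|left; exact hz]. }
    assert (0 <= Cmod z ^ l) by (apply pow_le, Cmod_ge_0).
    pose proof (Cmod_ge_0 (wd (repeat lZ m) (Nat.iter l dbar G) z)).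
    rewrite <- (Rmult_1_l M). apply Rmult_le_compat; auto; [apply Rmult_le_pos; auto|].
    rewrite <- (Rmult_1_l M). apply Rmult_le_compat; auto.
  - apply Rmult_le_compat_r; auto. apply le_INR; lia.
Qed.

(** ** Growth of [s^(gamma s)] *)

Lemma Rpower_base_le x y a : 0 < x <= y -> 0 <= a -> Rpower x a <= Rpower y a.
Proof.
  intros h ha. unfold Rpower. apply exp_le_compat. apply Rmult_le_compat_l; auto. apply ln_le; lra.
Qed.

Lemma Rpower_exp_le x a b : 1 <= x -> a <= b -> Rpower x a <= Rpower x b.
Proof.
  intros hx hab. unfold Rpower. apply exp_le_compat. apply Rmult_le_compat_r; auto.
  rewrite <- ln_1. apply ln_le; lra.
Qed.

Lemma Rpower_0_0 a : Rpower (INR 0) (a * INR 0) = 1.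
Proof. unfold Rpower. rewrite Rmult_0_r, Rmult_0_l. apply exp_0. Qed.

Lemma gevrey_seq_mono g s t : 0 < g -> (s <= t)%nat -> (1 <= t)%nat ->
  Rpower (INR s) (g * INR s) <= Rpower (INR t) (g * INR t).
Proof.
  intros hg hst ht. assert (h1 : 1 <= INR t) by (apply (le_INR 1); auto).
  destruct s as [|s].
  - rewrite Rpower_0_0, <- (Rpower_O (INR t)) by lra. apply Rpower_exp_le; auto. nra.
  - assert (hs : 1 <= INR (S s)) by apply INR_S_ge1.
    assert (hst' : INR (S s) <= INR t) by (apply le_INR; auto).
    apply Rle_trans with (Rpower (INR (S s)) (g * INR t)).
    + apply Rpower_exp_le; auto. nra.
    + apply Rpower_base_le; [lra|nra].
Qed.

Lemma ln_le_id x : 0 < x -> ln x <= x.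
Proof.
  intros hx. rewrite <- (ln_exp x) at 2. apply ln_le; auto.
  pose proof (exp_ineq1_le x). lra.
Qed.

(** Replacing [m] by [m + N] in [m^(g m)] costs a geometric factor in [m]. *)
Lemma gevrey_seq_shift g N m : 0 < g ->
  Rpower (INR (m + N)) (g * INR (m + N)) <=
  Rpower (INR (S N)) (g * INR N) * (Rpower (INR (S N)) g * exp (g * INR N)) ^ m *
  Rpower (INR m) (g * INR m).
Proof.
  intros hg. assert (hN : 1 <= INR (S N)) by apply INR_S_ge1.
  destruct m as [|m].
  - rewrite Rpower_0_0. rewrite pow_O, !Rmult_1_r, Nat.add_0_l.
    destruct N as [|N].
    + rewrite Rpower_0_0. unfold Rpower. rewrite Rmult_0_r, Rmult_0_l, exp_0. lra.
    + pose proof (INR_S_ge1 N). apply Rpower_base_le; [|nra]. rewrite (S_INR (S N)). lra.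
  - set (x := INR (S m)). assert (hx : 1 <= x) by apply INR_S_ge1.
    pose proof (pos_INR N) as hN0.
    assert (hsum : INR (S m + N) <= x * INR (S N)).
    { rewrite plus_INR, (S_INR N). fold x. nra. }
    assert (hsum0 : 1 <= INR (S m + N)) by (rewrite plus_INR; fold x; lra).
    eapply Rle_trans; [apply (Rpower_base_le _ (x * INR (S N))); [lra|nra]|].
    rewrite plus_INR. fold x. rewrite <- Rpower_mult_distr by lra.
    rewrite !Rmult_plus_distr_l, !Rpower_plus.
    rewrite Rpow_mult_distr.
    rewrite <- (Rpower_pow (S m) (Rpower (INR (S N)) g)) by apply exp_pos.
    rewrite <- (Rpower_pow (S m) (exp (g * INR N))) by apply exp_pos.
    rewrite Rpower_mult. fold x.
    assert (K : Rpower x (g * INR N) <= Rpower (exp (g * INR N)) x).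
    { unfold Rpower. rewrite ln_exp. apply exp_le_compat. pose proof (ln_le_id x ltac:(lra)).
      rewrite (Rmult_comm x). apply Rmult_le_compat_l; [nra|auto]. }
    set (a := Rpower x (g * x)). set (b := Rpower x (g * INR N)) in *.
    set (c := Rpower (INR (S N)) (g * x)). set (d := Rpower (INR (S N)) (g * INR N)).
    set (e := Rpower (exp (g * INR N)) x) in *.
    assert (0 < a) by apply exp_pos. assert (0 < c) by apply exp_pos. assert (0 < d) by apply exp_pos.
    replace (a * b * (c * d)) with ((a * c * d) * b) by ring.
    replace (d * (c * e) * a) with ((a * c * d) * e) by ring.
    apply Rmult_le_compat_l; auto. left. repeat apply Rmult_lt_0_compat; auto.
Qed.

Lemma rising_ge n m x : 0 <= x <= INR (S n) -> x ^ m <= rising n m.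
Proof.
  intros hx. induction m as [|m IH]; [simpl; lra|].
  cbn [rising]. simpl pow. rewrite Rmult_comm.
  assert (INR (S n) <= INR (S (n + m))) by (apply le_INR; lia).
  apply Rmult_le_compat; try lra. apply pow_le; lra.
Qed.

(** The hypothesis is Cauchy's estimate for the [m]-th derivative.  For the
  coefficient of index [p], [m] is chosen of the order of [p^(k/(k+1))]. *)
Lemma coef_decay_of_bounds (a : nat -> C) k A Q : 0 < k -> 0 < A -> 1 <= Q ->
  (forall n m, rising n m * Cmod (a (n + m)%nat) <= A * Q ^ m * Rpower (INR m) ((1 + 1 / k) * INR m)) ->
  exists C0 c, 0 < C0 /\ 0 < c /\ forall n, Cmod (a n) <= C0 * W c (k / (k + 1)) n.
Proof.
  intros hk hA hQ H.
  set (b := k / (k + 1)). set (g := 1 + 1 / k) in *.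
  assert (hg : 0 < g) by (unfold g; assert (0 < 1 / k) by (apply Rdiv_lt_0_compat; lra); lra).

  assert (hb1 : b <= 1).
  { unfold b. apply Rmult_le_reg_r with (k + 1); [lra|]. unfold Rdiv. rewrite Rmult_assoc, Rinv_l; lra. }
  assert (hbg : b * g = 1) by (unfold b, g; field; lra).
  set (e1 := exp 1). assert (he1 : 1 <= e1) by (unfold e1; pose proof (exp_ineq1_le 1); lra).
  assert (hQe : 1 <= Q * e1) by nra.
  exists (A * e1), (Rpower (/ (2 * (Q * e1))) b).
  split; [nra|]. split; [apply exp_pos|]. intros p.
  set (x := INR (S p) / 2). assert (hx : 0 < x) by (unfold x; pose proof (INR_S_pos p); lra).
  set (y := x / (Q * e1)). assert (hy : 0 < y) by (apply Rdiv_lt_0_compat; lra).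
  assert (hyx : y <= x).
  { unfold y. apply Rmult_le_reg_r with (Q * e1); [lra|]. unfold Rdiv. rewrite Rmult_assoc, Rinv_l by lra. nra. }
  set (t := Rpower y b). assert (ht : 0 < t) by apply exp_pos.
  assert (EW : W (Rpower (/ (2 * (Q * e1))) b) b p = exp (- t)).
  { unfold W. f_equal. unfold t, y, x.
    replace (INR (S p) / 2 / (Q * e1)) with (/ (2 * (Q * e1)) * INR (S p)) by (field; nra).
    rewrite <- Rpower_mult_distr; [ring| |apply INR_S_pos].
    apply Rinv_0_lt_compat; lra. }
  rewrite EW.
  (* [m] is the integer part of [t = y^b], hence [m^g <= y] where [b g = 1]; as
    [Q y = x / e], the bound for [x^m |a_p|] becomes [A (x / e)^m] *)
  destruct (nfloor_ex t ltac:(lra)) as (m & hm1 & hm2).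
  assert (Kexp : exp (- INR m) <= e1 * exp (- t)).
  { unfold e1. rewrite <- exp_plus. apply exp_le_compat. lra. }
  enough (G : Cmod (a p) <= A * exp (- INR m)).
  { eapply Rle_trans; [exact G|]. rewrite Rmult_assoc. apply Rmult_le_compat_l; lra. }
  destruct m as [|m].
  - specialize (H p 0%nat). rewrite Rpower_0_0, Nat.add_0_r in H. simpl in H.
    simpl INR. rewrite Ropp_0, exp_0. lra.
  - assert (hm : 1 <= INR (S m)) by apply INR_S_ge1.
    assert (hy1 : 1 <= y).
    { apply Rnot_lt_le. intros h. assert (ln y < 0) by (rewrite <- ln_1; apply ln_increasing; lra).
      assert (t < 1). { unfold t, Rpower. rewrite <- exp_0. apply exp_increasing. nra. } lra. }
    assert (hty : t <= y) by (apply Rpower_ge_1_le; auto).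
    assert (hmx : INR (S m) <= x) by lra.
    assert (hmp : (2 * S m <= S p)%nat).
    { apply INR_le. rewrite mult_INR. simpl (INR 2). unfold x in hmx. lra. }
    specialize (H (p - S m)%nat (S m)). replace (p - S m + S m)%nat with p in H by lia.
    assert (hr : x ^ S m <= rising (p - S m) (S m)).
    { apply rising_ge. split; [lra|]. replace (S (p - S m)) with (S p - S m)%nat by lia.
      rewrite minus_INR by lia. unfold x in *. lra. }
    assert (hxm : 0 < x ^ S m) by (apply pow_lt; auto).
    pose proof (Cmod_ge_0 (a p)) as ha.
    apply Rmult_le_reg_l with (x ^ S m); auto.
    apply Rle_trans with (rising (p - S m) (S m) * Cmod (a p)).
    { apply Rmult_le_compat_r; auto. }
    eapply Rle_trans; [exact H|].
    assert (K1 : Rpower (INR (S m)) (g * INR (S m)) <= y ^ S m).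
    { rewrite <- Rpower_mult, Rpower_pow by apply exp_pos. apply pow_incr.
      split; [left; apply exp_pos|].
      apply Rle_trans with (Rpower t g); [apply Rpower_base_le; lra|].
      unfold t. rewrite Rpower_mult, hbg, Rpower_1 by auto. lra. }
    apply Rle_trans with (A * Q ^ S m * y ^ S m).
    { apply Rmult_le_compat_l; auto. apply Rmult_le_pos; [lra|apply pow_le; lra]. }
    right. replace (exp (- INR (S m))) with ((/ e1) ^ S m).
    2:{ unfold e1. rewrite <- exp_Ropp, <- Rpower_pow by apply exp_pos.
        unfold Rpower. rewrite ln_exp. f_equal. ring. }
    rewrite Rmult_assoc, <- Rpow_mult_distr.
    replace (Q * y) with (x * / e1) by (unfold y; field; lra).
    rewrite Rpow_mult_distr. ring.
Qed.

(** Cauchy's estimates for the derivatives [(d/dz)^m] of the components. *)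
Lemma coef_decay_of_gevrey N k f j : (1 <= N)%nat -> 0 < k -> gevrey_polyanalytic N k f -> (j < N)%nat ->
  exists C0 c, 0 < C0 /\ 0 < c /\
    forall n, Cmod (coef (pcomp N f j) n) <= C0 * W c (k / (k + 1)) n.
Proof.
  intros hN hk [Hf (B & hB & HB)] hj.
  set (g := 1 + 1 / k) in *.
  assert (hg : 0 < g) by (unfold g; assert (0 < 1 / k) by (apply Rdiv_lt_0_compat; lra); lra).
  set (B1 := B + 1).
  assert (Hs : smooth unit_disk f) by (apply (polyanalytic_smooth N); auto).
  assert (Hh : holomorphic (pcomp N f j)) by (apply pcomp_holomorphic; auto).
  assert (Hhs : smooth unit_disk (pcomp N f j)) by (apply holomorphic_smooth; auto).
  assert (hN' : 1 <= INR N) by (apply (le_INR 1); auto).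
  assert (HD : forall m a1 a2, (a1 + a2 <= m + N)%nat -> forall z, unit_disk z ->
    Cmod (dalpha a1 a2 f z) <= B1 ^ (m + N + 1) * Rpower (INR (m + N)) (g * INR (m + N))).
  { intros m a1 a2 ha z hz. eapply Rle_trans; [apply (sup_norm_ge unit_disk _ _ z (HB a1 a2) hz)|].
    apply Rmult_le_compat.
    - apply pow_le; lra.
    - left; apply exp_pos.
    - apply Rle_trans with (B1 ^ (a1 + a2 + 1)).
      + apply pow_incr. unfold B1; lra.
      + apply Rle_pow; [unfold B1; lra|lia].
    - apply gevrey_seq_mono; auto. lia. }
  set (P := Rpower (INR (S N)) g * exp (g * INR N)).
  set (A := 2 * (INR N * (B1 ^ (N + 1) * Rpower (INR (S N)) (g * INR N)))).
  assert (hP : 1 <= P).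
  { unfold P. rewrite <- (Rmult_1_l 1). apply Rmult_le_compat; try lra.
    - rewrite <- (Rpower_O (INR (S N))) by apply INR_S_pos. apply Rpower_exp_le; [apply INR_S_ge1|lra].
    - rewrite <- exp_0 at 1. apply exp_le_compat. nra. }
  apply (coef_decay_of_bounds (coef (pcomp N f j)) k A (B1 * P)); auto.
  - unfold A. apply Rmult_lt_0_compat; [lra|]. apply Rmult_lt_0_compat; [lra|].
    apply Rmult_lt_0_compat; [apply pow_lt; unfold B1; lra|apply exp_pos].
  - unfold B1. nra.
  - intros n m. fold g.
    destruct (dz_iter_holomorphic m (pcomp N f j) Hhs Hh) as [H1 H2].
    assert (Hr : 0 <= rising n m).
    { eapply Rle_trans; [|apply (rising_ge n m 0)]; [apply pow_le; lra|]. split; [lra|apply pos_INR]. }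
    assert (E : rising n m * Cmod (coef (pcomp N f j) (n + m)) = Cmod (coef (wd (repeat lZ m) (pcomp N f j)) n)).
    { rewrite H2, Cmod_mult, Cmod_R, Rabs_right by lra. reflexivity. }
    rewrite E.
    set (M := B1 ^ (m + N + 1) * Rpower (INR (m + N)) (g * INR (m + N))).
    assert (hM : 0 <= M) by (apply Rmult_le_pos; [apply pow_le; unfold B1; lra|left; apply exp_pos]).
    eapply Rle_trans; [apply (coef_bound _ n (INR N * M) H1)|].
    + apply dz_pcomp_bound; auto. exact (HD m).
    + unfold A, M.
      pose proof (gevrey_seq_shift g N m hg) as K. fold P in K.
      rewrite Rpow_mult_distr. replace (m + N + 1)%nat with (N + 1 + m)%nat by lia. rewrite pow_add.
      set (X := B1 ^ (N + 1)). set (Y := B1 ^ m).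
      assert (0 <= X) by (apply pow_le; unfold B1; lra). assert (0 <= Y) by (apply pow_le; unfold B1; lra).
      set (R1 := Rpower (INR (m + N)) (g * INR (m + N))) in *. set (R2 := Rpower (INR (S N)) (g * INR N)) in *.
      set (R3 := Rpower (INR m) (g * INR m)) in *.
      replace (2 * (INR N * (X * Y * R1))) with (2 * INR N * X * Y * R1) by ring.
      replace (2 * (INR N * (X * R2)) * (Y * P ^ m) * R3) with (2 * INR N * X * Y * (R2 * P ^ m * R3)) by ring.
      apply Rmult_le_compat_l; auto. apply Rmult_le_pos; auto. apply Rmult_le_pos; lra.
Qed.

(** * A smooth cutoff function on the line *)

(** Functions on the line with [n] continuous bounded derivatives. *)
Fixpoint SB (n : nat) (f : R -> R) : Prop :=
  (forall x, continuous f x) /\ (exists M, forall x, Rabs (f x) <= M) /\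
  match n with
  | O => True
  | S m => (forall x, ex_derive f x) /\ SB m (Derive f)
  end.

Lemma SB_ext n f g : (forall x, f x = g x) -> SB n f -> SB n g.
Proof. intros E. apply functional_extensionality in E. now rewrite E. Qed.

Lemma SB_S_le n : forall f, SB (S n) f -> SB n f.
Proof.
  induction n as [|n IH]; intros f (a & b & c & d).
  - split; [|split]; auto.
  - split; [|split; [|split]]; auto.
Qed.

Lemma SB_of_derive n f f' : (forall x, is_derive f x (f' x)) -> (exists M, forall x, Rabs (f x) <= M) ->
  SB n f' -> SB (S n) f.
Proof.
  intros H HM Hf'. split; [|split; [|split]]; auto.
  - intros x. apply ex_derive_continuous_R. eexists; apply H.
  - intros x; eexists; apply H.
  - apply (SB_ext n f'); auto. intros x; symmetry; apply is_derive_unique, H.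
Qed.

Lemma SB_plus n : forall f g, SB n f -> SB n g -> SB n (fun x => f x + g x).
Proof.
  induction n as [|n IH]; intros f g (a & (M & b) & c) (a' & (M' & b') & c').
  - split; [|split; [|exact Logic.I]].
    + intros x; apply continuous_plus_R; auto.
    + exists (M + M'). intros x. eapply Rle_trans; [apply Rabs_triang|]. apply Rplus_le_compat; auto.
  - destruct c as [c d], c' as [c' d'].
    apply (SB_of_derive n _ (fun x => Derive f x + Derive g x)); auto.
    + intros x. apply is_derive_plus_R; apply Derive_correct; auto.
    + exists (M + M'). intros x. eapply Rle_trans; [apply Rabs_triang|]. apply Rplus_le_compat; auto.
Qed.

Lemma SB_mult n : forall f g, SB n f -> SB n g -> SB n (fun x => f x * g x).
Proof.
  assert (B : forall f g : R -> R, (exists M, forall x, Rabs (f x) <= M) -> (exists M, forall x, Rabs (g x) <= M) ->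
    exists M, forall x, Rabs (f x * g x) <= M).
  { intros f g [M b] [M' b']. exists (M * M'). intros x. rewrite Rabs_mult.
    apply Rmult_le_compat; auto using Rabs_pos. }
  induction n as [|n IH]; intros f g H H'.
  - destruct H as (a & b & c), H' as (a' & b' & c'). split; [|split; [|exact Logic.I]]; auto.
    intros x; apply continuous_mult_R; auto.
  - pose proof (SB_S_le _ _ H) as K. pose proof (SB_S_le _ _ H') as K'.
    destruct H as (a & b & c & d), H' as (a' & b' & c' & d').
    apply (SB_of_derive n _ (fun x => Derive f x * g x + f x * Derive g x)); auto.
    + intros x. apply is_derive_Rmult; apply Derive_correct; auto.
    + apply SB_plus; auto.
Qed.

Lemma SB_const n c : SB n (fun _ => c).
Proof.
  revert c; induction n as [|n IH]; intros c.
  - split; [|split; [|exact Logic.I]]; [intros; apply continuous_const|]. exists (Rabs c). intros; lra.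
  - apply (SB_of_derive n _ (fun _ => 0)); auto.
    + intros x. apply is_derive_const_R.
    + exists (Rabs c). intros; lra.
Qed.

Lemma SB_affine n a b : forall f, SB n f -> SB n (fun x => f (a * x + b)).
Proof.
  assert (Da : forall x, is_derive (fun x => a * x + b) x a) by (intros; auto_derive; auto; ring).
  induction n as [|n IH]; intros f (p & (M & q) & c).
  - split; [|split; [|exact Logic.I]].
    + intros x. apply (continuous_comp (fun x => a * x + b) f); auto.
      apply ex_derive_continuous_R. eexists; apply Da.
    + exists M. intros; auto.
  - destruct c as [c d].
    apply (SB_of_derive n _ (fun x => a * Derive f (a * x + b))).
    + intros x. apply (is_derive_comp_R f (fun x => a * x + b)); auto.
      apply Derive_correct; auto.
    + exists M; auto.
    + apply (SB_mult n (fun _ => a)); auto. apply SB_const.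
Qed.

(** The functions [x^(-p) exp(-1/x)] on the positive axis, extended by zero:
  their linear span is stable under differentiation. *)
Definition flatexp (p : nat) (x : R) : R :=
  if Rlt_dec 0 x then (/ x) ^ p * exp (- / x) else 0.

Lemma pow_exp_bounded p : exists K, 0 < K /\ forall y, 0 < y -> y ^ p * exp (- y) <= K.
Proof.
  destruct p as [|p].
  - exists 1. split; [lra|]. intros y hy. rewrite Rmult_1_l, <- exp_0. apply exp_le_compat; lra.
  - exists (Rpower (INR (S p)) (INR (S p))). split; [apply exp_pos|]. intros y hy.
    rewrite <- Rpower_pow by auto. apply Rpower_exp_bound; auto. apply INR_S_pos.
Qed.

Lemma flatexp_bounded p : exists K, 0 < K /\ forall x, 0 <= flatexp p x <= K.
Proof.
  destruct (pow_exp_bounded p) as (K & hK & H). exists K. split; auto. intros x.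
  unfold flatexp. destruct (Rlt_dec 0 x) as [h|h]; [|lra].
  assert (h' : 0 < / x) by (apply Rinv_0_lt_compat; auto). split; [|apply H; auto].
  apply Rmult_le_pos; [apply pow_le; lra|left; apply exp_pos].
Qed.

Lemma flatexp_derive p x :
  is_derive (flatexp p) x (- INR p * flatexp (S p) x + flatexp (S (S p)) x).
Proof.
  destruct (Rtotal_order x 0) as [h|[h|h]].
  - apply (is_derive_ext_loc (fun _ => 0)).
    + generalize (open_lt 0 x h). apply filter_imp. intros y hy. unfold flatexp.
      destruct (Rlt_dec 0 y); lra.
    + unfold flatexp. destruct (Rlt_dec 0 x); [lra|].
      replace (- INR p * 0 + 0) with 0 by ring. apply is_derive_const_R.
  - subst x. apply is_derive_Reals.
    assert (Z : forall q, flatexp q 0 = 0) by (intros q; unfold flatexp; destruct (Rlt_dec 0 0); lra).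
    rewrite !Z. replace (- INR p * 0 + 0) with 0 by ring.
    destruct (flatexp_bounded (S (S p))) as (K & hK & H).
    intros eps he. assert (hd : 0 < eps / (K + 1)) by (apply Rdiv_lt_0_compat; lra).
    exists (mkposreal _ hd). intros u hu hu2. simpl in hu2. rewrite Rplus_0_l, Z, !Rminus_0_r.
    unfold flatexp at 1. destruct (Rlt_dec 0 u) as [h'|h'].
    + replace ((/ u) ^ p * exp (- / u) / u) with (u * flatexp (S (S p)) u).
      2:{ unfold flatexp. destruct (Rlt_dec 0 u); [|lra]. simpl. field. lra. }
      specialize (H u). rewrite Rabs_mult, (Rabs_right (flatexp _ u)) by lra.
      apply Rle_lt_trans with (Rabs u * K); [apply Rmult_le_compat_l; [apply Rabs_pos|lra]|].
      apply Rle_lt_trans with (eps / (K + 1) * K); [apply Rmult_le_compat_r; lra|].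
      apply Rmult_lt_reg_r with (K + 1); [lra|]. unfold Rdiv.
      replace (eps * / (K + 1) * K * (K + 1)) with (eps * K) by (field; lra). nra.
    + unfold Rdiv. rewrite Rmult_0_l, Rabs_R0. auto.
  - apply (is_derive_ext_loc (fun y => (/ y) ^ p * exp (- / y))).
    + generalize (open_gt 0 x h). apply filter_imp. intros y hy. unfold flatexp.
      destruct (Rlt_dec 0 y); lra.
    + unfold flatexp. destruct (Rlt_dec 0 x); [|lra].
      assert (D1 : is_derive (fun y => / y) x (- 1 * (/ x) ^ 2)).
      { auto_derive; [lra|]. field. lra. }
      evar_last.
      { apply is_derive_Rmult.
        - apply (is_derive_pow (fun y => / y) p x _ D1).
        - apply (is_derive_comp_R exp (fun y => - / y)).
          + apply is_derive_exp.
          + apply is_derive_opp_R, D1. }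
      unfold scal; simpl; unfold mult; simpl. unfold opp; simpl. cbv beta.
      destruct p as [|p]; simpl; [ring|].
      change (match p with O => 1 | S _ => INR p + 1 end) with (INR (S p)). ring.
Qed.

Lemma SB_flatexp n : forall p, SB n (flatexp p).
Proof.
  assert (B : forall p, exists M, forall x, Rabs (flatexp p x) <= M).
  { intros p. destruct (flatexp_bounded p) as (K & hK & H). exists K. intros x.
    specialize (H x). rewrite Rabs_right; lra. }
  induction n as [|n IH]; intros p.
  - split; [|split; [|exact Logic.I]]; auto. intros x.
    apply ex_derive_continuous_R. eexists; apply flatexp_derive.
  - apply (SB_of_derive n _ (fun x => - INR p * flatexp (S p) x + flatexp (S (S p)) x)); auto.
    + intros x; apply flatexp_derive.
    + apply SB_plus; auto. apply (SB_mult n (fun _ => - INR p)); auto. apply SB_const.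
Qed.

(** One minus the normalized primitive of the bump
  [exp (- 1/(x-1)) exp (- 1/(2-x))] on [1 < x < 2]. *)
Lemma cutoff_exists : exists psi : R -> R, (forall n, SB n psi) /\
  (forall x, x <= 1 -> psi x = 1) /\ (forall x, 2 <= x -> psi x = 0).
Proof.
  pose (b := fun x => flatexp 0 (1 * x + -1) * flatexp 0 (-1 * x + 2)).
  assert (Hb : forall n, SB n b).
  { intros n. apply SB_mult; apply SB_affine, SB_flatexp. }
  assert (b0 : forall x, x <= 1 \/ 2 <= x -> b x = 0).
  { intros x h. unfold b, flatexp. destruct (Rlt_dec 0 (1 * x + -1)); [|ring].
    destruct (Rlt_dec 0 (-1 * x + 2)); [lra|ring]. }
  assert (bp : forall x, 1 < x < 2 -> 0 < b x).
  { intros x h. unfold b, flatexp. destruct (Rlt_dec 0 (1 * x + -1)); [|lra].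
    destruct (Rlt_dec 0 (-1 * x + 2)); [|lra]. rewrite !Rmult_1_l.
    apply Rmult_lt_0_compat; apply exp_pos. }
  assert (bc : forall x, continuous b x) by apply (Hb 0%nat).
  assert (be : forall u v, ex_RInt b u v) by (intros; apply ex_RInt_cont; auto).
  set (I := RInt b 1 2).
  assert (hI : 0 < I).
  { apply RInt_gt_0; [lra|exact bp|]. intros x _. apply bc. }
  assert (Z1 : forall x, x <= 1 -> RInt b 1 x = 0).
  { intros x hx. rewrite (RInt_ext b (fun _ => 0)).
    - rewrite RInt_const_R. unfold scal; simpl; unfold mult; simpl. ring.
    - intros y hy. rewrite Rmin_right, Rmax_left in hy by lra. apply b0. lra. }
  assert (Z2 : forall x, 2 <= x -> RInt b 1 x = I).
  { intros x hx. rewrite <- (RInt_Chasles (V := R_CompleteNormedModule) b 1 2 x) by auto.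
    rewrite (RInt_ext b (fun _ => 0) 2 x).
    - rewrite RInt_const_R. unfold scal; simpl; unfold mult; simpl.
      unfold plus; simpl. fold I. ring.
    - intros y hy. rewrite Rmin_left, Rmax_right in hy by lra. apply b0. lra. }
  exists (fun x => 1 + (- / I) * RInt b 1 x). split; [|split].
  - destruct (Hb 0%nat) as (_ & (M & HM) & _).
    assert (hM : 0 <= M) by (eapply Rle_trans; [apply Rabs_pos|apply (HM 0)]).
    assert (D : forall x, is_derive (fun x => 1 + (- / I) * RInt b 1 x) x ((- / I) * b x)).
    { intros x. evar_last.
      - apply is_derive_plus_R; [apply is_derive_const_R|].
        apply is_derive_scal. apply (is_derive_RInt (V := R_NormedModule) b (fun x => RInt b 1 x) 1 x).
        + exists (mkposreal 1 Rlt_0_1). intros y _. apply (RInt_correct (V := R_CompleteNormedModule)); auto.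
        + apply bc.
      - unfold plus, zero; simpl. ring. }
    assert (Bd : exists K, forall x, Rabs (1 + (- / I) * RInt b 1 x) <= K).
    { exists (1 + / I * (M + I)). intros x. eapply Rle_trans; [apply Rabs_triang|]. rewrite Rabs_R1.
      apply Rplus_le_compat_l. rewrite Rabs_mult, Rabs_Ropp.
      assert (hi : 0 < / I) by (apply Rinv_0_lt_compat; auto). rewrite (Rabs_right (/ I)) by lra.
      apply Rmult_le_compat_l; [lra|].
      destruct (Rle_lt_dec x 1) as [h|h]; [rewrite Z1, Rabs_R0 by lra; lra|].
      destruct (Rle_lt_dec 2 x) as [h2|h2]; [rewrite Z2, Rabs_right by lra; lra|].
      apply Rle_trans with ((x - 1) * M); [|nra].
      apply abs_RInt_le_const; [lra|auto|auto]. }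
    intros n. apply SB_S_le. apply (SB_of_derive n _ (fun x => (- / I) * b x)); auto.
    apply (SB_mult n (fun _ => - / I)); auto. apply SB_const.
  - intros x hx. rewrite Z1 by auto. ring.
  - intros x hx. rewrite Z2 by auto. field. lra.
Qed.

(** * The flat extension *)

Lemma coord_derive b b' z :
  is_derive (fun t => coord b (slice b' z t)) (coord b' z) (if Bool.eqb b b' then 1 else 0).
Proof.
  destruct b, b'; simpl; first [apply is_derive_id_R | apply is_derive_const_R].
Qed.

Lemma continuous_coord b (z : C) : continuous (coord b) z.
Proof.
  pose proof (proj1 (continuous_C_iff (fun w : C => w) z) (continuous_id z)) as [h1 h2].
  destruct b; assumption.
Qed.

Lemma coord_le b z : Rabs (coord b z) <= Cmod z.
Proof. destruct b; [apply re_le_Cmod|apply im_le_Cmod]. Qed.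

Lemma Reg_coord (Om : nat -> C -> Prop) rho N b : (forall i, open (Om i)) ->
  (forall n z, Om n z -> Cmod z <= rho) ->
  Reg (Bd Om (fun _ => 1)) Om N (fun _ z => RtoC (coord b z)).
Proof.
  intros hS hrho.
  assert (P : forall b' z, is_pd b' (fun z => RtoC (coord b z)) z (RtoC (if Bool.eqb b b' then 1 else 0))).
  { intros b' z. apply cderive_RtoC, coord_derive. }
  assert (HB : Bd Om (fun _ => 1) (fun _ z => RtoC (coord b z))).
  { exists (Rabs rho), 0%nat. split; [apply Rabs_pos|]. intros n z hz. rewrite Cmod_R.
    rewrite !Rmult_1_r. eapply Rle_trans; [apply coord_le|]. eapply Rle_trans; [eauto|apply Rle_abs]. }
  destruct N as [|N].
  - split; [|split; [exact HB|exact Logic.I]]. intros i z hz. apply continuous_RtoC, continuous_coord.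
  - split; [|split; [exact HB|split]].
    + intros i z hz. apply continuous_RtoC, continuous_coord.
    + intros i z hz. apply diff_at_is. intros b'; eexists; apply P.
    + intros b'. apply (Reg_ext (Bd Om (fun _ => 1)) Om N hS (respects_Bd Om _)
        (fun _ _ => RtoC (if Bool.eqb b b' then 1 else 0))).
      * intros i z hz. symmetry; apply is_pd_unique, P.
      * apply (Reg_Bd_const_le _ _ N _ 1); auto; try (intros; lra). intros n.
        rewrite Cmod_R. destruct (Bool.eqb b b'); [rewrite Rabs_R1|rewrite Rabs_R0]; lra.
Qed.

(** The square of the modulus, which is smooth on the whole plane. *)
Definition sqnorm (z : C) : R := Re z ^ 2 + Im z ^ 2.

Lemma sqnorm_Cmod z : sqnorm z = Cmod z ^ 2.
Proof. unfold sqnorm. now rewrite Cmod2_alt. Qed.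

Lemma continuous_sqnorm z : continuous sqnorm z.
Proof.
  apply (continuous_plus_R (fun z => Re z ^ 2) (fun z => Im z ^ 2)).
  - apply (continuous_comp Re (fun x => x ^ 2)); [apply (continuous_coord true)|].
    apply ex_derive_continuous_R. auto_derive; auto.
  - apply (continuous_comp Im (fun x => x ^ 2)); [apply (continuous_coord false)|].
    apply ex_derive_continuous_R. auto_derive; auto.
Qed.

Lemma sqnorm_derive b z : is_derive (fun t => sqnorm (slice b z t)) (coord b z) (2 * coord b z).
Proof.
  destruct b; unfold sqnorm; simpl; auto_derive; auto; ring.
Qed.

(** The cutoffs [phi ((|z|^2 - 1) / delta_n)]: each derivative costs a factor
  [1 / delta_n], which is polynomial in [n]. *)
Lemma Reg_cutoff (Om : nat -> C -> Prop) rho (delta : nat -> R) K N : (forall i, open (Om i)) ->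
  (forall n z, Om n z -> Cmod z <= rho) -> 0 <= K ->
  (forall n, 0 < delta n /\ / delta n <= K * INR (S n)) ->
  forall phi, SB N phi ->
  Reg (Bd Om (fun _ => 1)) Om N (fun n z => RtoC (phi ((sqnorm z - 1) / delta n))).
Proof.
  intros hS hrho hK hd.
  assert (HB : forall phi, (exists M, forall x, Rabs (phi x) <= M) ->
    Bd Om (fun _ => 1) (fun n z => RtoC (phi ((sqnorm z - 1) / delta n)))).
  { intros phi (M & HM). exists (Rabs M), 0%nat. split; [apply Rabs_pos|]. intros n z hz.
    rewrite Cmod_R. rewrite !Rmult_1_r. eapply Rle_trans; [apply HM|apply Rle_abs]. }
  assert (Hcont : forall phi, (forall x, continuous phi x) -> forall n z,
    continuous (fun z => RtoC (phi ((sqnorm z - 1) / delta n))) z).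
  { intros phi Hc n z. apply continuous_RtoC.
    apply (continuous_comp sqnorm (fun x => phi ((x - 1) / delta n))); [apply continuous_sqnorm|].
    apply (continuous_comp (fun x => (x - 1) / delta n) phi); auto.
    apply ex_derive_continuous_R. auto_derive. pose proof (hd n); lra. }
  induction N as [|N IH]; intros phi (Hc & HM & Hd).
  - split; [|split; [auto|exact Logic.I]]. intros; auto.
  - destruct Hd as [Hd Hs].
    assert (P : forall b n z, is_pd b (fun z => RtoC (phi ((sqnorm z - 1) / delta n))) z
      (RtoC (Derive phi ((sqnorm z - 1) / delta n)) * (RtoC (2 / delta n) * RtoC (coord b z)))%C).
    { intros b n z. rewrite <- !RtoC_mult. apply cderive_RtoC.
      evar_last.
      - apply (is_derive_comp_R phi
          (fun t => (sqnorm (slice b z t) - 1) / delta n)).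
        + apply Derive_correct, Hd.
        + apply (is_derive_ext (fun t => / delta n * (sqnorm (slice b z t) + -1))).
          { intros t. match goal with |- ?a = ?b => change (@eq R a b) end. unfold Rdiv, Rminus. ring. }
          apply is_derive_scal.
          apply is_derive_plus_R; [apply sqnorm_derive|apply is_derive_const_R].
      - rewrite slice_coord. unfold scal; simpl; unfold mult; simpl. unfold plus, zero; simpl.
        unfold Rdiv. ring. }
    split; [|split; [|split]]; auto.
    + intros i z hz. apply diff_at_is. intros b; eexists; apply P.
    + intros b. apply (Reg_ext (Bd Om (fun _ => 1)) Om N hS (respects_Bd Om _)
        (fun n z => RtoC (Derive phi ((sqnorm z - 1) / delta n)) * (RtoC (2 / delta n) * RtoC (coord b z)))%C).
      * intros i z hz. symmetry; apply is_pd_unique, P.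
      * apply (Reg_Bd_mult1 Om (fun _ => 1) N
          (fun n z => RtoC (Derive phi ((sqnorm z - 1) / delta n)))
          (fun n z => RtoC (2 / delta n) * RtoC (coord b z))%C); auto; try (intros; lra).
        apply (Reg_Bd_mult1 Om (fun _ => 1) N
          (fun n z => RtoC (2 / delta n)) (fun n z => RtoC (coord b z))); auto; try (intros; lra).
        -- apply Reg_Bd_const; auto; [intros; lra|]. exists (2 * K), 1%nat. split; [lra|]. intros n.
           destruct (hd n) as [h1 h2]. assert (0 < / delta n) by (apply Rinv_0_lt_compat; auto).
           unfold Rdiv. rewrite Cmod_R, Rabs_right by nra. rewrite pow_1. nra.
        -- apply (Reg_coord Om rho); auto.
Qed.

(** Extension by zero. *)
Lemma Reg_extend (Om V : nat -> C -> Prop) E N : (forall i, open (Om i)) -> (forall i, open (V i)) ->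
  (forall i z, Om i z \/ V i z) -> (forall n, 0 <= E n) -> forall g : nat -> C -> C,
  (forall i z, V i z -> g i z = 0%C) ->
  Reg (Bd Om E) Om N g -> Reg (Bd (fun _ _ => True) E) (fun _ _ => True) N g.
Proof.
  intros hS hV hSV hE.
  assert (HB : forall g : nat -> C -> C, (forall i z, V i z -> g i z = 0%C) -> Bd Om E g -> Bd (fun _ _ => True) E g).
  { intros g H0 (A & p & hA & H). exists A, p. split; auto. intros n z _.
    destruct (hSV n z) as [h|h]; [auto|]. rewrite H0, Cmod_0 by auto.
    repeat apply Rmult_le_pos; auto. apply pow_le, pos_INR. }
  assert (HC : forall g : nat -> C -> C, (forall i z, V i z -> g i z = 0%C) -> (forall i z, Om i z -> continuous (g i) z) ->
    forall i z, True -> continuous (g i) z).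
  { intros g H0 H i z _. destruct (hSV i z) as [h|h]; auto.
    apply (continuous_ext_on (V i) (fun _ => RtoC 0)); auto; [|apply continuous_const].
    intros w hw. symmetry; auto. }
  induction N as [|N IH]; intros g H0 (Hc & Hb & Hd).
  - split; [|split; [|exact Logic.I]]; auto.
  - destruct Hd as [Hd Hr]. split; [|split; [|split]]; auto.
    + intros i z _. destruct (hSV i z) as [h|h]; auto.
      apply (diff_at_ext_loc (fun _ => RtoC 0)); [|apply diff_at_const].
      apply (locally_eq_on (V i)); auto. intros; symmetry; auto.
    + intros b. apply IH; auto. intros i z hz.
      rewrite <- (pd_ext_loc b (fun _ => RtoC 0) (g i) z), pd_const; auto.
      * apply (locally_eq_on (V i)); auto. intros; symmetry; auto.
      * apply diff_at_const.
Qed.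

Lemma Reg_wd_bound Om E w : (forall i, open (Om i)) -> (forall n, 0 <= E n) -> forall g,
  Reg (Bd Om E) Om (length w) g -> Bd Om E (fun n => wd w (g n)).
Proof.
  intros hS hE. induction w as [|l w IH]; intros g H.
  - apply (Reg_bound _ _ _ _ H).
  - apply (IH (fun n => Lop l (g n))). apply Reg_Bd_Lop; auto.
Qed.

(** The operator [dbar^N] annihilates [conj(z)^j z^n] when [j < N]. *)
Lemma dbar_monomial N n : forall j c z, (j < N)%nat ->
  wd (repeat lZbar N) (fun z => c * (Cconj z ^ j * z ^ n))%C z = 0%C.
Proof.
  pose (T := fun _ : C => True). assert (hT : open T) by apply open_true.
  induction N as [|N IH]; intros j c z hj; [lia|]. simpl.
  assert (E : Lop lZbar (fun z => c * (Cconj z ^ j * z ^ n))%C =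
    (fun z => (c * RtoC (INR j)) * (Cconj z ^ pred j * z ^ n))%C).
  { apply functional_extensionality; intros y.
    assert (d1 : diff_at (fun z => Cconj z ^ j)%C y)
      by (apply (Cn_diff 0 T); [apply smooth_zbarpow; auto|exact Logic.I]).
    assert (d2 : diff_at (fun z => z ^ n)%C y).
    { apply (Cn_diff 0 T); [apply (Cn_pow 1 T (fun z => z)); auto; apply Cn_id; auto|exact Logic.I]. }
    rewrite (Lop_scal lZbar c (fun z => Cconj z ^ j * z ^ n)%C)
      by (apply (diff_at_mult (fun z => Cconj z ^ j)%C (fun z => z ^ n)%C); auto).
    rewrite (Lop_mult lZbar (fun z => Cconj z ^ j)%C (fun z => z ^ n)%C) by auto.
    rewrite Lop_zbarpow, Lop_zpow, lzbar_Zbar, lz_Zbar. ring. }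
  rewrite E. destruct j as [|j].
  - replace (fun z => c * RtoC (INR 0) * (Cconj z ^ pred 0 * z ^ n))%C with (fun _ : C => RtoC 0).
    + apply wd_zero.
    + apply functional_extensionality; intros y. simpl. ring.
  - apply IH. simpl; lia.
Qed.

Lemma cser_zero (a : nat -> C) : (forall n, a n = 0%C) -> cser a = 0%C.
Proof.
  intros H. symmetry. apply (is_cser_eq a 0%C (fun n => / (INR (S n)) ^ 2)).
  - intros n. rewrite H, Cmod_0. left. apply Rinv_0_lt_compat, pow_lt, INR_S_pos.
  - apply ex_series_inv_sq.
  - intros eps he. exists O. intros M _.
    replace (csum M a - 0)%C with (RtoC 0); [rewrite Cmod_0; auto|].
    induction M as [|M IH]; simpl; [ring|]. rewrite H. rewrite IH. ring.
Qed.

(** The extension of one component. *)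
Lemma flat_component (a : nat -> C) N j k A c : (j < N)%nat -> 0 < k -> 0 < A -> 0 < c ->
  (forall n, Cmod (a n) <= A * W c (k / (k + 1)) n) ->
  exists (F : C -> C) (C1 C2 : R), smooth (fun _ => True) F /\ 0 < C1 /\ 0 < C2 /\
  (forall z, unit_disk z -> F z = cser (fun n => a n * (Cconj z ^ j * z ^ n))%C) /\
  (forall z, 2 <= Cmod z -> F z = 0%C) /\
  (forall z, 1 < Cmod z -> Cmod (Nat.iter N dbar F z) <= C1 * exp (- C2 * Rpower (Cmod z - 1) (- k))).
Proof.
  intros hj hk hA hc Ha.
  destruct cutoff_exists as (psi & Hpsi & Hpsi1 & Hpsi2).
  set (b := k / (k + 1)) in *. set (r := 1 / (k + 1)).
  assert (hb : 0 < b) by (apply Rdiv_lt_0_compat; lra).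
  assert (hr : 0 < r) by (apply Rdiv_lt_0_compat; lra).
  assert (hbr : b = 1 + - r) by (unfold b, r; field; lra).
  (* [delta_n = eps (n+1)^(-r)] is such that [(n+1) delta_n = eps (n+1)^b], and
    [eps <= c / 4] gives [(1 + 2 delta_n)^n <= exp (c/2 (n+1)^b)] *)
  set (eps := Rmin (c / 4) (1 / 2)).
  assert (he : 0 < eps) by (apply Rmin_glb_lt; lra).
  assert (he1 : eps <= c / 4) by apply Rmin_l. assert (he2 : eps <= 1 / 2) by apply Rmin_r.
  pose (delta := fun n => eps * Rpower (INR (S n)) (- r)).
  assert (hd0 : forall n, 0 < delta n) by (intros n; apply Rmult_lt_0_compat; [auto|apply exp_pos]).
  assert (hd1 : forall n, delta n <= 1 / 2).
  { intros n. unfold delta. pose proof (Rpower_exp_le (INR (S n)) (- r) 0 (INR_S_ge1 n) ltac:(lra)) as K.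
    rewrite Rpower_O in K by apply INR_S_pos.
    nra. }
  assert (hdinv : forall n, / delta n <= / eps * INR (S n)).
  { intros n. unfold delta. rewrite Rinv_mult. apply Rmult_le_compat_l; [left; apply Rinv_0_lt_compat; auto|].
    rewrite <- Rpower_Ropp, Ropp_involutive. apply Rpower_ge_1_le; [apply INR_S_ge1|].
    unfold r. apply Rmult_le_reg_r with (k + 1); [lra|]. unfold Rdiv. rewrite Rmult_assoc, Rinv_l; lra. }
  assert (hnd : forall n, INR (S n) * delta n = eps * Rpower (INR (S n)) b).
  { intros n. unfold delta. rewrite hbr, Rpower_plus, Rpower_1 by apply INR_S_pos. ring. }
  pose (S' := fun n z => Cmod z < 1 + 2 * delta n).
  pose (V := fun n z => 1 + delta n < Cmod z).
  assert (hS : forall i, open (S' i)) by (intros; apply open_diskr).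
  assert (hV : forall i, open (V i)) by (intros; apply open_exterior).
  assert (hSV : forall i z, S' i z \/ V i z).
  { intros i z. unfold S', V. specialize (hd0 i). destruct (Rlt_dec (Cmod z) (1 + 2 * delta i)); [left; auto|right; lra]. }
  pose (chi := fun n z => RtoC (psi ((sqnorm z - 1) / delta n))).
  pose (g := fun n z => ((a n * (Cconj z ^ j * z ^ n)) * chi n z)%C).
  assert (Hdiv : forall n u v, u * delta n <= v -> u <= v / delta n).
  { intros n u v h. apply Rmult_le_reg_r with (delta n); auto. unfold Rdiv.
    rewrite Rmult_assoc, Rinv_l by (specialize (hd0 n); lra). lra. }
  assert (Hdiv' : forall n u v, v <= u * delta n -> v / delta n <= u).
  { intros n u v h. apply Rmult_le_reg_r with (delta n); auto. unfold Rdiv.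
    rewrite Rmult_assoc, Rinv_l by (specialize (hd0 n); lra). lra. }
  assert (Hchi1 : forall n z, sqnorm z - 1 <= delta n -> chi n z = 1%C).
  { intros n z h. unfold chi. rewrite Hpsi1; [reflexivity|]. apply Hdiv'. lra. }
  assert (Hchi0 : forall n z, 2 * delta n <= sqnorm z - 1 -> chi n z = 0%C).
  { intros n z h. unfold chi. rewrite Hpsi2; [reflexivity|]. apply Hdiv. lra. }
  assert (HgV : forall n z, V n z -> g n z = 0%C).
  { intros n z h. unfold g. rewrite Hchi0; [ring|]. rewrite sqnorm_Cmod. unfold V in h.
    nra. }
  assert (hW : forall c n, 0 <= W c b n) by (intros; left; apply W_pos).
  pose (Winv := fun n => exp (c / 2 * Rpower (INR (S n)) b)).
  assert (hWi : forall n, 0 <= Winv n) by (intros; left; apply exp_pos).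
  assert (HReg : forall p, Reg (Bd S' (W (c / 2) b)) S' p g).
  { intros p.
    assert (Hrho : forall n z, S' n z -> Cmod z <= 2).
    { intros n z h. unfold S' in h. specialize (hd1 n). lra. }
    apply (Reg_Bd_mult S' (W (c / 2) b) (fun _ => 1) (W (c / 2) b) p
      (fun n z => a n * (Cconj z ^ j * z ^ n))%C chi); auto; try (intros; lra).
    - exists 1, 0%nat. split; [lra|]. intros n. specialize (hW (c / 2) n). simpl; lra.
    - apply (Reg_monomials S' (fun n => 1 + 2 * delta n) (W c b) Winv (W (c / 2) b) a A j p); auto.
      + intros n z h. unfold S' in h. specialize (hd1 n). lra.
      + lra.
      + intros q. exists 1. split; [lra|]. intros n. rewrite Rmult_1_l.
        pose proof (hd0 n) as d0.
        apply Rle_trans with ((1 + 2 * delta n) ^ n); [apply Rle_pow; [lra|lia]|].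
        apply Rle_trans with (exp (2 * delta n) ^ n).
        { apply pow_incr. split; [lra|]. apply exp_ineq1_le. }
        rewrite <- Rpower_pow by apply exp_pos. unfold Rpower, Winv. rewrite ln_exp. apply exp_le_compat.
        pose proof (hnd n) as hn. rewrite S_INR in hn at 1.
        assert (0 < Rpower (INR (S n)) b) by apply exp_pos. nra.
      + intros n. right. unfold W, Winv. rewrite <- exp_plus. f_equal. lra.
    - apply (Reg_cutoff S' 2 delta (/ eps)); auto.
      left; apply Rinv_0_lt_compat; auto. }
  assert (HRegT : forall p, Reg (Bd (fun _ _ => True) (W (c / 2) b)) (fun _ _ => True) p g).
  { intros p. apply (Reg_extend S' V); auto. }
  pose proof (open_true (T := C_UniformSpace)) as hT.
  assert (hsum : forall c', 0 < c' -> summable_weight (W c' b)) by (intros; apply W_summable; auto).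
  pose (F := fun z => cser (fun n => g n z)).
  assert (HF : smooth (fun _ => True) F).
  { intros p. apply (Reg_cser (fun _ => True) (W (c / 2) b)); auto. apply hsum; lra. }
  destruct (Reg_wd_bound (fun _ _ => True) (W (c / 2) b) (repeat lZbar N) (fun _ => hT) (hW (c / 2)) g (HRegT _))
    as (A' & p & hA' & HA').
  set (Sig := Series (fun n => INR (S n) ^ p * W (c / 4) b n)).
  assert (HSig : ex_series (fun n => INR (S n) ^ p * W (c / 4) b n)) by (apply hsum; lra).
  assert (hSig : 0 <= Sig).
  { eapply Rle_trans; [apply Rabs_pos|apply (series_bound (fun _ => 0))]; auto.
    intros n. rewrite Rabs_R0. apply Rmult_le_pos; auto. apply pow_le, pos_INR. }
  assert (F2 : forall z, 2 <= Cmod z -> F z = 0%C).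
  { intros z hz. apply cser_zero. intros n. apply HgV. unfold V. specialize (hd1 n). lra. }
  exists F, (A' * Sig + 1), (c / 4 * Rpower (eps / 3) k).
  assert (hC2 : 0 < c / 4 * Rpower (eps / 3) k) by (apply Rmult_lt_0_compat; [lra|apply exp_pos]).
  assert (hAS : 0 <= A' * Sig) by (apply Rmult_le_pos; auto).
  split; [auto|split; [lra|split; [auto|split; [|split; [auto|]]]]].
  - intros z hz. apply cser_ext. intros n. unfold g. rewrite Hchi1; [ring|].
    rewrite sqnorm_Cmod. unfold unit_disk in hz. pose proof (Cmod_ge_0 z). specialize (hd0 n). nra.
  - intros z hz. rewrite dbar_wd.
    set (ex := exp (- (c / 4 * Rpower (eps / 3) k) * Rpower (Cmod z - 1) (- k))).
    assert (hex : 0 < ex) by apply exp_pos.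
    destruct (Rlt_dec 2 (Cmod z)) as [h2|h2].
    { rewrite (wd_ext' _ (fun z => 2 < Cmod z) F (fun _ => RtoC 0)); auto.
      - rewrite wd_zero, Cmod_0. nra.
      - apply open_exterior.
      - intros q. apply (Cn_sub q (fun _ => True)); auto.
      - intros y hy. apply F2; lra. }
    unfold F. rewrite (wd_cser (fun _ => True) (W (c / 2) b)); auto; [|apply hsum; lra].
    apply Rle_trans with (A' * Sig * ex); [|nra].
    replace (A' * Sig * ex) with ((A' * ex) * Sig) by ring. unfold Sig. rewrite <- Series_scal_l.
    apply cser_bound; [|apply ex_series_scal_l_R; auto].
    intros n. assert (hpw : 0 <= INR (S n) ^ p) by (apply pow_le, pos_INR).
    destruct (Rlt_dec (sqnorm z - 1) (delta n)) as [hn|hn].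
    + assert (E : wd (repeat lZbar N) (g n) z = 0%C).
      { rewrite <- (dbar_monomial N n j (a n) z hj).
        apply (wd_ext' _ (fun z => sqnorm z < 1 + delta n)).
        - apply (open_comp sqnorm (fun x => x < 1 + delta n)); [intros; apply continuous_sqnorm|apply open_lt].
        - intros q. apply (Cn_sub q (fun _ => True)); auto. apply (Reg_Cn _ _ _ _ n (HRegT q)).
        - intros y hy. unfold g. rewrite Hchi1 by lra. ring.
        - lra. }
      rewrite E, Cmod_0. apply Rmult_le_pos; [apply Rmult_le_pos; lra|]. apply Rmult_le_pos; auto.
    + eapply Rle_trans; [apply HA'; exact Logic.I|]. rewrite W_half.
      replace (c / 2 / 2) with (c / 4) by field.
      rewrite Rmult_assoc, (Rmult_assoc A'). apply Rmult_le_compat_l; auto.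
      rewrite (Rmult_comm ex), <- !Rmult_assoc.
      apply Rmult_le_compat_l; [apply Rmult_le_pos; auto|].
      unfold W, ex. apply exp_le_compat.
      (* [|z|^2 - 1 <= 3 (|z| - 1)], as [|z| <= 2] *)
      assert (ht : delta n <= 3 * (Cmod z - 1)).
      { rewrite sqnorm_Cmod in hn. nra. }
      assert (hz1 : 0 < Cmod z - 1) by lra.
      assert (hx := INR_S_pos n).
      assert (K : Rpower (eps / 3) k * Rpower (Cmod z - 1) (- k) <= Rpower (INR (S n)) b).
      { replace b with (r * k) by (unfold b, r; field; lra). rewrite <- Rpower_mult.
        rewrite Rpower_Ropp.
        apply Rmult_le_reg_r with (Rpower (Cmod z - 1) k); [apply exp_pos|].
        rewrite Rmult_assoc, Rinv_l, Rmult_1_r by (apply Rgt_not_eq, exp_pos).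
        rewrite Rpower_mult_distr by (auto; apply exp_pos).
        apply Rpower_base_le; [|lra]. split; [lra|].
        unfold delta in ht. rewrite Rpower_Ropp in ht.
        set (y := Rpower (INR (S n)) r) in *. assert (hy : 0 < y) by apply exp_pos.
        apply (Rmult_le_compat_l y) in ht; [|lra].
        replace (y * (eps * / y)) with eps in ht by (field; lra). nra. }

      replace (- (c / 4 * Rpower (eps / 3) k) * Rpower (Cmod z - 1) (- k)) with
        (- (c / 4 * (Rpower (eps / 3) k * Rpower (Cmod z - 1) (- k)))) by ring.
      nra.
Qed.

(** * Compactness of the support, and the sum of the components *)

(** The open square with centre [p] and half-side [d]. *)
Definition box (p : C) (d : R) (w : C) : Prop := Rabs (Re w - Re p) < d /\ Rabs (Im w - Im p) < d.

Lemma locally_box (p : C) (d : posreal) x : box p d x -> locally x (box p d).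
Proof.
  intros [h1 h2].
  assert (he : 0 < Rmin (d - Rabs (Re x - Re p)) (d - Rabs (Im x - Im p))) by (apply Rmin_glb_lt; lra).
  exists (mkposreal _ he). intros w [k1 k2].
  change (Rabs (Re w - Re x) < Rmin (d - Rabs (Re x - Re p)) (d - Rabs (Im x - Im p))) in k1.
  change (Rabs (Im w - Im x) < Rmin (d - Rabs (Re x - Re p)) (d - Rabs (Im x - Im p))) in k2.
  pose proof (Rmin_l (d - Rabs (Re x - Re p)) (d - Rabs (Im x - Im p))).
  pose proof (Rmin_r (d - Rabs (Re x - Re p)) (d - Rabs (Im x - Im p))).
  pose proof (Rabs_triang (Re w - Re x) (Re x - Re p)) as t1.
  replace (Re w - Re x + (Re x - Re p)) with (Re w - Re p) in t1 by ring.
  pose proof (Rabs_triang (Im w - Im x) (Im x - Im p)) as t2.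
  replace (Im w - Im x + (Im x - Im p)) with (Im w - Im p) in t2 by ring.
  split; lra.
Qed.

(** The Heine-Borel theorem for the closure of a bounded set. *)
Lemma compact_closure (A : C -> Prop) (r : R) : (forall z, A z -> Cmod z <= r) -> is_compact (closure A).
Proof.
  intros HA I V hV Hcov.
  (* a square inside a member of the cover, or disjoint from the closure *)
  assert (Hd : forall p : C, exists d : posreal,
    (exists i, forall w, box p d w -> V i w) \/ (forall w, box p d w -> ~ closure A w)).
  { intros p. destruct (classic (closure A p)) as [h|h].
    - destruct (Hcov p h) as [i hi]. destruct (hV i p hi) as [e he]. exists e. left. exists i.
      intros w [k1 k2]. apply he. split; assumption.
    - apply not_all_ex_not in h. destruct h as [P h]. apply imply_to_and in h. destruct h as [[e he] h].
      exists e. right. intros w hw hcl.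
      destruct (hcl (box p e) (locally_box p e w hw)) as (y & [k1 k2] & k3).
      apply h. exists y. split; auto. apply he. split; assumption. }
  pose (delta := fun p => proj1_sig (constructive_indefinite_description _ (Hd p))).
  assert (Hdelta : forall p, (exists i, forall w, box p (delta p) w -> V i w) \/
    (forall w, box p (delta p) w -> ~ closure A w)).
  { intros p. apply (proj2_sig (constructive_indefinite_description _ (Hd p))). }
  clearbody delta.
  pose (pt := fun t : Compactness.Tn 2 R => (fst t, fst (snd t)) : C).
  pose (lo := (- r - 1, (- r - 1, tt)) : Compactness.Tn 2 R). pose (hi := (r + 1, (r + 1, tt)) : Compactness.Tn 2 R).
  pose proof (NNPP _ (compactness_list 2 lo hi (fun t => delta (pt t)))) as [l Hl].
  assert (HL : exists L : list I, forall t, In t l -> (exists w, box (pt t) (delta (pt t)) w /\ closure A w) ->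
    exists i, In i L /\ forall w, box (pt t) (delta (pt t)) w -> V i w).
  { clear Hl. induction l as [|t l [L IH]].
    - exists nil. intros t [].
    - destruct (Hdelta (pt t)) as [[i h]|h].
      + exists (i :: L). intros t' [<-|h'] H; [exists i; split; [left|]; auto|].
        destruct (IH t' h' H) as (i' & k1 & k2). exists i'. split; [right|]; auto.
      + exists L. intros t' [<-|h'] H; [destruct H as (w & k1 & k2); exfalso; apply (h w); auto|].
        apply IH; auto. }
  destruct HL as [L HL]. exists L. intros z hz.
  assert (hzr : Cmod z <= r).
  { apply Rnot_lt_le. intros h. destruct (hz (fun w => r < Cmod w) (open_exterior r z h)) as (w & k1 & k2).
    specialize (HA w k2). lra. }
  pose proof (re_le_Cmod z) as r1. pose proof (im_le_Cmod z) as r2.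
  assert (b1 : - r - 1 <= Re z <= r + 1) by (apply Rabs_le_between in r1; lra).
  assert (b2 : - r - 1 <= Im z <= r + 1) by (apply Rabs_le_between in r2; lra).
  destruct (Hl (Re z, (Im z, tt))) as (t & k1 & _ & k3).
  { simpl. auto. }
  destruct t as [t1 [t3 u]]. destruct k3 as (k3 & k4 & _).
  assert (hb : box (pt (t1, (t3, u))) (delta (pt (t1, (t3, u)))) z) by (split; assumption).
  destruct (HL _ k1 (ex_intro _ z (conj hb hz))) as (i & k5 & k6).
  exists i. split; auto.
Qed.

(** The extension of the sum of the first [K] components. *)
Lemma flat_extension_exists N k f : (1 <= N)%nat -> 0 < k -> gevrey_polyanalytic N k f ->
  forall K, (K <= N)%nat -> exists (F : C -> C) (C1 C2 : R), smooth (fun _ => True) F /\ 0 < C1 /\ 0 < C2 /\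
  (forall z, unit_disk z -> F z = csum K (fun j => RtoC (/ INR (fact j)) * (Cconj z ^ j * pcomp N f j z))%C) /\
  (forall z, 2 <= Cmod z -> F z = 0%C) /\
  (forall z, 1 < Cmod z -> Cmod (Nat.iter N dbar F z) <= C1 * exp (- C2 * Rpower (Cmod z - 1) (- k))).
Proof.
  intros hN hk Hg. pose proof (open_true (T := C_UniformSpace)) as hT.
  induction K as [|K IH]; intros hK.
  - exists (fun _ => RtoC 0), 1, 1. split; [apply smooth_const; auto|]. repeat (split; [lra || auto|]).
    intros z hz. rewrite dbar_wd, wd_zero, Cmod_0. rewrite Rmult_1_l. left; apply exp_pos.
  - destruct (IH ltac:(lia)) as (F & C1 & C2 & h1 & h2 & h3 & h4 & h5 & h6).
    destruct (coef_decay_of_gevrey N k f K hN hk Hg ltac:(lia)) as (A & c & hA & hc & HAc).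
    destruct (flat_component (fun n => RtoC (/ INR (fact K)) * coef (pcomp N f K) n)%C N K k A c)
      as (G & D1 & D2 & g1 & g2 & g3 & g4 & g5 & g6); auto.
    { intros n. rewrite Cmod_mult, Cmod_R.
      pose proof (inv_fact_bounds K).
      rewrite Rabs_right by lra. specialize (HAc n). pose proof (Cmod_ge_0 (coef (pcomp N f K) n)). nra. }
    exists (fun z => F z + G z)%C, (C1 + D1), (Rmin C2 D2).
    split; [intros n; apply Cn_plus; auto|]. split; [lra|]. split; [apply Rmin_glb_lt; auto|].
    split; [|split].
    + intros z hz. rewrite csum_S, h4, g4 by auto. f_equal. apply cser_component; auto. apply Hg.
    + intros z hz. rewrite h5, g5 by auto. ring.
    + intros z hz. rewrite dbar_wd, (wd_plus _ (fun _ => True)) by auto.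
      rewrite <- !dbar_wd. eapply Rle_trans; [apply Cmod_triangle|].
      set (q := Rpower (Cmod z - 1) (- k)) in *. assert (hq : 0 < q) by apply exp_pos.
      specialize (h6 z hz). specialize (g6 z hz). fold q in h6, g6.
      pose proof (Rmin_l C2 D2). pose proof (Rmin_r C2 D2).
      assert (exp (- C2 * q) <= exp (- Rmin C2 D2 * q)) by (apply exp_le_compat; nra).
      assert (exp (- D2 * q) <= exp (- Rmin C2 D2 * q)) by (apply exp_le_compat; nra).
      nra.
Qed.

Theorem corollary7p1 (N : nat) (k : R) (f : C -> C)
  (hN : (1 <= N)%nat) (hk : 0 < k) (hf : polyanalytic N f) :
  (gevrey_polyanalytic N k f ->
   exists (F : C -> C) (C1 C2 : R),
     smooth (fun _ => True) F /\ compactly_supported F /\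
     0 < C1 /\ 0 < C2 /\
     (forall z, unit_disk z -> F z = f z) /\
     dbar_flat N k C1 C2 (fun _ => True) F)
  /\
  ((exists (U : C -> Prop) (F : C -> C) (C1 C2 : R),
     open U /\ (forall z, closure unit_disk z -> U z) /\
     smooth U F /\
     0 < C1 /\ 0 < C2 /\
     (forall z, unit_disk z -> F z = f z) /\
     dbar_flat N k C1 C2 U F) ->
   gevrey_polyanalytic N k f).
Proof.
  split; [|apply gevrey_of_flat_extension; assumption].
  intros Hg.
  destruct (flat_extension_exists N k f hN hk Hg N (le_n N)) as (F & C1 & C2 & h1 & h2 & h3 & h4 & h5 & h6).
  exists F, C1, C2. split; [exact h1|]. split; [|split; [exact h2|split; [exact h3|split]]].
  - apply (compact_closure _ 2). intros z hz. apply Rnot_lt_le. intros h. apply hz, h5. lra.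
  - intros z hz. rewrite h4 by exact hz. symmetry. apply pcomp_sum; exact hN.
  - intros z _ hz. apply h6. rewrite closure_disk_iff in hz. lra.
Qed.
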